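(* Let $\mathcal G\rightrightarrows M$ be a Lie groupoid, let $\gamma\in\Omega^1(\mathcal G^{(2)})$ be such that the $\gamma$-deformed cotangent groupoid $(T^*\mathcal G)_\gamma\rightrightarrows A^*$ is defined, and let $\omega_B\in\Omega^2(\mathcal G)$. Then the 2-form $\omega_M:=\omega_{\mathrm{can}}+\mathrm{pr}_{\mathcal G}^*\omega_B\in\Omega^2(T^*\mathcal G)$ is multiplicative on $(T^*\mathcal G)_\gamma$ if and only if $\partial\omega_B=d\gamma$.
   Context: Conventions. $\mathcal G\rightrightarrows M$ has source $s$, target $t$, multiplication $m$, unit $u$, inverse $\iota$; $(g,h)$ is composable iff $s(g)=t(h)$; $\mathcal G^{(p)}$ denotes composable $p$-tuples; $L_g:h\mapsto gh$, $R_g:h\mapsto hg$; $A=\ker(s_* )|_M$, anchor $\rho=t_*$. The differential $\partial=\sum_i(-1)^i(\partial_i)^*:\Omega^q(\mathcal G^{(n-1)})\to\Omega^q(\mathcal G^{(n)})$ uses the face maps ($\partial_0$ drops the first arrow, $\partial_i$ multiplies the $i$-th and $(i+1)$-st, $\partial_n$ drops the last); for $\omega\in\Omega^q(\mathcal G)$: $\partial\omega=\mathrm{pr}_1^*\omega+\mathrm{pr}_2^*\omega-m^*\omega$. A form $\omega$ on the arrows of a Lie groupoid is multiplicative if $\mathrm{pr}_1^*\omega+\mathrm{pr}_2^*\omega-m^*\omega=0$ (with that groupoid's multiplication). $\omega_{\mathrm{can}}=d\vartheta_L$ with $\vartheta_L$ the Liouville one-form on $T^*\mathcal G$; $\mathrm{pr}_{\mathcal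 G}:T^*\mathcal G\to\mathcal G$ is the bundle projection. Cotangent groupoid maps: for $\xi\in T_g^*\mathcal G$, $\langle s_0(\xi),a\rangle=\langle\xi,(L_g)_*(a-u_*\rho(a))\rangle$; $\langle t_0(\xi),b\rangle=\langle\xi,(R_g)_*b\rangle$; $\langle u_0(\alpha),v\rangle=\langle\alpha,v-u_*s_*v\rangle$; $\iota_0(\xi)=-\iota^*\xi$. $\gamma$-deformed cotangent groupoid $(T^*\mathcal G)_\gamma\rightrightarrows A^*$: $T^*\mathcal G$ with structure maps, for $\xi\in T_k^*\mathcal G$, $\langle\hat s(\xi),a\rangle=\langle s_0(\xi),a\rangle+\gamma(0_k,\iota_*a)$ ($a\in A_{s(k)}$), $\langle\hat t(\xi),b\rangle=\langle t_0(\xi),b\rangle-\gamma(b,0_k)$ ($b\in A_{t(k)}$); $\langle\hat m(\xi_1,\xi_2),m_*(w_1,w_2)\rangle=\langle\xi_1,w_1\rangle+\langle\xi_2,w_2\rangle+\gamma(w_1,w_2)$ when $\hat s(\xi_1)=\hat t(\xi_2)$ and $s_*w_1=t_*w_2$; $\hat u=u_0$; $\langle\hat\iota(\xi),w\rangle=\langle\iota_0(\xi),w\rangle-\gamma(\iota_*w,w)$ ($w\in T_{k^{-1}}\mathcal G$). It is ''defined'' when these maps form a Lie groupoid. *)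

(* Defs.v *)
From HB Require Import structures.
From mathcomp Require Import all_boot all_order all_algebra.
From mathcomp Require Import all_classical all_reals all_analysis.

Set Implicit Arguments.
Unset Strict Implicit.
Unset Printing Implicit Defensive.

Import Order.TTheory GRing.Theory Num.Theory.
Import numFieldNormedType.Exports.

Local Open Scope classical_set_scope.
Local Open Scope ring_scope.

(* C^k and C^oo functions on a set [U], which is open wherever these are
   used. *)
Fixpoint Ck_on (R : realType) (V W : normedModType R) (k : nat) (U : set V)
    (f : V -> W) : Prop :=
  if k is k'.+1 then
    (forall x, U x -> differentiable f x) /\
    (forall v, Ck_on k' U (fun x => 'D_v f x))
  else forall x, U x -> {for x, continuous f}.

Definition smooth_on (R : realType) (V W : normedModType R) (U : set V)
    (f : V -> W) : Prop := forall k, Ck_on k U f.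

(* A chart is given by its domain and its coordinates; the values of [coord]
   outside of [dom] are irrelevant. *)
Record chart (R : realType) (n : nat) (T : Type) := Chart {
  dom : set T;
  coord :> T -> 'rV[R]_n }.

Section Charts.
Context {R : realType} {n : nat} {T : Type}.
Implicit Types phi psi : chart R n T.

Definition is_chart phi : Prop :=
  set_inj (dom phi) phi /\ open (phi @` dom phi).

(* [loc phi f] is f \o phi^-1; it is meaningful on phi (dom phi) only. *)
Definition loc (W : pointedType) phi (f : T -> W) (y : 'rV[R]_n) : W :=
  get (f @` [set x | dom phi x /\ phi x = y]).

Definition compatible phi psi : Prop :=
  let U := phi @` (dom phi `&` dom psi) in open U /\ smooth_on U (loc phi psi).

End Charts.

(* A set with an atlas. As in the usual "smooth manifold chart lemma", the
   topology is the one generated by the charts; [smooth_manifold] below says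
   when this data is a smooth manifold. *)
Record charted (R : realType) (n : nat) := Charted {
  carrier :> Type;
  atlas : set (chart R n carrier) }.

HB.instance Definition _ (R : realType) (n : nat) (X : charted R n) :=
  gen_eqMixin (carrier X).
HB.instance Definition _ (R : realType) (n : nat) (X : charted R n) :=
  gen_choiceMixin (carrier X).

Definition chart_open (R : realType) (n : nat) (X : charted R n) :
    set (set X) :=
  [set O | exists2 phi, atlas phi &
    exists2 V : set 'rV[R]_n, open V & O = dom phi `&` phi @^-1` V].

HB.instance Definition _ (R : realType) (n : nat) (X : charted R n) :=
  @isSubBaseTopological.Build (carrier X) (set X) (@chart_open R n X) id.

Section Manifolds.
Context {R : realType}.

Definition max_atlas n (X : charted R n) : set (chart R n X) :=
  [set phi | is_chart phi /\
    forall psi, atlas psi -> compatible phi psi /\ compatible psi phi].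
Arguments max_atlas {n} X phi.

Definition smooth_manifold n (X : charted R n) : Prop :=
  [/\ (forall x : X, exists2 phi, atlas phi & dom phi x),
      @atlas R n X `<=` max_atlas X,
      hausdorff_space X & @second_countable X].

Definition smooth n m (X : charted R n) (Y : charted R m) (f : X -> Y) : Prop :=
  continuous f /\
  forall phi psi, atlas phi -> atlas psi ->
    smooth_on (phi @` (dom phi `&` f @^-1` dom psi)) (loc phi (psi \o f)).

(* A preferred chart around each point. The tangent space of X at x is 'rV_n,
   a tangent vector being represented by its coordinates in [chart_at x]. *)
Definition chart_at n (X : charted R n) (x : X) : chart R n X :=
  match pselect (exists phi, atlas phi /\ dom phi x) with
  | left ex => projT1 (cid ex)
  | right _ => Chart set0 (fun=> 0)
  end.

(* The tangent vector at x with coordinates v in the chart phi. *)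
Definition tvec n (X : charted R n) (phi : chart R n X) (x : X)
    (v : 'rV[R]_n) : 'rV[R]_n :=
  'd (loc phi (chart_at x)) (phi x) v.

(* The coordinates in the chart phi of the tangent vector v at x. *)
Definition tcoord n (X : charted R n) (phi : chart R n X) (x : X)
    (v : 'rV[R]_n) : 'rV[R]_n :=
  'd (loc (chart_at x) phi) (chart_at x x) v.

Definition push n m (X : charted R n) (Y : charted R m) (f : X -> Y) (x : X)
    (v : 'rV[R]_n) : 'rV[R]_m :=
  'd (loc (chart_at x) (chart_at (f x) \o f)) (chart_at x x) v.

Definition submersion n m (X : charted R n) (Y : charted R m) (f : X -> Y) :
    Prop :=
  smooth f /\ forall x w, exists v, push f x v = w.

Definition prod_chart n m (X : charted R n) (Y : charted R m)
    (phi : chart R n X) (psi : chart R m Y) : chart R (n + m) (X * Y) :=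
  Chart [set p | dom phi p.1 /\ dom psi p.2]
        (fun p => row_mx (phi p.1) (psi p.2)).

Definition prod_manifold n m (X : charted R n) (Y : charted R m) :
    charted R (n + m) :=
  @Charted R (n + m) (X * Y)
    [set c | exists phi psi, [/\ atlas phi, atlas psi & c = prod_chart phi psi]].

(* The subset S with the charts induced by the k-slice charts of X: it is a
   smooth manifold when S is an embedded submanifold of dimension k. *)
Definition slice_chart n (X : charted R n) (S : set X) (k : nat)
    (phi : chart R n X) : Prop :=
  forall x, dom phi x -> (S x <-> forall j : 'I_n, (k <= j)%N -> phi x 0 j = 0).

Definition submanifold n (X : charted R n) (S : set X) (k : nat) :
    charted R k :=
  @Charted R k {x : X | S x}
    [set c | exists phi, [/\ max_atlas X phi, slice_chart S k phi &
       c = Chart [set x | dom phi (sval x)]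
                 (fun x => phi (sval x) *m (pid_mx k : 'M[R]_(n, k)))]].

End Manifolds.
Arguments max_atlas {R n} X phi.

(* The dual of a rank k subbundle E of the pullback of TX along u : B -> X.
   A point is a pair (b, alpha) with alpha a linear form on E_b, extended by 0
   outside E_b to have a unique representative. The charts are those given by
   a chart of B and a smooth frame of E on its domain, which is encoded as the
   matrix whose rows are the vectors of the frame. *)
Section DualBundle.
Context {R : realType} {m n : nat} {B : charted R m} {X : charted R n}.
Variables (u : B -> X) (E : B -> set 'rV[R]_n) (k : nat).

Definition linear_form_on (W : set 'rV[R]_n) (alpha : 'rV[R]_n -> R) : Prop :=
  (forall a v w, W v -> W w -> alpha (a *: v + w) = a * alpha v + alpha w) /\
  (forall v, ~ W v -> alpha v = 0).

Definition smooth_frame (phi : chart R m B) (e : B -> 'M[R]_(k, n)) : Prop :=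
  [/\ (forall b, dom phi b -> row_free (e b)),
      (forall b, dom phi b -> forall v, E b v <-> (v <= e b)%MS) &
      forall i (psi : chart R n X), atlas psi ->
        smooth_on (phi @` (dom phi `&` u @^-1` dom psi))
          (loc phi (fun b => tcoord psi (u b) (row i (e b))))].

Definition dual_bundle : charted R (m + k) :=
  @Charted R (m + k)
    {p : B * ('rV[R]_n -> R) | linear_form_on (E p.1) p.2}
    [set c | exists phi e, [/\ max_atlas B phi, smooth_frame phi e &
       c = Chart [set p | dom phi (sval p).1]
                 (fun p => row_mx (phi (sval p).1)
                    (\row_i (sval p).2 (row i (e (sval p).1))))]].

Definition base (p : dual_bundle) : B := (sval p).1.
Definition pairing (p : dual_bundle) (v : 'rV[R]_n) : R := (sval p).2 v.

End DualBundle.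
Arguments base {R m n B X u E k} p.
Arguments pairing {R m n B X u E k} p v.

Definition cotangent (R : realType) (n : nat) (X : charted R n) :
    charted R (n + n) :=
  dual_bundle (@id X) (fun=> setT) n.

Section Forms.
Context {R : realType}.

Definition smooth_form1 n (X : charted R n) (w : X -> 'rV[R]_n -> R) : Prop :=
  (forall x a v v', w x (a *: v + v') = a * w x v + w x v') /\
  (forall phi, atlas phi -> forall v,
    smooth_on (phi @` dom phi) (loc phi (fun x => w x (tvec phi x v)))).

Definition smooth_form2 n (X : charted R n)
    (w : X -> 'rV[R]_n -> 'rV[R]_n -> R) : Prop :=
  [/\ (forall x a v v' z, w x (a *: v + v') z = a * w x v z + w x v' z),
      (forall x v, w x v v = 0) &
      forall phi, atlas phi -> forall v z,
        smooth_on (phi @` dom phi)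
          (loc phi (fun x => w x (tvec phi x v) (tvec phi x z)))].

Definition pullback2 n m (X : charted R n) (Y : charted R m) (f : X -> Y)
    (w : Y -> 'rV[R]_m -> 'rV[R]_m -> R) : X -> 'rV[R]_n -> 'rV[R]_n -> R :=
  fun x v z => w (f x) (push f x v) (push f x z).

Definition ext_d n (X : charted R n) (w : X -> 'rV[R]_n -> R) :
    X -> 'rV[R]_n -> 'rV[R]_n -> R :=
  fun x v z =>
    let phi := chart_at x in
    let comp v' := loc phi (fun x' => w x' (tvec phi x' v')) in
    'D_v (comp z) (phi x) - 'D_z (comp v) (phi x).

Definition liouville n (X : charted R n) : cotangent X -> 'rV[R]_(n + n) -> R :=
  fun xi v => pairing xi (push (base : cotangent X -> X) xi v).

Definition omega_can n (X : charted R n) := ext_d (liouville (X := X)).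

End Forms.

(* Structure maps of a groupoid; (g, h) is composable when src g = tgt h, and
   the values of [gmul] on other pairs are irrelevant. *)
Record groupoid (G M : Type) := Groupoid {
  src : G -> M;
  tgt : G -> M;
  ident : M -> G;
  ginv : G -> G;
  gmul : G -> G -> G }.

Definition groupoid_axioms (G M : Type) (Gm : groupoid G M) : Prop :=
  [/\ (forall x, src Gm (ident Gm x) = x /\ tgt Gm (ident Gm x) = x),
      (forall g h, src Gm g = tgt Gm h ->
         src Gm (gmul Gm g h) = src Gm h /\ tgt Gm (gmul Gm g h) = tgt Gm g),
      (forall g h k, src Gm g = tgt Gm h -> src Gm h = tgt Gm k ->
         gmul Gm (gmul Gm g h) k = gmul Gm g (gmul Gm h k)),
      (forall g, gmul Gm (ident Gm (tgt Gm g)) g = g /\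
                 gmul Gm g (ident Gm (src Gm g)) = g) &
      (forall g, [/\ src Gm (ginv Gm g) = tgt Gm g,
                     tgt Gm (ginv Gm g) = src Gm g,
                     gmul Gm (ginv Gm g) g = ident Gm (src Gm g) &
                     gmul Gm g (ginv Gm g) = ident Gm (tgt Gm g)])].

(* The manifold of arrows has dimension m + r, where m is the dimension of the
   manifold of objects: this is no restriction as src is a submersion. *)
Section LieGroupoids.
Context {R : realType} {m r : nat} {M : charted R m} {G : charted R (m + r)}.
Variable Gm : groupoid G M.

Definition composables : charted R (m + r + r) :=
  submanifold (X := prod_manifold G G)
    [set p | src Gm p.1 = tgt Gm p.2] (m + r + r).

Definition pr1 (p : composables) : G := (sval p).1.
Definition pr2 (p : composables) : G := (sval p).2.
Definition mulc (p : composables) : G := gmul Gm (pr1 p) (pr2 p).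

Definition lie_groupoid : Prop :=
  [/\ smooth_manifold M, smooth_manifold G, groupoid_axioms Gm,
      submersion (src Gm) /\ submersion (tgt Gm) &
      [/\ smooth (ident Gm), smooth (ginv Gm) & smooth mulc]].

Definition simp_d2 (w : G -> 'rV[R]_(m + r) -> 'rV[R]_(m + r) -> R) :
    composables -> 'rV[R]_(m + r + r) -> 'rV[R]_(m + r + r) -> R :=
  fun p v z => pullback2 pr1 w p v z + pullback2 pr2 w p v z
               - pullback2 mulc w p v z.

Definition multiplicative2 (w : G -> 'rV[R]_(m + r) -> 'rV[R]_(m + r) -> R) :
    Prop :=
  forall p v z, simp_d2 w p v z = 0.

Definition algebroid (x : M) : set 'rV[R]_(m + r) :=
  [set a | push (src Gm) (ident Gm x) a = 0].

Definition dual_algebroid : charted R (m + r) :=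
  dual_bundle (ident Gm) algebroid r.

Definition anchor (x : M) (a : 'rV[R]_(m + r)) : 'rV[R]_m :=
  push (tgt Gm) (ident Gm x) a.

(* F_(g, h) (w1, w2) for F defined on tangent vectors of [composables], a
   tangent vector at (g, h) being identified with the pair (w1, w2) of its
   images under pr1 and pr2. *)
Definition on_pair (Z : pointedType) (F : composables -> 'rV[R]_(m + r + r) -> Z)
    (g h : G) (w1 w2 : 'rV[R]_(m + r)) : Z :=
  get [set z | exists p v, [/\ sval p = (g, h), push pr1 p v = w1,
                               push pr2 p v = w2 & z = F p v]].

(* L_g is defined on the t-fibre of src g and R_g on the s-fibre of tgt g;
   tangent vectors of these fibres are identified with their images in TG. *)
Definition push_along (S : set G) (f : submanifold S r -> G) (h : G)
    (w : 'rV[R]_(m + r)) : 'rV[R]_(m + r) :=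
  get [set z | exists (h' : submanifold S r) v,
    [/\ sval h' = h, push (sval : submanifold S r -> G) h' v = w &
        z = push f h' v]].

Definition push_L (g h : G) :=
  push_along (S := [set h | tgt Gm h = src Gm g])
    (fun h => gmul Gm g (sval h)) h.

Definition push_R (g h : G) :=
  push_along (S := [set h | src Gm h = tgt Gm g])
    (fun h => gmul Gm (sval h) g) h.

Section CotangentGroupoid.
Implicit Types (xi : cotangent G) (alpha : dual_algebroid).

Definition s0 xi (a : 'rV[R]_(m + r)) : R :=
  let g := base xi in let x := src Gm g in
  pairing xi (push_L g (ident Gm x) (a - push (ident Gm) x (anchor x a))).

Definition t0 xi (b : 'rV[R]_(m + r)) : R :=
  let g := base xi in pairing xi (push_R g (ident Gm (tgt Gm g)) b).

Definition u0 alpha (v : 'rV[R]_(m + r)) : R :=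
  let x := base alpha in
  pairing alpha (v - push (ident Gm) x (push (src Gm) (ident Gm x) v)).

(* w is tangent to G at the inverse of the base point of xi. *)
Definition i0 xi (w : 'rV[R]_(m + r)) : R :=
  - pairing xi (push (ginv Gm) (ginv Gm (base xi)) w).

Variable gamma : composables -> 'rV[R]_(m + r + r) -> R.

(* D consists of the structure maps of the gamma-deformed cotangent
   groupoid. *)
Definition deformed_cotangent (D : groupoid (cotangent G) dual_algebroid) :
    Prop :=
  [/\ (forall xi, let k := base xi in let x := src Gm k in
         base (src D xi) = x /\
         forall a, algebroid x a -> pairing (src D xi) a =
           s0 xi a
           + on_pair gamma k (ident Gm x) 0 (push (ginv Gm) (ident Gm x) a)),
      (forall xi, let k := base xi in let y := tgt Gm k in
         base (tgt D xi) = y /\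
         forall b, algebroid y b -> pairing (tgt D xi) b =
           t0 xi b - on_pair gamma (ident Gm y) k b 0),
      (forall xi1 xi2, src D xi1 = tgt D xi2 ->
         let k1 := base xi1 in let k2 := base xi2 in
         base (gmul D xi1 xi2) = gmul Gm k1 k2 /\
         forall w1 w2, push (src Gm) k1 w1 = push (tgt Gm) k2 w2 ->
           pairing (gmul D xi1 xi2) (on_pair (push mulc) k1 k2 w1 w2) =
           pairing xi1 w1 + pairing xi2 w2 + on_pair gamma k1 k2 w1 w2),
      (forall alpha, base (ident D alpha) = ident Gm (base alpha) /\
         forall v, pairing (ident D alpha) v = u0 alpha v) &
      (forall xi, let k := base xi in
         base (ginv D xi) = ginv Gm k /\
         forall w, pairing (ginv D xi) w =
           i0 xi w
           - on_pair gamma k (ginv Gm k) (push (ginv Gm) (ginv Gm k) w) w)].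

End CotangentGroupoid.
End LieGroupoids.
Arguments simp_d2 {R m r M G} Gm w p v z.
Arguments multiplicative2 {R m r M G} Gm w.
Arguments deformed_cotangent {R m r M G Gm} gamma D.

(* Main.v *)
From HB Require Import structures.
Require Import Defs.
From mathcomp Require Import all_boot all_order all_algebra.
From mathcomp Require Import all_classical all_reals all_analysis.
From mathcomp Require Import ring lra.

(** Write [theta] for the Liouville form of the cotangent bundle, [d] for the
    exterior derivative and [P] for the map [proj_arrows] which sends a
    composable pair of covectors to the pair of their base points.

    The multiplication of the deformed groupoid is defined by its values on the
    vectors [m_* (w1, w2)].  Evaluated on the projections of a tangent vector to
    the manifold of composable pairs of covectors, this definition reads
    [pr1^* theta + pr2^* theta + P^* gamma = m^* theta] ([liouville_mulc]).
    Since [d] commutes with pull-backs ([ext_d_pullback]), the simplicial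
    differential of [omega_can] is [- P^* (d gamma)] ([omega_can_mulc]).  The
    other summand of [omega_M] is pulled back along the bundle projection, which
    intertwines the two multiplications, so that the simplicial differential of
    [omega_M] is [P^* (partial omega_B - d gamma)] ([simp_d2_omega]).  This gives one
    implication at once, and the other one as soon as [P] is surjective on
    points ([proj_arrows_surj]) and on tangent vectors ([push_proj_surj]).

    Both surjectivities come from one fact.  On the cotangent space at an arrow
    [h], the target map of the deformed groupoid is affine, and its linear part
    is the transpose of the right translation [b |-> m_* (b, 0_h)]
    ([pairing_tgt]).  Right translation is injective because translation by the
    inverse arrow undoes it ([push_mulc_inj]), hence the linear part is onto
    ([translate_form]).  Given any covector over the first arrow, a covector
    over the second one can therefore be chosen to be composable with it, and
    a tangent vector at the second covector can be corrected by a vertical one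
    to match the source of a given vector at the first ([vertical_surj]).

    All of this is calculus on manifolds of composable pairs, whose charts are
    slice charts of a product.  That there are enough of them, and that the
    tangent vectors are the pairs [(w1, w2)] with [s_* w1 = t_* w2], is the
    regular value theorem ([equalizer_slice], [equalizer_tangent]), deduced from
    the inverse function theorem with a smooth inverse ([inverse_function]).
    The other analytic input is the symmetry of second derivatives
    ([smooth_near_schwarz]), on which the naturality of [d] rests. *)

Set Implicit Arguments.
Unset Strict Implicit.
Unset Printing Implicit Defensive.

Import Order.TTheory GRing.Theory Num.Theory.
Import numFieldNormedType.Exports.
Local Open Scope classical_set_scope.
Local Open Scope ring_scope.

(** * Differentials from estimates and from coordinates *)

Section Differential.
Context {R : realType}.

(** The remainder is bounded explicitly, which is the form in which a Lipschitz
    inverse function yields its derivative. *)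
Lemma is_diff_eps (V W : normedModType R) (f : V -> W) (df : {linear V -> W})
    (x : V) : continuous df ->
  (forall e : R, 0 < e ->
     \forall h \near (0 : V), `|f (h + x) - f x - df h| <= e * `|h|) ->
  is_diff x f df.
Proof.
move=> cdf H.
have E : f \o shift x = cst (f x) + df +o_ (0 : V) id.
  apply/eqaddoP => e e0; have := H e e0; apply: filterS => h.
  by rewrite /= !fctE opprD addrA.
have dE := diff_unique cdf E.
by apply: DiffDef => //; apply/diff_locallyP; rewrite dE.
Qed.

Lemma diff_epsP (V W : normedModType R) (f : V -> W) (x : V) :
  differentiable f x -> forall e : R, 0 < e ->
     \forall h \near (0 : V), `|f (h + x) - f x - 'd f x h| <= e * `|h|.
Proof.
move=> df e e0; have /eqaddoP/(_ e e0) := diff_locally df.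
by apply: filterS => h; rewrite /= !fctE opprD addrA.
Qed.

Lemma near_eq_is_diff (V W : normedModType R) (f g : V -> W) (x : V) :
  (\near x, f x = g x) -> differentiable f x -> is_diff x g ('d f x).
Proof.
move=> fg df; apply: is_diff_eps; first exact: diff_continuous.
move=> e e0; have := diff_epsP df e0.
have fg0 : \forall h \near (0 : V), f (h + x) = g (h + x).
  move: fg; rewrite (near_shift 0 x) /=; apply: filterS => h.
  by rewrite /= subr0.
have gx := nbhs_singleton fg.
by apply: filterS2 fg0 => h -> ; rewrite gx.
Qed.

Lemma near_eq_differentiable (V W : normedModType R) (f g : V -> W) (x : V) :
  (\near x, f x = g x) -> differentiable f x -> differentiable g x.
Proof. by move=> fg df; have [] := near_eq_is_diff fg df. Qed.

Lemma rV_linear_continuous n (W : normedModType R) (f : {linear 'rV[R]_n -> W}) :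
  continuous f.
Proof.
have -> : (f : _ -> _) =
    \sum_i (fun v : 'rV[R]_n => (v 0 i : R) *: f (delta_mx 0 i)).
  apply/funext => v; rewrite [in LHS](row_sum_delta v) linear_sum.
  by rewrite fct_sumE; apply: eq_bigr => i _; rewrite linearZ.
move=> v; apply: differentiable_continuous; apply: differentiable_sum => i.
exact/differentiableZl/differentiable_coord.
Qed.

Lemma rV_linear_diff n (W : normedModType R) (f : {linear 'rV[R]_n -> W}) x :
  is_diff x f f.
Proof.
apply: DiffDef; first exact/linear_differentiable/rV_linear_continuous.
by rewrite diff_lin //; exact: rV_linear_continuous.
Qed.

Lemma differentiable_rV (V : normedModType R) m (f : V -> 'rV[R]_m) (x : V) :
  differentiable f x <-> forall j, differentiable (fun y => f y 0 j : R) x.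
Proof.
split=> [df j|df].
  exact: (differentiable_comp df (differentiable_coord _ _ _)).
have -> : f = \sum_j (fun y => f y 0 j *: delta_mx 0 j).
  by apply/funext => y; rewrite {1}(row_sum_delta (f y)) fct_sumE.
by apply: differentiable_sum => j; exact: differentiableZl.
Qed.

Lemma diff_rVE (V : normedModType R) m (f : V -> 'rV[R]_m) (x v : V) j :
  differentiable f x -> ('d f x v) 0 j = 'd (fun y => f y 0 j : R) x v.
Proof.
pose c0 (N : 'rV[R]_m) : R := N 0 j.
have c0_lin : linear c0 by move=> a u w; rewrite /c0 !mxE.
pose c0M := GRing.isLinear.Build _ _ _ _ _ c0_lin.
pose c : {linear 'rV[R]_m -> R} := HB.pack c0 c0M.
move=> df; have [dc vc] := rV_linear_diff c (f x).
by have /(congr1 (@^~ v)) /= -> := diff_comp df dc; rewrite vc.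
Qed.

End Differential.

(** * Closure properties of functions of class C^k *)

Section CkCalculus.
Context {R : realType}.

Lemma Ck_congr (V W : normedModType R) k (U : set V) (f g : V -> W) :
  open U -> (forall x, U x -> f x = g x) -> Ck_on k U f -> Ck_on k U g.
Proof.
move=> oU; elim: k f g => [|k IHk] f g fg /=.
  move=> cf x Ux; have cfx := cf x Ux.
  suff : g @ x --> f x by rewrite fg.
  apply: cvg_trans cfx; apply: near_eq_cvg.
  by apply: filterS (open_nbhs_nbhs (conj oU Ux)) => y /fg.
have nfg x : U x -> \near x, f x = g x.
  by move=> Ux; apply: filterS (open_nbhs_nbhs (conj oU Ux)) => y /fg.
case=> df Df; split=> [x Ux|v]; first exact: near_eq_differentiable (nfg x Ux) (df x Ux).
by apply: IHk (Df v) => x Ux; exact/near_eq_derive/nfg.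
Qed.

Lemma Ck_subset (V W : normedModType R) k (U U' : set V) (f : V -> W) :
  U' `<=` U -> Ck_on k U f -> Ck_on k U' f.
Proof.
move=> UU; elim: k f => [|k IHk] f /=; first by move=> + x /UU; exact.
by case=> df Df; split=> [x /UU|v]; [exact: df|exact: IHk].
Qed.

(** Being of class C^k is a condition at each point; this is what allows
    smoothness to be handled through germs. *)
Lemma Ck_local (V W : normedModType R) k (U : set V) (f : V -> W) :
  (forall x, U x -> exists2 U', U' x & Ck_on k U' f) -> Ck_on k U f.
Proof.
elim: k f => [|k IHk] f /= H; first by move=> x /H[U' U'x]; exact.
split=> [x /H[U' U'x [+ _]]|v]; first exact.
by apply: IHk => x /H[U' U'x [_ Df]]; exists U'.
Qed.

Lemma Ck_S (V W : normedModType R) k (U : set V) (f : V -> W) :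
  Ck_on k.+1 U f -> Ck_on k U f.
Proof.
elim: k f => [|k IHk] f; last by case=> df Df; split=> // v; exact/IHk/Df.
by case=> df _ x Ux; exact/differentiable_continuous/df.
Qed.

Lemma Ck_cst (V W : normedModType R) k (U : set V) (c : W) :
  Ck_on k U (fun _ : V => c).
Proof.
elim: k c => [|k IHk] c /=; first by move=> x _; exact: cst_continuous.
split=> [x _|v]; first exact: differentiable_cst.
have -> : (fun x : V => 'D_v (fun=> c) x) = (fun=> 0 : W).
  by apply/funext => x; rewrite derive_cst.
exact: IHk.
Qed.

Lemma Ck_D (V W : normedModType R) k (U : set V) (f g : V -> W) : open U ->
  Ck_on k U f -> Ck_on k U g -> Ck_on k U (fun x => f x + g x).
Proof.
move=> oU; elim: k f g => [|k IHk] f g /=.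
  by move=> cf cg x Ux; apply: continuousD; [exact: cf|exact: cg].
case=> df Df [dg Dg]; split=> [x Ux|v].
  by apply: differentiableD; [exact: df|exact: dg].
apply: (Ck_congr oU _ (IHk _ _ (Df v) (Dg v))) => x Ux.
by rewrite deriveD //; apply: diff_derivable; [exact: df|exact: dg].
Qed.

Lemma Ck_sum (V W : normedModType R) k (U : set V) (I : Type) (r : seq I)
    (P : pred I) (f : I -> V -> W) :
  open U -> (forall i, P i -> Ck_on k U (f i)) ->
  Ck_on k U (fun x => \sum_(i <- r | P i) f i x).
Proof.
move=> oU Hf; elim: r => [|i r IHr].
  by apply: Ck_congr (Ck_cst k U 0) => // x _; rewrite big_nil.
have [Pi|nPi] := boolP (P i).
  by apply: Ck_congr (Ck_D oU (Hf i Pi) IHr) => // x _; rewrite big_cons Pi.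
by apply: Ck_congr IHr => // x _; rewrite big_cons (negbTE nPi).
Qed.

Lemma Ck_M (V : normedModType R) k (U : set V) (f g : V -> R) : open U ->
  Ck_on k U f -> Ck_on k U g -> Ck_on k U (fun x => f x * g x).
Proof.
move=> oU; elim: k f g => [|k IHk] f g /=.
  by move=> cf cg x Ux; apply: continuousM; [exact: cf|exact: cg].
move=> Cf Cg; have [df Df] := Cf; have [dg Dg] := Cg; split=> [x Ux|v].
  by apply: differentiableM; [exact: df|exact: dg].
have := Ck_D oU (IHk _ _ (Ck_S Cf) (Dg v)) (IHk _ _ (Ck_S Cg) (Df v)).
apply: Ck_congr => // x Ux.
by rewrite deriveM //; apply: diff_derivable; [exact: df|exact: dg].
Qed.

Lemma Ck_prod (V : normedModType R) k (U : set V) (I : Type) (r : seq I)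
    (f : I -> V -> R) :
  open U -> (forall i, Ck_on k U (f i)) ->
  Ck_on k U (fun x => \prod_(i <- r) f i x).
Proof.
move=> oU Hf; elim: r => [|i r IHr].
  by apply: Ck_congr (Ck_cst k U (1 : R)) => // x _; rewrite big_nil.
by apply: Ck_congr (Ck_M oU (Hf i) IHr) => // x _; rewrite big_cons.
Qed.

(** The derivative of [1 / f] is [- f' / f ^ 2], a product of functions which the
    induction on [k] covers. *)
Lemma Ck_V (V : normedModType R) k (U : set V) (f : V -> R) : open U ->
  (forall x, U x -> f x != 0) -> Ck_on k U f -> Ck_on k U (fun x => (f x)^-1).
Proof.
move=> oU; elim: k f => [|k IHk] f f0 /=.
  by move=> cf x Ux; apply: continuousV; [exact: f0|exact: cf].
move=> Cf; have [df Df] := Cf; split=> [x Ux|v].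
  by apply: differentiableV; [exact: df|exact: f0].
have Cf1 := IHk _ f0 (Ck_S Cf).
have := Ck_M oU (Ck_cst k U (-1 : R)) (Ck_M oU (Ck_M oU Cf1 Cf1) (Df v)).
apply: Ck_congr => // x Ux.
rewrite deriveV ?f0//; last by apply: diff_derivable; exact: df.
by rewrite -[_ *: _]/(_ * _) expr2 invfM mulN1r mulNr.
Qed.

Lemma Ck_rV (V : normedModType R) m k (U : set V) (f : V -> 'rV[R]_m) :
  open U -> Ck_on k U f <-> forall j, Ck_on k U (fun x => f x 0 j : R).
Proof.
move=> oU; elim: k f => [|k IHk] f /=; split.
- move=> cf j x Ux; 
  apply: (@continuous_comp _ _ _ f (fun N : 'rV[R]_m => N 0 j : R) x (cf x Ux)).
  exact: coord_continuous.
- move=> cf x Ux; apply/cvgrPdist_le => e e0; near=> y.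
  rewrite [leLHS]/Num.Def.normr/= mx_normrE (bigmax_le _ (ltW e0))//= => -[i j] _.
  rewrite !mxE ord1 /=; move: j; near: y; apply: filter_forall => /= j.
  exact: ((cvgrPdist_le _ _).1 (cf j x Ux)).
- case=> df Df j; split=> [x Ux|v]; first exact/(differentiable_rV _ _).1/df.
  have /IHk/(_ j) := Df v; apply: Ck_congr => // x Ux.
  by rewrite derive_mx ?mxE//; apply: diff_derivable; exact: df.
- move=> H; have df x : U x -> differentiable f x.
    by move=> Ux; apply/differentiable_rV => j; exact: (H j).1.
  split=> // v; apply/IHk => j; have := (H j).2 v; apply: Ck_congr => // x Ux.
  by rewrite derive_mx ?mxE//; apply: diff_derivable; exact: df.
Unshelve. all: by end_near. Qed.

Lemma diff_sum_coord m (W : normedModType R) (f : 'rV[R]_m -> W) x v :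
  differentiable f x -> 'd f x v = \sum_j v 0 j *: 'D_(delta_mx 0 j) f x.
Proof.
move=> df; rewrite {1}(row_sum_delta v) linear_sum; apply: eq_bigr => j _.
by rewrite linearZ deriveE.
Qed.

Lemma derive_comp (V : normedModType R) (V' W : normedModType R) (f : V -> V')
    (g : V' -> W) x v : differentiable f x -> differentiable g (f x) ->
  'D_v (fun y => g (f y)) x = 'd g (f x) ('D_v f x).
Proof.
move=> df dg; rewrite !deriveE //; last exact: (differentiable_comp df dg).
by have /(congr1 (@^~ v)) := diff_comp df dg.
Qed.

(** By the chain rule a derivative of [g \o f] is a sum of products of partial
    derivatives of [g], composed with [f], and derivatives of [f]; the induction
    on [k] applies to these compositions. *)
Lemma Ck_comp_R (V : normedModType R) m k (U : set V) (U' : set 'rV[R]_m)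
    (f : V -> 'rV[R]_m) (g : 'rV[R]_m -> R) : open U ->
  (forall x, U x -> U' (f x)) -> Ck_on k U f -> Ck_on k U' g ->
  Ck_on k U (fun x => g (f x)).
Proof.
move=> oU ff; elim: k f g ff => [|k IHk] f g ff /=.
  move=> cf cg x Ux; apply: (@continuous_comp _ _ _ f g x (cf x Ux)).
  exact: (cg (f x) (ff x Ux)).
move=> Cf [dg Dg]; have [df Df] := Cf; split=> [x Ux|v].
  exact: (@differentiable_comp _ _ _ _ f g x (df x Ux) (dg _ (ff x Ux))).
have : Ck_on k U (fun x => \sum_j ('D_v f x) 0 j * 'D_(delta_mx 0 j) g (f x)).
  apply: Ck_sum => // j _; apply: Ck_M => //; first exact: (Ck_rV k _ oU).1.
  by apply: (IHk f (fun y => 'D_(delta_mx 0 j) g y)) => //; exact: Ck_S.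
apply: Ck_congr => // x Ux; rewrite (derive_comp v (df x Ux) (dg _ (ff x Ux))).
by rewrite (diff_sum_coord _ (dg _ (ff x Ux))).
Qed.

Lemma Ck_comp (V : normedModType R) m p k (U : set V) (U' : set 'rV[R]_m)
    (f : V -> 'rV[R]_m) (g : 'rV[R]_m -> 'rV[R]_p) : open U -> open U' ->
  (forall x, U x -> U' (f x)) -> Ck_on k U f -> Ck_on k U' g ->
  Ck_on k U (fun x => g (f x)).
Proof.
move=> oU oU' ff Cf Cg; apply/Ck_rV => // j.
by apply: (@Ck_comp_R _ _ _ _ U' f (fun y => g y 0 j)) => //; exact: (Ck_rV k _ oU').1.
Qed.

Lemma Ck_linear n (W : normedModType R) k U (f : {linear 'rV[R]_n -> W}) :
  Ck_on k U f.
Proof.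
case: k => [|k]; first by move=> x _; exact: rV_linear_continuous.
split=> [x _|v]; first by have [] := rV_linear_diff f x.
have -> : (fun x => 'D_v f x) = (fun=> f v).
  by apply/funext => x; have [df vf] := rV_linear_diff f x; rewrite deriveE // vf.
exact: Ck_cst.
Qed.

Lemma Ck_det n (V : normedModType R) k (U : set V) (f : V -> 'M[R]_n) :
  open U -> (forall i j, Ck_on k U (fun x => f x i j : R)) ->
  Ck_on k U (fun x => \det (f x)).
Proof.
move=> oU Hf; rewrite /determinant; apply: Ck_sum => // s _.
by apply: Ck_M => //; [exact: Ck_cst|exact: Ck_prod].
Qed.

(** Cramer's rule expresses the entries of the inverse by determinants. *)
Lemma Ck_invmx n (V : normedModType R) k (U : set V) (f : V -> 'M[R]_n) :
  open U -> (forall x, U x -> f x \in unitmx) ->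
  (forall i j, Ck_on k U (fun x => f x i j : R)) ->
  forall i j, Ck_on k U (fun x => invmx (f x) i j : R).
Proof.
move=> oU fu Hf i j.
have : Ck_on k U (fun x => (\det (f x))^-1 *
    ((-1) ^+ (j + i) * \det (row' j (col' i (f x))))).
  apply: Ck_M => //.
    apply: Ck_V => //; last exact: Ck_det.
    by move=> x /fu; rewrite unitmxE unitfE.
  apply: Ck_M => //; first exact: Ck_cst.
  apply: Ck_det => // i' j'.
  rewrite (_ : (fun x => _) = (fun x => f x (lift j i') (lift i j'))); first exact: Hf.
  by apply/funext => x; rewrite !mxE.
by apply: Ck_congr => // x /fu fx; rewrite /invmx fx !mxE.
Qed.

End CkCalculus.

(** * Germs of smooth functions, symmetry of second derivatives *)

(** As in [smooth_on], one neighbourhood serves for all orders of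
    differentiability. *)
Definition smooth_near (R : realType) (V W : normedModType R) (f : V -> W)
  (x : V) := exists2 U, open_nbhs x U & smooth_on U f.

Section Germs.
Context {R : realType}.

Lemma near_open (T : topologicalType) (P : set T) x : (\forall y \near x, P y) ->
  exists2 U, open_nbhs x U & forall y, U y -> P y.
Proof. by move=> H; have : nbhs x P := H; rewrite nbhsE. Qed.

Lemma smooth_near_eq (V W : normedModType R) (f g : V -> W) x :
  (\near x, f x = g x) -> smooth_near f x -> smooth_near g x.
Proof.
move=> /near_open[U1 [oU1 U1x] fg] [U2 [oU2 U2x] sf].
exists (U1 `&` U2); first by split; [exact: openI|].
move=> k; apply: (@Ck_congr _ _ _ _ _ f); first exact: openI.
  by move=> y [/fg].
by apply: Ck_subset (sf k) => y [].
Qed.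

Lemma smooth_near_ext (V W : normedModType R) (f g : V -> W) x :
  f =1 g -> smooth_near f x -> smooth_near g x.
Proof. by move=> /funext ->. Qed.

Lemma smooth_near_near (V W : normedModType R) (f : V -> W) x :
  smooth_near f x -> \forall y \near x, smooth_near f y.
Proof.
case=> U [oU Ux] sf; apply: filterS (open_nbhs_nbhs (conj oU Ux)) => y Uy.
by exists U.
Qed.

Lemma smooth_near_differentiable (V W : normedModType R) (f : V -> W) x :
  smooth_near f x -> differentiable f x.
Proof. by case=> U [oU Ux] /(_ 1%N)[+ _]; exact. Qed.

Lemma smooth_near_continuous (V W : normedModType R) (f : V -> W) x :
  smooth_near f x -> {for x, continuous f}.
Proof. by move/smooth_near_differentiable/differentiable_continuous. Qed.

Lemma smooth_near_derive (V W : normedModType R) (f : V -> W) x v :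
  smooth_near f x -> smooth_near (fun y => 'D_v f y) x.
Proof. by case=> U oU sf; exists U => // k; exact: (sf k.+1).2. Qed.

Lemma smooth_onP (V W : normedModType R) (U : set V) (f : V -> W) : open U ->
  smooth_on U f <-> forall x, U x -> smooth_near f x.
Proof.
move=> oU; split=> [sf x Ux|H k]; first by exists U.
by apply: Ck_local => x /H[U' [oU' U'x] sf]; exists U'.
Qed.

Lemma smooth_near_cst (V W : normedModType R) (c : W) (x : V) :
  smooth_near (fun=> c) x.
Proof. by exists setT; [split=> //; exact: openT|move=> k; exact: Ck_cst]. Qed.

Lemma smooth_near_linear n (W : normedModType R) (f : {linear 'rV[R]_n -> W}) x :
  smooth_near f x.
Proof. by exists setT; [split=> //; exact: openT|move=> k; exact: Ck_linear]. Qed.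

Lemma nbhs_forall (T : topologicalType) (I : finType) (P : I -> set T) (x : T) :
  (forall i, nbhs x (P i)) -> nbhs x [set y | forall i, P i y].
Proof. by move=> H; apply: filter_forall. Qed.

Lemma smooth_near_family (V : normedModType R) (I : finType) (W : normedModType R)
    (f : I -> V -> W) x : (forall i, smooth_near (f i) x) ->
  exists2 U, open_nbhs x U & forall i, smooth_on U (f i).
Proof.
move=> H; have : \forall y \near x, forall i, smooth_near (f i) y.
  by apply: filter_forall => i; exact: smooth_near_near.
move=> /near_open[U [oU Ux] HU]; exists U => // i.
by apply/smooth_onP => // y /HU.
Qed.

Lemma smooth_near_pair (V W1 W2 : normedModType R) (f : V -> W1) (g : V -> W2) x :
  smooth_near f x -> smooth_near g x ->
  exists2 U, open_nbhs x U & smooth_on U f /\ smooth_on U g.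
Proof.
move=> [U1 [oU1 U1x] sf] [U2 [oU2 U2x] sg].
exists (U1 `&` U2); first by split; [exact: openI|].
split=> k; [apply: Ck_subset (sf k)|apply: Ck_subset (sg k)] => y [] //.
Qed.

Lemma smooth_near_add (V W : normedModType R) (f g : V -> W) x :
  smooth_near f x -> smooth_near g x -> smooth_near (fun x => f x + g x) x.
Proof.
move=> sf sg; have [U [oU Ux] [Sf Sg]] := smooth_near_pair sf sg.
by exists U => // k; apply: Ck_D.
Qed.

Lemma smooth_near_mul (V : normedModType R) (f g : V -> R) x :
  smooth_near f x -> smooth_near g x -> smooth_near (fun x => f x * g x) x.
Proof.
move=> sf sg; have [U [oU Ux] [Sf Sg]] := smooth_near_pair sf sg.
by exists U => // k; apply: Ck_M.
Qed.

Lemma smooth_near_opp (V : normedModType R) (f : V -> R) x :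
  smooth_near f x -> smooth_near (fun x => - f x) x.
Proof.
move=> sf; have := smooth_near_mul (smooth_near_cst (-1 : R) x) sf.
by apply: smooth_near_ext => y; rewrite mulN1r.
Qed.

Lemma smooth_near_sum (V W : normedModType R) (I : finType)
    (f : I -> V -> W) x :
  (forall i, smooth_near (f i) x) -> smooth_near (fun x => \sum_i f i x) x.
Proof.
move=> /smooth_near_family[U [oU Ux] H]; exists U => // k.
by apply: Ck_sum => // i _; exact: H.
Qed.

Lemma smooth_near_rV (V : normedModType R) m (f : V -> 'rV[R]_m) x :
  smooth_near f x <-> forall j, smooth_near (fun x => f x 0 j : R) x.
Proof.
split=> [[U [oU Ux] sf] j|H].
  by exists U => // k; exact: (Ck_rV k _ oU).1.
have [U [oU Ux] sf] := smooth_near_family H.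
by exists U => // k; apply/Ck_rV => // j; exact: sf.
Qed.

Lemma smooth_near_comp (V : normedModType R) m p (f : V -> 'rV[R]_m)
    (g : 'rV[R]_m -> 'rV[R]_p) x :
  smooth_near f x -> smooth_near g (f x) -> smooth_near (fun x => g (f x)) x.
Proof.
move=> sf; have cf := smooth_near_continuous sf.
move: sf => [U1 [oU1 U1x] sf] [U2 oU2 sg].
have : nbhs x (U1 `&` f @^-1` U2).
  have U2n : nbhs (f x) U2 by exact: open_nbhs_nbhs.
  have U2c : nbhs x (f @^-1` U2) by exact: cf U2n.
  by apply: filterI U2c; exact: open_nbhs_nbhs.
rewrite nbhsE => -[U [oU Ux] UU]; exists U => // k.
apply: (Ck_comp (U' := U2)) => //; first by have [] := oU2.
  by move=> y /UU[].
by apply: Ck_subset (sf k) => y /UU[].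
Qed.

Lemma smooth_near_comp_R (V : normedModType R) m (f : V -> 'rV[R]_m)
    (g : 'rV[R]_m -> R) x :
  smooth_near f x -> smooth_near g (f x) -> smooth_near (fun x => g (f x)) x.
Proof.
move=> sf sg; have sg' : smooth_near (fun y => \row_(_ < 1) g y) (f x).
  apply/smooth_near_rV => j; apply: smooth_near_ext sg => y.
  by rewrite mxE.
have /smooth_near_rV/(_ 0) := smooth_near_comp sf sg'.
by apply: smooth_near_ext => y; rewrite mxE.
Qed.

(** The units are open because the determinant is continuous, so it is enough to
    assume invertibility at the point. *)
Lemma smooth_near_invmx (V : normedModType R) n (f : V -> 'M[R]_n) x :
  f x \in unitmx -> (forall i j, smooth_near (fun x => f x i j : R) x) ->
  forall i j, smooth_near (fun x => invmx (f x) i j : R) x.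
Proof.
move=> fu H.
have [U [oU Ux] sf] := smooth_near_family (I := ('I_n * 'I_n)%type)
  (f := fun ij x => f x ij.1 ij.2) (fun ij => H ij.1 ij.2).
have sf' i j k : Ck_on k U (fun x => f x i j : R) by exact: (sf (i, j)).
have cdet : {for x, continuous (fun x => \det (f x))}.
  by apply: (Ck_det (k := 0) oU) => // i j; exact: sf'.
have : nbhs x (U `&` [set y | f y \in unitmx]).
  apply: filterI; first exact: open_nbhs_nbhs.
  have : \forall y \near x, \det (f y) != 0.
    have d0 : nbhs (\det (f x)) [set z : R | z != 0].
      apply: open_nbhs_nbhs; split; first exact: open_neq.
      by move: fu; rewrite unitmxE unitfE.
    exact: cdet _ d0.
  by apply: filterS => y; rewrite /= unitmxE unitfE.
rewrite nbhsE => -[U' [oU' U'x] UU] i j; exists U' => // k.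
apply: Ck_invmx => //; first by move=> y /UU[].
by move=> i' j'; apply: Ck_subset (sf' i' j' k) => y /UU[].
Qed.

End Germs.

Section Schwarz.
Context {R : realType}.

Lemma derive_line (V : normedModType R) (f : V -> R) (a v : V) (t : R) :
  differentiable f (a + t *: v) ->
  is_derive t 1 (fun s : R => f (a + s *: v)) ('D_v f (a + t *: v)).
Proof.
move=> df; have dl : is_derive t 1 (fun s : R => a + s *: v) v.
  have H : is_diff t (fun s : R => a + s *: v) (fun s => 0 + s *: v).
    exact: (is_diffD (is_diff_cst a (t : R)) (is_diff_scalel (t : R) v)).
  by apply: DeriveDef; [exact/diff_derivable/ex_diff|
    rewrite deriveE; [rewrite diff_val add0r scale1r|exact: ex_diff]].
have [dl1 dl2] := dl.
have dl3 : differentiable (fun s : R => a + s *: v) t by exact/derivable1_diffP.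
apply: DeriveDef.
  by apply: diff_derivable; apply: (@differentiable_comp _ _ _ _ _ f).
by rewrite (derive_comp (1 : R) dl3 df) dl2 deriveE.
Qed.

Lemma MVT_line (V : normedModType R) (f : V -> R) (a v : V) (t : R) : 0 < t ->
  (forall s, 0 <= s <= t -> differentiable f (a + s *: v)) ->
  exists2 c, 0 < c < t & f (a + t *: v) - f a = t * 'D_v f (a + c *: v).
Proof.
move=> t0 df.
have H s : 0 <= s <= t -> is_derive s 1 (fun s : R => f (a + s *: v)) ('D_v f (a + s *: v)).
  by move=> /df; exact: derive_line.
have [| |c] := @MVT R (fun s : R => f (a + s *: v)) (fun s => 'D_v f (a + s *: v)) 0 t t0.
- by move=> s /[!in_itv]/= /andP[s0 st]; apply: H; rewrite !ltW.
- apply: derivable_within_continuous => s; rewrite in_itv/= => /H.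
  by case.
rewrite in_itv/= => ct; rewrite scale0r addr0 subr0 => ->.
by exists c => //; rewrite mulrC.
Qed.

(** Two applications of the mean value theorem: in the direction [v], to the
    increment of [f] along [t *: w], then in the direction [w], to ['D_v f]. *)
Lemma second_difference (V : normedModType R) (f : V -> R) (x v w : V) (t : R) :
  0 < t ->
  (forall c d, 0 <= c <= t -> 0 <= d <= t ->
     differentiable f (x + c *: v + d *: w)) ->
  (forall c d, 0 <= c <= t -> 0 <= d <= t ->
     differentiable (fun y => 'D_v f y) (x + c *: v + d *: w)) ->
  exists c d, [/\ 0 < c < t, 0 < d < t &
    f (x + t *: v + t *: w) - f (x + t *: v) - (f (x + t *: w) - f x) =
      t * (t * 'D_w (fun y => 'D_v f y) (x + c *: v + d *: w))].
Proof.
move=> t0 df dDf; have tt : 0 <= t <= t by rewrite lexx ltW.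
have zt : 0 <= (0 : R) <= t by rewrite lexx ltW.
pose g y : R := f (y + t *: w) - f y.
have dsh s : 0 <= s <= t -> is_diff (x + s *: v) (fun y => f (y + t *: w))
   ('d f (x + s *: v + t *: w)).
  move=> st; have ds : is_diff (x + s *: v) (fun y : V => y + t *: w) (id + 0).
    exact: (is_diffD (is_diff_id _) (is_diff_cst (t *: w) (x + s *: v))).
  have [ds1 ds2] := ds; have df1 := df _ _ st tt.
  apply: DiffDef; first exact: (@differentiable_comp _ _ _ _ _ f).
  rewrite (@diff_comp _ _ _ _ (fun y : V => y + t *: w) f) // ds2.
  by apply/funext => y; rewrite /= addr0.
have dg s : 0 <= s <= t -> differentiable g (x + s *: v).
  move=> st; have [d1 _] := dsh s st; apply: differentiableB => //.
  by have := df _ _ st zt; rewrite scale0r addr0.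
have Dg s : 0 <= s <= t -> 'D_v g (x + s *: v) =
    'D_v f (x + s *: v + t *: w) - 'D_v f (x + s *: v).
  move=> st; have [d1 v1] := dsh s st.
  have d2 : differentiable f (x + s *: v).
    by have := df _ _ st zt; rewrite scale0r addr0.
  rewrite deriveB; [|exact: diff_derivable..].
  by rewrite (deriveE _ d1) v1 [in RHS]deriveE //; exact: df.
have [c ct] := MVT_line t0 dg; rewrite /g => ->.
have ct' : 0 <= c <= t by move: ct => /andP[? ?]; rewrite !ltW.
have [d dt Ed] := @MVT_line _ (fun y => 'D_v f y) (x + c *: v) w t t0
  (fun d dt => dDf c d ct' dt).
by exists c, d; split => //; rewrite (Dg c ct') Ed.
Qed.

Lemma continuous_dist (V : normedModType R) (g : V -> R) x (e : R) :
  {for x, continuous g} -> 0 < e -> nbhs x [set y | `|g x - g y| < e].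
Proof. by move=> /cvgrPdist_lt/(_ e) H /H; apply: filterS. Qed.

(** The second difference quotient of [f] is symmetric in [v] and [w], and it is
    a value of either mixed derivative at a point that tends to [x]. *)
Lemma smooth_near_schwarz (V : normedModType R) (f : V -> R) (x v w : V) :
  smooth_near f x -> 'D_w (fun y => 'D_v f y) x = 'D_v (fun y => 'D_w f y) x.
Proof.
move=> sf.
have cont u u' : {for x, continuous (fun y => 'D_u (fun z => 'D_u' f z) y)}.
  by apply: smooth_near_continuous; do 2![apply: smooth_near_derive].
apply/eqP; rewrite -subr_eq0 -normr_le0; apply/ler_addgt0Pr => e e0; rewrite add0r.
have e2 : 0 < e / 2 by rewrite divr_gt0.
pose P y := [/\ smooth_near f y,
  `|'D_w (fun z => 'D_v f z) x - 'D_w (fun z => 'D_v f z) y| < e / 2 &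
  `|'D_v (fun z => 'D_w f z) x - 'D_v (fun z => 'D_w f z) y| < e / 2].
have : \forall y \near x, P y.
  have N1 : nbhs x [set y | smooth_near f y] by exact: smooth_near_near.
  have N2 : nbhs x [set y |
      `|'D_w (fun z => 'D_v f z) x - 'D_w (fun z => 'D_v f z) y| < e / 2].
    exact: continuous_dist (cont w v) e2.
  have N3 : nbhs x [set y |
      `|'D_v (fun z => 'D_w f z) x - 'D_v (fun z => 'D_w f z) y| < e / 2].
    exact: continuous_dist (cont v w) e2.
  apply: filterS (filterI N1 (filterI N2 N3)) => y [a [b c]]; exact: And3 a b c.
move=> /nbhs_ballP[r r0 HP].
(* Small enough for the parallelogram spanned by [t *: v] and [t *: w] to lie in
   the ball of radius [r]. *)
pose t := r / 2 / (`|v| + `|w| + 1).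
have N0 : 0 < `|v| + `|w| + 1 by rewrite ltr_wpDl.
have t0 : 0 < t by rewrite !divr_gt0.
have inB c d : 0 <= c <= t -> 0 <= d <= t -> P (x + c *: v + d *: w).
  move=> /andP[c0 ct] /andP[d0 dt]; apply: HP.
  rewrite -ball_normE /ball_ /= -addrA opprD addrA subrr sub0r normrN.
  apply: (le_lt_trans (ler_normD _ _)); rewrite !normrZ !ger0_norm //.
  apply: (@le_lt_trans _ _ (t * (`|v| + `|w| + 1))).
    by rewrite !mulrDr mulr1 -[leLHS]addr0 !lerD // ?ler_wpM2r // ltW.
  by rewrite /t divfK ?gt_eqF // ltr_pdivrMr // ltr_pMr // ltr1n.
have Dif u c d : 0 <= c <= t -> 0 <= d <= t ->
    differentiable (fun y => 'D_u f y) (x + c *: v + d *: w).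
  by move=> hc hd; have [sfy _ _] := inB c d hc hd; exact/smooth_near_differentiable/smooth_near_derive.
have dif c d : 0 <= c <= t -> 0 <= d <= t ->
    differentiable f (x + c *: v + d *: w).
  by move=> hc hd; have [sfy _ _] := inB c d hc hd; exact: smooth_near_differentiable.
have [c [d [ct dt E1]]] := second_difference t0 dif (Dif v).
have [||d' [c' [dt' ct' E2]]] := @second_difference _ f x w v t t0.
- by move=> ? ? ? ?; rewrite addrAC; exact: dif.
- by move=> ? ? ? ?; rewrite addrAC; exact: Dif.
set A := 'D_w _ (x + c *: v + d *: w) in E1.
set B := 'D_v _ (x + d' *: w + c' *: v) in E2.
have AB : A = B.
  have tn0 : t != 0 by rewrite gt_eqF.
  apply: (mulfI tn0); apply: (mulfI tn0).
  have swap (p q q' s : R) : p - q - (q' - s) = p - q' - (q - s) by ring.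
  by apply: etrans (esym E1) (etrans (swap _ _ _ _) _); rewrite (addrAC x (t *: v)).
have ltW2 (z : R) : 0 < z < t -> 0 <= z <= t by move=> /andP[? ?]; rewrite !ltW.
have [_ A1 _] := inB c d (ltW2 _ ct) (ltW2 _ dt).
have [_ _ B1] := inB c' d' (ltW2 _ ct') (ltW2 _ dt').
rewrite (addrAC x (c' *: v)) in B1; rewrite -/A in A1; rewrite -/B -AB in B1.
set a := 'D_w _ x in A1 *; set b := 'D_v _ x in B1 *; clearbody a b A.
have -> : a - b = (a - A) - (b - A) by rewrite opprB addrA subrK.
rewrite (splitr e); apply: (le_trans (ler_normB _ _)).
exact: lerD (ltW A1) (ltW B1).
Qed.

End Schwarz.

(** * The inverse function theorem *)

HB.instance Definition _ (R : realType) n := Complete.on 'rV[R]_n.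

Section InverseFunction.
Context {R : realType} {n : nat}.
Implicit Types x y a : 'rV[R]_n.

Lemma norm_coord x j : `|x 0 j| <= `|x|.
Proof.
rewrite [leRHS]/Num.Def.normr/= mx_normrE.
exact: (le_bigmax _ (fun ij : 'I_1 * 'I_n => `|x ij.1 ij.2|) (0, j)).
Qed.

Lemma norm_le_coord x (e : R) : 0 <= e -> (forall j, `|x 0 j| <= e) -> `|x| <= e.
Proof.
move=> e0 H; rewrite [leLHS]/Num.Def.normr/= mx_normrE.
by apply: bigmax_le => // -[i j] _; rewrite (ord1 i) H.
Qed.

(** The bound on the entries accounts for the norm being the supremum of the
    coordinates. *)
Lemma norm_mulmx_half (M : 'M[R]_n) x :
  (forall i j, `|M i j| <= (2 * n.+1%:R)^-1) -> `|x *m M| <= 2^-1 * `|x|.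
Proof.
move=> HM; apply: norm_le_coord => [|j]; first by rewrite mulr_ge0 ?invr_ge0.
rewrite mxE; apply: (le_trans (ler_norm_sum _ _ _)).
apply: (@le_trans _ _ (\sum_(i < n) `|x| * (2 * n.+1%:R)^-1)).
  by apply: ler_sum => i _; rewrite normrM ler_pM ?norm_coord.
rewrite sumr_const card_ord -mulrnAr mulrC ler_wpM2r //.
rewrite -[leLHS]mulr_natr invfM -mulrA ler_piMr ?invr_ge0//.
by rewrite mulrC ler_pdivrMr ?ltr0n// mul1r ler_nat.
Qed.

Lemma jacobianE (T : 'rV[R]_n -> 'rV[R]_n) x i j : differentiable T x ->
  jacobian T x i j = 'D_(delta_mx 0 i) T x 0 j.
Proof. by move=> dT; rewrite /jacobian mxE deriveE. Qed.

Lemma mulmx_jacobian (T : 'rV[R]_n -> 'rV[R]_n) x v :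
  v *m jacobian T x = 'd T x v.
Proof. by rewrite /jacobian mul_rV_lin1. Qed.

(** The differential of the perturbed identity to which the contraction principle
    is applied. *)
Lemma jacobian_id_add (F : 'rV[R]_n -> 'rV[R]_n) (B : 'M[R]_n) x :
  differentiable F x ->
  jacobian (fun y => y + F y *m B) x = 1%:M + jacobian F x *m B.
Proof.
move=> dF; apply/row_matrixP => i; rewrite !rowE.
apply: (etrans (mulmx_jacobian _ _ _)).
have [d1 v1] := rV_linear_diff (mulmxr B) (F x).
have d2 := @differentiable_comp _ _ _ _ F _ _ dF d1.
have [_ E] : is_diff x (fun y => y + F y *m B) (id + 'd (mulmxr B \o F) x).
  exact: (is_diffD (is_diff_id x) (differentiableP d2)).
apply: (etrans (congr1 (@^~ _) E)) => /=.
rewrite mulmxDr mulmx1 mulmxA (mulmx_jacobian F); congr (_ + _).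
have Ec := congr1 (@^~ (delta_mx 0 i)) (diff_comp dF d1).
apply: (etrans Ec); exact: (congr1 (@^~ ('d F x (delta_mx 0 i))) v1).
Qed.

(** The mean value theorem along the segment from [y] to [x], applied to each
    coordinate: the segment stays in the ball, which is convex. *)
Lemma small_jacobian_lipschitz (T : 'rV[R]_n -> 'rV[R]_n) a (r : R) :
  (forall x, `|x - a| <= r -> differentiable T x) ->
  (forall x i j, `|x - a| <= r -> `|jacobian T x i j| <= (2 * n.+1%:R)^-1) ->
  forall x y, `|x - a| <= r -> `|y - a| <= r -> `|T x - T y| <= 2^-1 * `|x - y|.
Proof.
move=> dT sT x y xr yr.
apply: norm_le_coord => [|j]; first by rewrite mulr_ge0 ?invr_ge0.
have seg (s : R) : 0 <= s <= 1 -> `|y + s *: (x - y) - a| <= r.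
  move=> /andP[s0 s1].
  have -> : y + s *: (x - y) - a = s *: (x - a) + (1 - s) *: (y - a).
    by apply/rowP => i; rewrite !mxE; ring.
  rewrite (le_trans (ler_normD _ _))// !normrZ !ger0_norm ?subr_ge0//.
  have -> : r = s * r + (1 - s) * r by ring.
  by apply: lerD; rewrite ler_wpM2l ?subr_ge0.
pose g z : R := T z 0 j.
have dg s : 0 <= s <= 1 -> differentiable g (y + s *: (x - y)).
  by move=> /seg/dT/differentiable_rV/(_ j).
have [c c01] := MVT_line ltr01 dg.
have c01' : 0 <= c <= 1 by move: c01 => /andP[? ?]; rewrite !ltW.
have dTc := dT _ (seg c c01').
rewrite scale1r (addrC y) subrK mul1r /g => E; rewrite !mxE E.
rewrite deriveE -?diff_rVE//; last exact: dg.
rewrite -mulmx_jacobian.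
by apply: (le_trans (norm_coord _ _)); apply: norm_mulmx_half => i k; exact/sT/seg.
Qed.

Lemma half_contraction_fixpoint (T : 'rV[R]_n -> 'rV[R]_n) a (r : R) : 0 < r ->
  (forall x, `|a - x| <= r -> `|a - T x| <= r) ->
  (forall x y, `|a - x| <= r -> `|a - y| <= r -> `|T x - T y| <= 2^-1 * `|x - y|) ->
  exists2 p, `|a - p| <= r & p = T p.
Proof.
move=> r0 Tr lT; pose U : set 'rV[R]_n := closed_ball a r.
have UE x : U x <-> `|a - x| <= r by rewrite /U closed_ballE.
have TU : set_fun U U T by move=> x /UE/Tr/UE.
pose TM := isFun.Build _ _ U U T TU.
pose T' : {fun U >-> U} := HB.pack T TM.
have cT : is_contraction T'.
  have h0 : 0 <= 2^-1 :> R by rewrite invr_ge0.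
  exists (NngNum h0); split=> /=; first by rewrite invf_lt1 // ltr1n.
  by move=> [x y] [/UE Ux /UE Uy] /=; exact: lT.
have [||p Up Tp] := banach_fixed_point cT; last by exists p => //; exact/UE.
  exact: closed_ball_closed.
by exists a; apply/UE; rewrite subrr normr0 ltW.
Qed.

Lemma unitmx_inj (M : 'M[R]_n) : (forall v : 'rV_n, v *m M = 0 -> v = 0) -> M \in unitmx.
Proof.
move=> inj; rewrite -row_free_unit -kermx_eq0; apply/eqP/eqP/rowV0P => v.
by move/sub_kermxP/inj.
Qed.

Lemma smooth_near_jacobian (F : 'rV[R]_n -> 'rV[R]_n) x i j :
  smooth_near F x -> smooth_near (fun y => jacobian F y i j : R) x.
Proof.
move=> sF; have /smooth_near_rV/(_ j) := smooth_near_derive (delta_mx 0 i) sF.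
apply: smooth_near_eq; apply: filterS (smooth_near_near sF) => y sFy.
by rewrite jacobianE //; exact: smooth_near_differentiable.
Qed.

(** After composition with the inverse [B] of its Jacobian at [a], the map [F] is
    the identity minus a map [T] whose Jacobian vanishes at [a] and which is
    therefore a contraction of factor 1/2 on a small ball.  Hence [F] is
    injective there with a Lipschitz inverse [G], and [F x = y] is solved by
    Banach's fixed point theorem.  The Lipschitz bound makes [G] differentiable,
    with the inverse of the Jacobian of [F] at [G y] as its Jacobian; this
    expression has as many derivatives as [G], so that [G] is smooth. *)
Theorem inverse_function (F : 'rV[R]_n -> 'rV[R]_n) a (N : set 'rV[R]_n) :
  smooth_near F a -> jacobian F a \in unitmx -> nbhs a N ->
  exists U G, [/\ open_nbhs a U, U `<=` N, (forall x, U x -> G (F x) = x),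
    open (F @` U) & forall y, (F @` U) y -> smooth_near G y].
Proof.
move=> sF uJ nN; set B := invmx (jacobian F a).
have JB : jacobian F a *m B = 1%:M by exact: mulmxV.
have BJ : B *m jacobian F a = 1%:M by exact: mulVmx.
clearbody B.
pose T x := x + F x *m (- B).
have dF x : smooth_near F x -> differentiable F x.
  exact: smooth_near_differentiable.
have sT x : smooth_near F x -> smooth_near T x.
  move=> sFx; apply: smooth_near_add.
    exact: (smooth_near_linear (@idfun 'rV[R]_n)).
  apply: (@smooth_near_comp _ _ _ _ F (mulmxr (- B))) => //.
  exact: smooth_near_linear.
have JT x : smooth_near F x -> jacobian T x = 1%:M - jacobian F x *m B.
  by move=> sFx; rewrite /T (jacobian_id_add (- B) (dF _ sFx)) mulmxN.
have JTa : jacobian T a = 0 by rewrite JT // JB subrr.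
have c0 : 0 < (2 * n.+1%:R)^-1 :> R by rewrite invr_gt0 mulr_gt0 // ltr0n.
have near_a : nbhs a [set x | [/\ smooth_near F x, N x &
    forall i j, `|jacobian T x i j| < (2 * n.+1%:R)^-1]].
  have N1 : nbhs a [set x | smooth_near F x] by exact: (smooth_near_near sF).
  have N2 : nbhs a [set x | forall i j, `|jacobian T x i j| < (2 * n.+1%:R)^-1].
    pose P (ij : 'I_n * 'I_n) : set 'rV[R]_n :=
      [set x | `|jacobian T x ij.1 ij.2| < (2 * n.+1%:R)^-1].
    have HP ij : nbhs a (P ij).
      have := continuous_dist (smooth_near_continuous
        (smooth_near_jacobian ij.1 ij.2 (sT a sF))) c0.
      by apply: filterS => x; rewrite /P /= JTa mxE sub0r normrN.
    by apply: filterS (nbhs_forall HP) => x H i j; exact: (H (i, j)).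
  apply: filterS (filterI N1 (filterI nN N2)) => x [b1 [b2 b3]]; exact: And3 b1 b2 b3.
have [r r0 Hr] : exists2 r : R, 0 < r & forall x, `|x - a| <= r ->
    [/\ smooth_near F x, N x & forall i j, `|jacobian T x i j| < (2 * n.+1%:R)^-1].
  have /nbhs_closedballP[r Hr] := near_a.
  by exists r%:num => // x xr; apply: Hr; rewrite closed_ballE // /closed_ball_ /= distrC.
have lT x y : `|x - a| <= r -> `|y - a| <= r -> `|T x - T y| <= 2^-1 * `|x - y|.
  apply: small_jacobian_lipschitz => z => [/Hr[/sT/smooth_near_differentiable]//|].
  by move=> i j /Hr[_ _ /(_ i j)/ltW].
have FB x y : x - y = (T x - T y) + (F x - F y) *m B.
  by rewrite /T !mulmxN mulmxBl; apply/rowP => i; rewrite !mxE; ring.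
have lF x y : `|x - a| <= r -> `|y - a| <= r ->
    `|x - y| <= 2 * `|(F x - F y) *m B|.
  move=> xr yr; have := lT x y xr yr.
  have : `|x - y| <= `|T x - T y| + `|(F x - F y) *m B|.
    by rewrite {1}(FB x y) ler_normD.
  lra.
pose U : set 'rV[R]_n := ball a r.
have UE x : U x <-> `|x - a| < r by rewrite /U -ball_normE /ball_ /= distrC.
have Ule x : U x -> `|x - a| <= r by move/UE/ltW.
have [K K0 HK] := linear_lipschitz (@rV_linear_continuous R n _ (mulmxr B)).
have FBK y : y *m B *m jacobian F a = y by rewrite -mulmxA BJ mulmx1.
have imU : open (F @` U).
  rewrite openE => _ [x0 Ux0 <-]; have := (UE _).1 Ux0 => Ux0'.
  (* Half the distance from [x0] to the boundary of the ball, so that the closed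
     ball on which the fixed point is sought stays inside. *)
  pose d := (r - `|x0 - a|) / 2.
  have d0 : 0 < d by rewrite divr_gt0 // subr_gt0.
  have inU x : `|x0 - x| <= d -> U x.
    move=> xd; apply/UE; apply: (le_lt_trans (ler_distD x0 _ _)).
    rewrite distrC; have : 2 * d = r - `|x0 - a| by rewrite /d; field.
    lra.
  apply/nbhs_ballP; exists (d / 2 / K); first by apply: divr_gt0 => //; exact: divr_gt0.
  move=> y; rewrite -ball_normE /ball_ /= ltr_pdivlMr // mulrC => /ltW yd.
  have {}yd := le_trans (HK _) yd; rewrite /= in yd.
  (* The solutions of [F x = y] are the fixed points of [T + y *m B]. *)
  have [x xd|x x' xd x'd|p pd pE] := @half_contraction_fixpoint
    (fun x => T x + y *m B) x0 d d0.
  - have -> : x0 - (T x + y *m B) = (T x0 - T x) + (F x0 - y) *m B.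
      rewrite /T !mulmxN mulmxBl; apply/rowP => i; rewrite !mxE; ring.
    apply: (le_trans (ler_normD _ _)).
    have x0d : `|x0 - x0| <= d by rewrite subrr normr0 ltW.
    have := lT x0 x (Ule _ (inU _ x0d)) (Ule _ (inU _ xd)).
    lra.
  - rewrite opprD addrACA subrr addr0.
    exact: lT (Ule _ (inU _ xd)) (Ule _ (inU _ x'd)).
  - exists p; first exact: inU.
    apply/eqP; rewrite -subr_eq0 -(FBK (F p - y)) mulmxBl.
    move/eqP: pE; rewrite /T mulmxN -addrA -subr_eq0 opprD addNKr opprD opprK.
    by move=> /eqP ->; rewrite mul0mx.
pose G y := get [set x | U x /\ F x = y].
have GF x : U x -> G (F x) = x.
  move=> Ux; have : exists z, U z /\ F z = F x by exists x.
  move/getPex => [Uz Fz]; apply/eqP; rewrite -subr_eq0 -normr_le0.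
  by rewrite (le_trans (lF _ _ (Ule _ Uz) (Ule _ Ux))) // Fz subrr mul0mx normr0 mulr0.
clearbody G.
have unitU x : U x -> jacobian F x \in unitmx.
  move=> Ux; apply: unitmx_inj => v vJ; have [sFx _ HJ] := Hr x (Ule _ Ux).
  have := @norm_mulmx_half (jacobian T x) v (fun i j => ltW (HJ i j)).
  rewrite JT // mulmxBr mulmx1 mulmxA vJ mul0mx subr0 => Hv.
  apply/eqP; rewrite -normr_le0; lra.
have dG x : U x -> is_diff (F x) G (mulmxr (invmx (jacobian F x))).
  move=> Ux; have [sFx _ _] := Hr x (Ule _ Ux).
  apply: is_diff_eps; first exact: rV_linear_continuous.
  have := linear_lipschitz (@rV_linear_continuous R n _ (mulmxr (invmx (jacobian F x)))).
  move=> [L L0 HL] e e0.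
  have e'0 : 0 < e / L / (2 * K) by rewrite !divr_gt0 // mulr_gt0.
  have /nbhs_ballP[s s0 Hs] := diff_epsP (dF x sFx) e'0.
  have Vx : nbhs (F x) (F @` U).
    by apply: open_nbhs_nbhs; split=> //; exists x.
  have /nbhs_ballP[q q0 Hq] := Vx.
  apply/nbhs_ballP; exists (Num.min q (s / (2 * K))).
    by rewrite /= lt_min q0 divr_gt0 // mulr_gt0.
  move=> h; rewrite -ball_normE /ball_ /= sub0r normrN lt_min => /andP[hq hs].
  have [x' Ux' Fx'] : (F @` U) (h + F x).
    by apply: Hq; rewrite -ball_normE /ball_ /= opprD addrCA subrr addr0 normrN.
  rewrite -Fx' !GF //.
  have hE : h = F x' - F x by rewrite Fx' addrK.
  have ux : `|x' - x| <= 2 * K * `|h|.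
    apply: (le_trans (lF _ _ (Ule _ Ux') (Ule _ Ux))).
    by rewrite -mulrA ler_pM2l // -hE; exact: HK.
  have /Hs : ball 0 s (x' - x).
    rewrite -ball_normE /ball_ /= sub0r normrN; apply: (le_lt_trans ux).
    by rewrite -ltr_pdivlMl ?mulr_gt0 // mulrC.
  rewrite /= subrK -hE.
  have -> : 'd F x (x' - x) = (x' - x) *m jacobian F x by rewrite mulmx_jacobian.
  move=> Hh.
  have -> : x' - x - h *m invmx (jacobian F x) =
      - ((h - (x' - x) *m jacobian F x) *m invmx (jacobian F x)).
    by rewrite mulmxBl mulmxK ?unitU // opprB.
  rewrite normrN; apply: (le_trans (HL _)).
  have := ler_wpM2l (ltW L0) (le_trans Hh (ler_wpM2l (ltW e'0) ux)).
  move/le_trans; apply; rewrite le_eqVlt; apply/orP; left; apply/eqP.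
  by field; rewrite !gt_eqF.
exists U, G; split => //.
- by apply: ball_open_nbhs.
- by move=> x Ux; have [] := Hr x (Ule _ Ux).
- move=> y0 Vy0; exists (F @` U) => //.
  elim=> [|k IHk].
    by move=> _ [x Ux <-]; apply: differentiable_continuous; have [] := dG x Ux.
  split=> [_ [x Ux <-]|v]; first by have [] := dG x Ux.
  have H : Ck_on k (F @` U)
      (fun y => \row_j \sum_i v 0 i * invmx (jacobian F (G y)) i j).
    apply/(Ck_rV _ _ imU) => j.
    suff H : Ck_on k (F @` U)
        (fun y => \sum_i v 0 i * invmx (jacobian F (G y)) i j : R).
      by apply: (Ck_congr imU _ H) => y _; rewrite mxE.
    apply: (@Ck_sum R _ R k _ _ _ xpredT (fun i y => v 0 i *
      invmx (jacobian F (G y)) i j) imU) => i _.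
    apply: (Ck_M imU); first exact: Ck_cst.
    apply: (Ck_invmx imU) => [_ [x Ux <-]|i' j']; first by rewrite (GF x Ux); exact: unitU.
    have VU y : (F @` U) y -> U (G y) by move=> [x Ux <-]; rewrite GF.
    have sJ : smooth_on U (fun x => jacobian F x i' j' : R).
      apply/smooth_onP => [|x Ux]; first exact: ball_open.
      by have [sFx _ _] := Hr x (Ule _ Ux); exact: smooth_near_jacobian.
    exact: (Ck_comp_R imU VU IHk (sJ k)).
  apply: (Ck_congr imU _ H) => _ [x Ux <-]; have [d1 v1] := dG x Ux.
  rewrite (deriveE _ d1) v1 (GF x Ux); apply/rowP => j; rewrite !mxE.
  by apply: eq_bigr.
Qed.

End InverseFunction.

(** * Charts and the topology they generate *)

Section LocalCharts.
Context {R : realType} {n : nat} {X : charted R n}.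
Implicit Types (phi psi chi : chart R n X) (x : X).

(** The local conditions among those of [smooth_manifold], which are the ones that
    calculus in charts relies on. *)
Definition locally_euclidean : Prop :=
  (forall x, exists2 phi, atlas phi & dom phi x) /\ @atlas R n X `<=` max_atlas X.

Lemma locE (W : pointedType) phi (f : X -> W) x :
  is_chart phi -> dom phi x -> loc phi f (phi x) = f x.
Proof.
move=> [inj _] dx; rewrite /loc.
have : exists w, (f @` [set x' | dom phi x' /\ phi x' = phi x]) w.
  by exists (f x), x.
move=> /getPex[x' [dx' xx'] <-]; congr (f _).
by apply: inj; rewrite ?inE.
Qed.

Lemma chart_nbhs phi x : is_chart phi -> dom phi x ->
  nbhs (phi x) (phi @` dom phi).
Proof. by move=> [_ o] dx; apply: open_nbhs_nbhs; split => //; exists x. Qed.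

(** Neighbourhoods as seen in a single chart. *)
Definition chart_filter phi x : set (set X) :=
  [set P | nbhs (phi x) (phi @` (dom phi `&` P))].

Lemma chart_filter_filter phi x : is_chart phi -> dom phi x ->
  Filter (chart_filter phi x).
Proof.
move=> cphi dx; have [inj _] := cphi; split.
- by rewrite /chart_filter /= setIT; exact: chart_nbhs.
- move=> P Q; rewrite /chart_filter /= => HP HQ.
  apply: filterS (filterI HP HQ) => _ [[x1 [d1 P1] <-] [x2 [d2 Q2] e]].
  exists x1 => //; split=> //; split=> //.
  by rewrite -(inj x2 x1) ?inE.
- move=> P Q PQ; rewrite /chart_filter /=; apply: filterS => _ [x1 [d1 P1] <-].
  by exists x1 => //; split=> //; exact: PQ.
Qed.

Lemma compatible_near phi psi x : is_chart phi -> compatible phi psi ->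
  dom phi x -> dom psi x ->
  smooth_near (loc phi psi) (phi x) /\ chart_filter phi x (dom psi).
Proof.
move=> cphi [oU sU] dx dx'.
have Ux : (phi @` (dom phi `&` dom psi)) (phi x) by exists x.
by split; [exact/(smooth_onP _ oU).1|exact: open_nbhs_nbhs].
Qed.

(** Transition maps are continuous, so a neighbourhood seen in one chart is seen
    in every other chart around the point. *)
Lemma transition_filter phi psi x P : is_chart phi -> is_chart psi ->
  compatible phi psi -> dom phi x -> dom psi x ->
  chart_filter psi x P -> chart_filter phi x P.
Proof.
move=> cphi cpsi cc dx dx' HP.
have [sm nb] := compatible_near cphi cc dx dx'.
have cont : {for phi x, continuous (loc phi psi)} := smooth_near_continuous sm.
have HP' : nbhs (loc phi psi (phi x)) (psi @` (dom psi `&` P)).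
  by rewrite (locE psi cphi dx).
rewrite /chart_filter /= in nb *.
apply: filterS (filterI nb (cont _ HP')) => _ [[x1 [d1 d1'] <-]] /=.
rewrite (locE psi cphi d1) => -[x2 [d2 P2] e]; exists x1 => //; split => //.
by have [inj _] := cpsi; rewrite -(inj x2 x1) ?inE.
Qed.

Hypothesis le : locally_euclidean.

Lemma atlas_compatible phi psi : max_atlas X phi -> atlas psi ->
  compatible phi psi /\ compatible psi phi.
Proof. by move=> [_ H] /H. Qed.

Lemma max_chart phi : max_atlas X phi -> is_chart phi.
Proof. by case. Qed.

Lemma max_transition phi psi x P : max_atlas X phi -> max_atlas X psi ->
  dom phi x -> dom psi x -> chart_filter psi x P -> chart_filter phi x P.
Proof.
move=> mphi mpsi dx dx' HP; have [chi achi dchi] := le.1 x.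
have [c1 _] := atlas_compatible mphi achi.
have [_ c2] := atlas_compatible mpsi achi.
have cchi := max_chart (le.2 _ achi).
apply: (transition_filter (max_chart mphi) cchi c1 dx dchi).
exact: (transition_filter cchi (max_chart mpsi) c2 dchi dx').
Qed.

(** The topology was built from a subbase; this exposes its open sets. *)
Lemma open_chartE (O : set X) : open O <->
  [set \bigcup_(i in D) i | D in subset^~ (finI_from (@chart_open R n X) id)] O.
Proof. by []. Qed.

(** The topology generated by the chart domains is the one transported by any one
    chart.  For a finite intersection of subbasic sets this is seen chart by
    chart, with the help of the transition maps. *)
Lemma nbhs_atlas phi x P : atlas phi -> dom phi x ->
  nbhs x P <-> chart_filter phi x P.
Proof.
move=> aphi dx; have cphi := max_chart (le.2 _ aphi).
have FF := chart_filter_filter cphi dx.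
split; last first.
  rewrite /chart_filter /= nbhsE => -[V [oV Vx] VP]; rewrite nbhsE.
  exists (dom phi `&` phi @^-1` V).
    split=> //.
    apply/open_chartE; exists [set dom phi `&` phi @^-1` V]; last by rewrite bigcup_set1.
    move=> _ ->; apply: (@finI_from1 _ _ (@chart_open R n X) id).
    by exists phi => //; exists V.
  move=> x' [d' /VP [x2 [d2 P2] e]].
  by have [inj _] := cphi; rewrite -(inj x2 x') ?inE.
rewrite nbhsE => -[Q [oQ Qx] QP]; apply: (filterS QP).
move/open_chartE: oQ => [D HD DQ]; move: Qx; rewrite -DQ => -[S DS Sx].
apply: (@filterS _ _ _ S); first by move=> y Sy; exists S.
have [D' HD' DE] := HD _ DS; rewrite -DE in Sx *.
apply: filter_bigI => i iD'.
have [psi apsi [V oV iE]] : chart_open i by have := HD' _ iD'; rewrite inE.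
have : i x by apply: Sx.
rewrite iE => -[dpsi Vx].
have [c1 _] := atlas_compatible (le.2 _ aphi) apsi.
have cpsi := max_chart (le.2 _ apsi).
apply: (transition_filter cphi cpsi c1 dx dpsi).
rewrite /chart_filter /=; have Vn : nbhs (psi x) V by exact: open_nbhs_nbhs.
apply: filterS (filterI (chart_nbhs cpsi dpsi) Vn) => _ [[x1 d1 <-] V1].
by exists x1.
Qed.

Lemma nbhs_chart phi x P : max_atlas X phi -> dom phi x ->
  nbhs x P <-> chart_filter phi x P.
Proof.
move=> mphi dx; have [chi achi dchi] := le.1 x.
have mchi := le.2 _ achi.
split=> [/(nbhs_atlas _ achi dchi) H|H].
  exact: max_transition mphi mchi dx dchi H.
by apply/(nbhs_atlas _ achi dchi); exact: max_transition mchi mphi dchi dx H.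
Qed.

Lemma near_chart phi x P : max_atlas X phi -> dom phi x -> nbhs x P ->
  nbhs (phi x) (phi @` (dom phi `&` P)).
Proof. by move=> mphi dx /(nbhs_chart _ mphi dx). Qed.

Lemma near_dom phi x : max_atlas X phi -> dom phi x -> nbhs x (dom phi).
Proof.
move=> mphi dx; apply/(nbhs_chart _ mphi dx); rewrite /chart_filter /= setIid.
exact: chart_nbhs (max_chart mphi) dx.
Qed.

Lemma near_coord phi x V : max_atlas X phi -> dom phi x -> nbhs (phi x) V ->
  nbhs x (phi @^-1` V).
Proof.
move=> mphi dx nV; apply/(nbhs_chart _ mphi dx); rewrite /chart_filter /=.
apply: filterS (filterI (chart_nbhs (max_chart mphi) dx) nV).
by move=> _ [[x1 d1 <-] V1]; exists x1.
Qed.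

Lemma chart_atP x : atlas (chart_at x) /\ dom (chart_at x) x.
Proof.
rewrite /chart_at; case: pselect => [ex|]; first exact: (projT2 (cid ex)).
by have [phi ? ?] := le.1 x; case; exists phi.
Qed.

Lemma chart_at_max x : max_atlas X (chart_at x).
Proof. exact/le.2/(chart_atP x).1. Qed.

Lemma chart_at_dom x : dom (chart_at x) x. Proof. exact: (chart_atP x).2. Qed.

End LocalCharts.
Arguments locally_euclidean {R n} X.

(** * Smooth maps and the chain rule for tangent maps *)

(** Smoothness in all compatible charts and not only in those of the atlas: slice
    charts and frame charts are built on charts of the maximal atlas. *)
Definition smooth_at (R : realType) n m (X : charted R n) (Y : charted R m)
    (f : X -> Y) (x : X) : Prop :=
  {for x, continuous f} /\
  forall phi psi, max_atlas X phi -> max_atlas Y psi -> dom phi x ->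
    dom psi (f x) -> smooth_near (loc phi (psi \o f)) (phi x).

Section SmoothMaps.
Context {R : realType} {n m : nat} {X : charted R n} {Y : charted R m}.
Hypotheses (leX : locally_euclidean X) (leY : locally_euclidean Y).
Implicit Types (f : X -> Y) (x : X).

(** The local expression of a composition is the composition of the local
    expressions only where these make sense, hence the germs. *)
Lemma loc_comp_near (W : pointedType) f (g : Y -> W) x phi psi :
  max_atlas X phi -> max_atlas Y psi -> dom phi x ->
  nbhs x (f @^-1` dom psi) ->
  nbhs (phi x) [set y | loc psi g (loc phi (psi \o f) y) = loc phi (g \o f) y].
Proof.
move=> mphi mpsi dx nf.
apply: filterS (near_chart leX mphi dx nf) => _ [x1 [d1 df1] <-] /=.
rewrite !(locE _ (max_chart mphi) d1) /=.
by rewrite (locE _ (max_chart mpsi) df1).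
Qed.

Lemma smooth_at_near_dom f x psi : smooth_at f x -> max_atlas Y psi ->
  dom psi (f x) -> nbhs x (f @^-1` dom psi).
Proof. by move=> [cf _] mpsi dfx; exact: cf _ (near_dom leY mpsi dfx). Qed.

Lemma is_diff_loc_comp (W : normedModType R) f (g : Y -> W) x phi psi :
  max_atlas X phi -> max_atlas Y psi -> dom phi x ->
  nbhs x (f @^-1` dom psi) -> differentiable (loc phi (psi \o f)) (phi x) ->
  differentiable (loc psi g) (psi (f x)) ->
  is_diff (phi x) (loc phi (g \o f))
    ('d (loc psi g) (psi (f x)) \o 'd (loc phi (psi \o f)) (phi x)).
Proof.
move=> mphi mpsi dx nf df dg.
have E : loc phi (psi \o f) (phi x) = psi (f x).
  exact: (locE (psi \o f) (max_chart mphi) dx).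
rewrite -E in dg *.
rewrite -(diff_comp df dg); apply: near_eq_is_diff.
  exact: loc_comp_near mphi mpsi dx nf.
exact: differentiable_comp.
Qed.

Lemma smooth_near_loc_comp p f (g : Y -> 'rV[R]_p) x phi psi :
  max_atlas X phi -> max_atlas Y psi -> dom phi x ->
  nbhs x (f @^-1` dom psi) -> smooth_near (loc phi (psi \o f)) (phi x) ->
  smooth_near (loc psi g) (psi (f x)) -> smooth_near (loc phi (g \o f)) (phi x).
Proof.
move=> mphi mpsi dx nf sf.
rewrite -(locE (psi \o f) (max_chart mphi) dx : _ = psi (f x)) => sg.
apply: smooth_near_eq (smooth_near_comp sf sg).
exact: loc_comp_near mphi mpsi dx nf.
Qed.

End SmoothMaps.

Section Transition.
Context {R : realType} {n : nat} {X : charted R n}.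
Hypothesis leX : locally_euclidean X.

Lemma nbhs_id_dom (x : X) psi : max_atlas X psi -> dom psi x ->
  nbhs x ((@id X) @^-1` dom psi).
Proof. by move=> mpsi dx; have H := near_dom leX mpsi dx; exact: H. Qed.

Lemma smooth_transition (x : X) phi psi : max_atlas X phi -> max_atlas X psi ->
  dom phi x -> dom psi x -> smooth_near (loc phi psi) (phi x).
Proof.
move=> mphi mpsi dx dx'.
have [[chi achi dchi] mchi] := (leX.1 x, leX.2).
have [c1 _] := atlas_compatible mphi achi.
have [_ c2] := atlas_compatible mpsi achi.
have [s1 _] := compatible_near (max_chart mphi) c1 dx dchi.
have [s2 _] := compatible_near (max_chart (mchi _ achi)) c2 dchi dx'.
apply: (@smooth_near_loc_comp _ _ _ X X leX _ id psi x phi chi) => //.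
  exact: mchi.
exact: nbhs_id_dom (mchi _ achi) dchi.
Qed.

End Transition.

Section SmoothMaps2.
Context {R : realType} {n m : nat} {X : charted R n} {Y : charted R m}.
Hypotheses (leX : locally_euclidean X) (leY : locally_euclidean Y).
Implicit Types (f : X -> Y) (x : X).

(** One pair of charts is enough, since transition maps are smooth.  Continuity
    of [f] follows from that of its local expression. *)
Lemma smooth_atI f x phi psi : max_atlas X phi -> max_atlas Y psi ->
  dom phi x -> dom psi (f x) -> nbhs x (f @^-1` dom psi) ->
  smooth_near (loc phi (psi \o f)) (phi x) -> smooth_at f x.
Proof.
move=> mphi mpsi dx dfx nf sf; split.
  move=> P /(near_chart leY mpsi dfx) HP.
  have E : loc phi (psi \o f) (phi x) = psi (f x).
    exact: (locE (psi \o f) (max_chart mphi) dx).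
  have HP' : nbhs (loc phi (psi \o f) (phi x)) (psi @` (dom psi `&` P)).
    by rewrite E.
  have := near_coord leX mphi dx (smooth_near_continuous sf HP').
  move=> H; apply: filterS (filterI (near_dom leX mphi dx) (filterI nf H)).
  move=> x1 [d1 [d2 /= ]]; rewrite (locE _ (max_chart mphi) d1) /=.
  move=> [y [dy Py] e]; have [inj _] := max_chart mpsi.
  by rewrite -(inj y (f x1)) ?inE.
move=> phi' psi' mphi' mpsi' dx' dfx'.
have H : smooth_near (loc phi (psi' \o f)) (phi x).
  apply: (smooth_near_loc_comp leX (psi := psi)) => //.
  exact: smooth_transition.
apply: (@smooth_near_loc_comp _ _ _ X X leX _ id (psi' \o f) x phi' phi) => //.
  exact: nbhs_id_dom.
exact: smooth_transition.
Qed.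

Lemma smooth_smooth_at f x : smooth f -> smooth_at f x.
Proof.
move=> [cf sf]; have [[phi aphi dx] [psi apsi dfx]] := (leX.1 x, leY.1 (f x)).
have mphi := leX.2 _ aphi; have mpsi := leY.2 _ apsi.
have nf x' : dom psi (f x') -> nbhs x' (f @^-1` dom psi).
  by move=> d'; exact: cf _ _ (near_dom leY mpsi d').
apply: (@smooth_atI f x phi psi) => //; first exact: nf.
exists (phi @` (dom phi `&` f @^-1` dom psi)); last exact: sf.
split; last by exists x.
rewrite openE => _ [x1 [d1 df1] <-].
have H := near_chart leX mphi d1 (nf _ df1); exact: H.
Qed.

Lemma smooth_at_loc f x phi psi : smooth_at f x -> max_atlas X phi ->
  max_atlas Y psi -> dom phi x -> dom psi (f x) ->
  differentiable (loc phi (psi \o f)) (phi x).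
Proof.
by move=> [_ H] mphi mpsi dx dfx; exact/smooth_near_differentiable/H.
Qed.

Lemma push_is_linear f x a v w :
  push f x (a *: v + w) = a *: push f x v + push f x w.
Proof. by rewrite /push linearP. Qed.

Lemma pushD f x v w : push f x (v + w) = push f x v + push f x w.
Proof. by rewrite /push linearD. Qed.

Lemma pushB f x v w : push f x (v - w) = push f x v - push f x w.
Proof. by rewrite /push linearB. Qed.

Lemma push0 f x : push f x 0 = 0.
Proof. by rewrite /push linear0. Qed.

(** A tangent vector is represented by its coordinates in the preferred chart,
    and [tcoord] passes to another chart; this is the chain rule for that change
    of chart. *)
Lemma diff_loc_tcoord (W : normedModType R) (g : X -> W) x phi v :
  max_atlas X phi -> dom phi x -> differentiable (loc phi g) (phi x) ->
  'd (loc (chart_at x) g) (chart_at x x) v = 'd (loc phi g) (phi x) (tcoord phi x v).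
Proof.
move=> mphi dx dg.
have st : smooth_near (loc (chart_at x) phi) (chart_at x x).
  apply: (smooth_transition leX) => //; first exact: chart_at_max.
  exact: chart_at_dom.
have := @is_diff_loc_comp _ _ _ X X leX W id g x (chart_at x) phi
  (chart_at_max leX x) mphi (chart_at_dom leX x) (nbhs_id_dom leX mphi dx)
  (smooth_near_differentiable st) dg.
by move=> [_ E]; exact: (congr1 (@^~ v) E).
Qed.

Lemma tvec_tcoord x phi v : max_atlas X phi -> dom phi x ->
  tvec phi x (tcoord phi x v) = v.
Proof.
move=> mphi dx; rewrite /tvec -diff_loc_tcoord //; last first.
  apply: smooth_near_differentiable; apply: (smooth_transition leX) => //.
    exact: chart_at_max.
  exact: chart_at_dom.
have E : nbhs (chart_at x x) [set y | y = loc (chart_at x) (chart_at x) y].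
  apply: filterS (near_chart leX (chart_at_max leX x) (chart_at_dom leX x)
    (filterT)) => _ [x1 [d1 _] <-] /=.
  by rewrite (locE _ (max_chart (chart_at_max leX x))).
have [did vid] := is_diff_id (chart_at x x : 'rV[R]_n).
by have [_ ->] := near_eq_is_diff E did; rewrite vid.
Qed.

Lemma tcoord_tvec x phi v : max_atlas X phi -> dom phi x ->
  tcoord phi x (tvec phi x v) = v.
Proof.
move=> mphi dx; have mc := chart_at_max leX x; have dc := chart_at_dom leX x.
have s1 : smooth_near (loc phi (chart_at x)) (phi x) by exact: smooth_transition.
have s2 : smooth_near (loc (chart_at x) phi) (chart_at x x).
  exact: smooth_transition.
have [_ E] := @is_diff_loc_comp _ _ _ X X leX _ id phi x phi (chart_at x) mphi mc
  dx (nbhs_id_dom leX mc dc) (smooth_near_differentiable s1)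
  (smooth_near_differentiable s2).
apply: (etrans (esym (congr1 (@^~ v) E))).
have E' : nbhs (phi x) [set y | y = loc phi phi y].
  apply: filterS (near_chart leX mphi dx (filterT)) => _ [x1 [d1 _] <-] /=.
  by rewrite (locE _ (max_chart mphi)).
have [did vid] := is_diff_id (phi x : 'rV[R]_n).
by have [_ ->] := near_eq_is_diff E' did; rewrite vid.
Qed.

End SmoothMaps2.

Section SmoothMaps3.
Context {R : realType} {n m : nat} {X : charted R n} {Y : charted R m}.
Hypotheses (leX : locally_euclidean X) (leY : locally_euclidean Y).
Implicit Types (f : X -> Y) (x : X).

Lemma diff_loc_push (W : normedModType R) f (g : Y -> W) x psi v :
  smooth_at f x -> max_atlas Y psi -> dom psi (f x) ->
  differentiable (loc psi g) (psi (f x)) ->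
  'd (loc (chart_at x) (g \o f)) (chart_at x x) v =
  'd (loc psi g) (psi (f x)) (tcoord psi (f x) (push f x v)).
Proof.
move=> sf mpsi dfx dg; rewrite -diff_loc_tcoord //.
have [mc dc] := (chart_at_max leX x, chart_at_dom leX x).
have [mc' dc'] := (chart_at_max leY (f x), chart_at_dom leY (f x)).
have nf := smooth_at_near_dom leY sf mc' dc'.
have df := smooth_at_loc sf mc mc' dc dc'.
have nid := nbhs_id_dom leY mpsi dfx.
have st := smooth_near_differentiable (smooth_transition leY mc' mpsi dc' dfx).
have [dg' _] := @is_diff_loc_comp _ _ _ Y Y leY W id g (f x) (chart_at (f x)) psi
  mc' mpsi dc' nid st dg.
have [_ E] := @is_diff_loc_comp _ _ _ X Y leX W f g x _ _ mc mc' dc nf df dg'.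
exact: (congr1 (@^~ v) E).
Qed.

Lemma tcoord_push f x phi psi v : smooth_at f x -> max_atlas X phi ->
  max_atlas Y psi -> dom phi x -> dom psi (f x) ->
  tcoord psi (f x) (push f x v) = 'd (loc phi (psi \o f)) (phi x) (tcoord phi x v).
Proof.
move=> sf mphi mpsi dx dfx; rewrite -diff_loc_tcoord //; last first.
  exact: smooth_at_loc.
have [mc' dc'] := (chart_at_max leY (f x), chart_at_dom leY (f x)).
have st := smooth_near_differentiable (smooth_transition leY mc' mpsi dc' dfx).
by rewrite (diff_loc_push _ sf mc' dc' st) /tcoord -diff_loc_tcoord.
Qed.

Lemma push_tvec f x phi psi v : smooth_at f x -> max_atlas X phi ->
  max_atlas Y psi -> dom phi x -> dom psi (f x) ->
  push f x (tvec phi x v) = tvec psi (f x) ('d (loc phi (psi \o f)) (phi x) v).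
Proof.
move=> sf mphi mpsi dx dfx.
rewrite -[LHS](tvec_tcoord leY _ mpsi dfx) (tcoord_push _ sf mphi) //.
by rewrite tcoord_tvec.
Qed.

End SmoothMaps3.

Section SmoothMaps4.
Context {R : realType} {n m p : nat}.
Context {X : charted R n} {Y : charted R m} {Z : charted R p}.
Hypotheses (leX : locally_euclidean X) (leY : locally_euclidean Y).
Hypothesis leZ : locally_euclidean Z.

Lemma smooth_at_comp (f : X -> Y) (g : Y -> Z) x : smooth_at f x ->
  smooth_at g (f x) -> smooth_at (g \o f) x.
Proof.
move=> sf sg; have [cf Sf] := sf; have [cg Sg] := sg; split.
  by apply: continuous_comp.
move=> phi psi mphi mpsi dx dgx.
have [mc dc] := (chart_at_max leY (f x), chart_at_dom leY (f x)).
apply: (@smooth_near_loc_comp _ _ _ _ _ leX _ f (psi \o g) x phi (chart_at (f x))) => //.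
- exact (smooth_at_near_dom leY sf mc dc).
- exact: Sf.
- exact: Sg.
Qed.

Lemma push_comp (f : X -> Y) (g : Y -> Z) x v : smooth_at f x ->
  smooth_at g (f x) -> push (g \o f) x v = push g (f x) (push f x v).
Proof.
move=> sf sg.
have [mc dc] := (chart_at_max leY (f x), chart_at_dom leY (f x)).
have [mc' dc'] := (chart_at_max leZ (g (f x)), chart_at_dom leZ (g (f x))).
have dg := smooth_at_loc sg mc mc' dc dc'.
by rewrite /push (diff_loc_push leX leY v sf mc dc dg) -diff_loc_tcoord.
Qed.

End SmoothMaps4.

Section SmoothMaps5.
Context {R : realType} {n : nat} {X : charted R n}.
Hypothesis leX : locally_euclidean X.

Lemma smooth_at_id (x : X) : smooth_at (@id X) x.
Proof.
by split=> [|phi psi mphi mpsi dx dx']; [|exact: (smooth_transition leX)].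
Qed.

Lemma push_id (x : X) v : push (@id X) x v = v.
Proof.
have := tvec_tcoord leX v (chart_at_max leX x) (chart_at_dom leX x).
rewrite /tvec -diff_loc_tcoord //; first exact: chart_at_max.
  exact: chart_at_dom.
apply: smooth_near_differentiable; apply: (smooth_transition leX);
  by [exact: chart_at_max|exact: chart_at_dom].
Qed.

End SmoothMaps5.

(** * Products of manifolds *)

Lemma nbhsT (T : topologicalType) (x : T) : nbhs x setT.
Proof. exact: filterT. Qed.

Section ProductManifold.
Context {R : realType} {n m : nat} {X : charted R n} {Y : charted R m}.
Hypotheses (leX : locally_euclidean X) (leY : locally_euclidean Y).
Implicit Types (phi : chart R n X) (psi : chart R m Y).
Let XY := prod_manifold X Y.

Definition prod_fst (p : XY) : X := p.1.
Definition prod_snd (p : XY) : Y := p.2.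

Lemma compatibleI k (Z : charted R k) (c d : chart R k Z) : is_chart c ->
  (forall x, dom c x -> dom d x ->
     chart_filter c x (dom d) /\ smooth_near (loc c d) (c x)) ->
  compatible c d.
Proof.
move=> cc H; have oU : open (c @` (dom c `&` dom d)).
  by rewrite openE => _ [x [dx dx'] <-]; have [N _] := H x dx dx'; exact N.
split=> //; apply/(smooth_onP _ oU) => _ [x [dx dx'] <-].
exact: (H x dx dx').2.
Qed.

Lemma smooth_near_row_mx (V : normedModType R) k l (f : V -> 'rV[R]_k)
    (g : V -> 'rV[R]_l) x :
  smooth_near f x -> smooth_near g x -> smooth_near (fun y => row_mx (f y) (g y)) x.
Proof.
move=> sf sg; apply/smooth_near_rV => j; case: (split_ordP j) => i ->.
  have /smooth_near_rV/(_ i) := sf; apply: smooth_near_ext => y.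
  by rewrite row_mxEl.
have /smooth_near_rV/(_ i) := sg; apply: smooth_near_ext => y.
by rewrite row_mxEr.
Qed.

Lemma lsubmx_nbhs (v : 'rV[R]_(n + m)) (V : set 'rV[R]_n) :
  nbhs (lsubmx v) V -> nbhs v (lsubmx @^-1` V).
Proof.
move=> nV; have c := @rV_linear_continuous R (n + m) _ (@lsubmx R 1 n m) v.
exact: c _ nV.
Qed.

Lemma rsubmx_nbhs (v : 'rV[R]_(n + m)) (V : set 'rV[R]_m) :
  nbhs (rsubmx v) V -> nbhs v (rsubmx @^-1` V).
Proof.
move=> nV; have c := @rV_linear_continuous R (n + m) _ (@rsubmx R 1 n m) v.
exact: c _ nV.
Qed.

Lemma prod_chart_nbhs phi psi (p : XY) (P : set X) (Q : set Y) :
  max_atlas X phi -> max_atlas Y psi -> dom phi p.1 -> dom psi p.2 ->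
  nbhs p.1 P -> nbhs p.2 Q ->
  chart_filter (prod_chart phi psi : chart R (n + m) XY) p
    [set q | P q.1 /\ Q q.2].
Proof.
move=> mphi mpsi d1 d2 nP nQ; rewrite /chart_filter /=.
have N1 : nbhs (lsubmx (row_mx (phi p.1) (psi p.2))) (phi @` (dom phi `&` P)).
  rewrite row_mxKl; have H := near_chart leX mphi d1 nP; exact H.
have N2 : nbhs (rsubmx (row_mx (phi p.1) (psi p.2))) (psi @` (dom psi `&` Q)).
  rewrite row_mxKr; have H := near_chart leY mpsi d2 nQ; exact H.
apply: filterS (filterI (lsubmx_nbhs N1) (rsubmx_nbhs N2)) => y /=.
move=> [[x1 [dx1 Px1] e1] [x2 [dx2 Qx2] e2]]; exists (x1, x2) => //=.
by rewrite e1 e2 hsubmxK.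
Qed.

Lemma prod_chart_is_chart phi psi : max_atlas X phi -> max_atlas Y psi ->
  is_chart (prod_chart phi psi).
Proof.
move=> mphi mpsi; split.
  move=> [x1 x2] [y1 y2]; rewrite !inE /= => -[dx1 dx2] [dy1 dy2].
  move=> /eq_row_mx[e1 e2]; have [i1 _] := max_chart mphi.
  by have [i2 _] := max_chart mpsi; rewrite (i1 x1 y1) ?inE // (i2 x2 y2) ?inE.
rewrite openE => _ [p [d1 d2] <-].
have H := prod_chart_nbhs mphi mpsi d1 d2 (nbhsT _) (nbhsT _).
rewrite /chart_filter /= in H; rewrite /interior /=; apply: filterS H => _ [q [dq _] <-].
by exists q.
Qed.

Lemma smooth_prod_transition phi psi phi' psi' (p : XY) :
  max_atlas X phi -> max_atlas Y psi -> max_atlas X phi' -> max_atlas Y psi' ->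
  dom phi p.1 -> dom psi p.2 -> dom phi' p.1 -> dom psi' p.2 ->
  smooth_near (loc (prod_chart phi psi) (prod_chart phi' psi'))
    (prod_chart phi psi p).
Proof.
move=> m1 m2 m1' m2' d1 d2 d1' d2'.
have c := prod_chart_is_chart m1 m2.
have s1 : smooth_near (loc phi phi') (lsubmx (prod_chart phi psi p)).
  by rewrite row_mxKl; exact: (smooth_transition leX).
have s2 : smooth_near (loc psi psi') (rsubmx (prod_chart phi psi p)).
  by rewrite row_mxKr; exact: (smooth_transition leY).
have s : smooth_near (fun y : 'rV[R]_(n + m) => row_mx (loc phi phi' (lsubmx y))
    (loc psi psi' (rsubmx y))) (prod_chart phi psi p).
  apply: smooth_near_row_mx.
    exact: smooth_near_comp (smooth_near_linear (@lsubmx R 1 n m) _) s1.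
  exact: smooth_near_comp (smooth_near_linear (@rsubmx R 1 n m) _) s2.
apply: smooth_near_eq s.
have H := prod_chart_nbhs m1 m2 d1 d2 (nbhsT _) (nbhsT _).
rewrite /chart_filter /= in H; apply: filterS H => _ [q [[dq1 dq2] _] <-].
rewrite (locE (X := XY) _ c) //= row_mxKl row_mxKr.
by rewrite (locE _ (max_chart m1)) // (locE _ (max_chart m2)).
Qed.

Lemma prod_chart_compatible phi psi phi' psi' :
  max_atlas X phi -> max_atlas Y psi -> max_atlas X phi' -> max_atlas Y psi' ->
  compatible (prod_chart phi psi) (prod_chart phi' psi').
Proof.
move=> m1 m2 m1' m2'; apply: (@compatibleI _ XY); first exact: prod_chart_is_chart.
move=> p [d1 d2] [d1' d2']; split; last exact: smooth_prod_transition.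
have H := prod_chart_nbhs m1 m2 d1 d2 (near_dom leX m1' d1') (near_dom leY m2' d2').
exact H.
Qed.

Lemma prod_chart_max phi psi : max_atlas X phi -> max_atlas Y psi ->
  max_atlas XY (prod_chart phi psi).
Proof.
move=> mphi mpsi; split; first exact: prod_chart_is_chart.
move=> _ [phi' [psi' [/leX.2 a1 /leY.2 a2 ->]]].
by split; exact: prod_chart_compatible.
Qed.

Lemma prod_locally_euclidean : locally_euclidean XY.
Proof.
split.
  move=> [x y]; have [[phi aphi dx] [psi apsi dy]] := (leX.1 x, leY.1 y).
  by exists (prod_chart phi psi); [exists phi, psi|].
by move=> _ [phi [psi [/leX.2 a1 /leY.2 a2 ->]]]; exact: prod_chart_max.
Qed.

Lemma prod_nbhs (p : XY) (P : set X) (Q : set Y) : nbhs p.1 P -> nbhs p.2 Q ->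
  nbhs p [set q : XY | P q.1 /\ Q q.2].
Proof.
move=> nP nQ; have [m1 m2] := (chart_at_max leX p.1, chart_at_max leY p.2).
have [d1 d2] := (chart_at_dom leX p.1, chart_at_dom leY p.2).
apply/(nbhs_chart prod_locally_euclidean _ (prod_chart_max m1 m2)); first by [].
exact: prod_chart_nbhs.
Qed.

Lemma loc_prod_fst phi psi (p : XY) : max_atlas X phi -> max_atlas Y psi ->
  dom phi p.1 -> dom psi p.2 ->
  nbhs (prod_chart phi psi p) [set y | lsubmx y =
    loc (prod_chart phi psi : chart R (n + m) XY) (phi \o prod_fst) y].
Proof.
move=> m1 m2 d1 d2; have H := prod_chart_nbhs m1 m2 d1 d2 (nbhsT _) (nbhsT _).
rewrite /chart_filter /= in H; apply: filterS H => _ [q [[dq1 dq2] _] <-] /=.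
by rewrite (locE (X := XY) _ (prod_chart_is_chart m1 m2)) //= row_mxKl.
Qed.

Lemma loc_prod_snd phi psi (p : XY) : max_atlas X phi -> max_atlas Y psi ->
  dom phi p.1 -> dom psi p.2 ->
  nbhs (prod_chart phi psi p) [set y | rsubmx y =
    loc (prod_chart phi psi : chart R (n + m) XY) (psi \o prod_snd) y].
Proof.
move=> m1 m2 d1 d2; have H := prod_chart_nbhs m1 m2 d1 d2 (nbhsT _) (nbhsT _).
rewrite /chart_filter /= in H; apply: filterS H => _ [q [[dq1 dq2] _] <-] /=.
by rewrite (locE (X := XY) _ (prod_chart_is_chart m1 m2)) //= row_mxKr.
Qed.

Lemma smooth_prod_fst (p : XY) : smooth_at prod_fst p.
Proof.
have [m1 m2] := (chart_at_max leX p.1, chart_at_max leY p.2).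
have [d1 d2] := (chart_at_dom leX p.1, chart_at_dom leY p.2).
apply: (smooth_atI prod_locally_euclidean leX (prod_chart_max m1 m2) m1) => //.
  apply: filterS (prod_nbhs (near_dom leX m1 d1) (nbhsT _)).
  by move=> q [].
apply: smooth_near_eq (loc_prod_fst m1 m2 d1 d2) _.
exact: (smooth_near_linear (@lsubmx R 1 n m)).
Qed.

Lemma smooth_prod_snd (p : XY) : smooth_at prod_snd p.
Proof.
have [m1 m2] := (chart_at_max leX p.1, chart_at_max leY p.2).
have [d1 d2] := (chart_at_dom leX p.1, chart_at_dom leY p.2).
apply: (smooth_atI prod_locally_euclidean leY (prod_chart_max m1 m2) m2) => //.
  apply: filterS (prod_nbhs (nbhsT _) (near_dom leY m2 d2)).
  by move=> q [].
apply: smooth_near_eq (loc_prod_snd m1 m2 d1 d2) _.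
exact: (smooth_near_linear (@rsubmx R 1 n m)).
Qed.

(** In a product chart the projections are [lsubmx] and [rsubmx]. *)
Lemma tcoord_prod phi psi (p : XY) v : max_atlas X phi -> max_atlas Y psi ->
  dom phi p.1 -> dom psi p.2 ->
  tcoord (X := XY) (prod_chart phi psi) p v =
  row_mx (tcoord phi p.1 (push prod_fst p v)) (tcoord psi p.2 (push prod_snd p v)).
Proof.
move=> m1 m2 d1 d2; have mp := prod_chart_max m1 m2.
rewrite (tcoord_push prod_locally_euclidean leX _ (smooth_prod_fst p) mp m1) //.
rewrite (tcoord_push prod_locally_euclidean leY _ (smooth_prod_snd p) mp m2) //.
set w := tcoord _ _ _.
have [dl vl] := rV_linear_diff (@lsubmx R 1 n m) (prod_chart phi psi p).
have [dr vr] := rV_linear_diff (@rsubmx R 1 n m) (prod_chart phi psi p).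
have [_ E1] := near_eq_is_diff (loc_prod_fst m1 m2 d1 d2) dl.
have [_ E2] := near_eq_is_diff (loc_prod_snd m1 m2 d1 d2) dr.
rewrite (congr1 (@^~ w) E1) (congr1 (@^~ w) E2).
by rewrite (congr1 (@^~ w) vl) (congr1 (@^~ w) vr) hsubmxK.
Qed.

Lemma prod_push_inj (p : XY) v v' : push prod_fst p v = push prod_fst p v' ->
  push prod_snd p v = push prod_snd p v' -> v = v'.
Proof.
move=> e1 e2; have [m1 m2] := (chart_at_max leX p.1, chart_at_max leY p.2).
have [d1 d2] := (chart_at_dom leX p.1, chart_at_dom leY p.2).
have mp := prod_chart_max m1 m2.
rewrite -(tvec_tcoord prod_locally_euclidean v mp (conj d1 d2)).
rewrite -(tvec_tcoord prod_locally_euclidean v' mp (conj d1 d2)).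
by rewrite !tcoord_prod // e1 e2.
Qed.

Lemma prod_push_surj (p : XY) w1 w2 : exists v,
  push prod_fst p v = w1 /\ push prod_snd p v = w2.
Proof.
have [m1 m2] := (chart_at_max leX p.1, chart_at_max leY p.2).
have [d1 d2] := (chart_at_dom leX p.1, chart_at_dom leY p.2).
have mp := prod_chart_max m1 m2.
pose v := tvec (X := XY) (prod_chart (chart_at p.1) (chart_at p.2)) p
  (row_mx (tcoord (chart_at p.1) p.1 w1) (tcoord (chart_at p.2) p.2 w2)).
exists v; have := tcoord_prod v m1 m2 d1 d2.
rewrite tcoord_tvec //; last exact: prod_locally_euclidean.
move=> /eq_row_mx[e1 e2].
rewrite -(tvec_tcoord leX (push _ _ _) m1 d1) -e1 tvec_tcoord //.
by rewrite -(tvec_tcoord leY (push _ _ _) m2 d2) -e2 tvec_tcoord.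
Qed.

Lemma smooth_pair k (Z : charted R k) (f : Z -> X) (g : Z -> Y) z :
  locally_euclidean Z -> smooth_at f z -> smooth_at g z ->
  smooth_at (fun z => (f z, g z) : XY) z.
Proof.
move=> leZ sf sg.
have [m1 m2] := (chart_at_max leX (f z), chart_at_max leY (g z)).
have [d1 d2] := (chart_at_dom leX (f z), chart_at_dom leY (g z)).
have [mz dz] := (chart_at_max leZ z, chart_at_dom leZ z).
have mp := prod_chart_max m1 m2.
have N : nbhs z (f @^-1` dom (chart_at (f z)) `&` g @^-1` dom (chart_at (g z))).
  exact: filterI (smooth_at_near_dom leX sf m1 d1) (smooth_at_near_dom leY sg m2 d2).
apply: (smooth_atI leZ prod_locally_euclidean mz mp) => //.
have s1 := sf.2 _ _ mz m1 dz d1; have s2 := sg.2 _ _ mz m2 dz d2.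
apply: (smooth_near_eq _ (smooth_near_row_mx s1 s2)).
apply: filterS (near_chart leZ mz dz (nbhsT _)) => _ [x1 [dx1 _] <-].
by rewrite !(locE _ (max_chart mz)).
Qed.

End ProductManifold.

(** * Embedded submanifolds *)

Section Submanifold.
Context {R : realType} {n : nat} {X : charted R n}.
Hypothesis leX : locally_euclidean X.
Variables (S : set X) (k : nat).
Hypothesis kn : (k <= n)%N.
Hypothesis sliced : forall x, S x ->
  exists phi, [/\ max_atlas X phi, slice_chart S k phi & dom phi x].
Let Sub := submanifold S k.
Implicit Types (phi : chart R n X) (p q : Sub).

Let E : 'M[R]_(k, n) := pid_mx k.
Let P : 'M[R]_(n, k) := pid_mx k.

Lemma pid_EP : E *m P = 1%:M.
Proof. by rewrite /E /P mul_pid_mx minnn (minn_idPr kn) pid_mx_1. Qed.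

(** [E] and [P] identify ['rV_k] with the vectors of ['rV_n] whose coordinates
    vanish from the [k]-th one on, that is, with the image of the submanifold in
    a slice chart. *)
Lemma pid_PE_id (y : 'rV[R]_n) : (forall j : 'I_n, (k <= j)%N -> y 0 j = 0) ->
  y *m P *m E = y.
Proof.
move=> H; rewrite -mulmxA /P /E mul_pid_mx !minnn; apply/rowP => j.
rewrite mxE (bigD1 j) //= big1 ?addr0; last first.
  move=> i ij; rewrite mxE (_ : (_ == _ :> nat) = false) ?mulr0 //.
  exact: negbTE.
rewrite mxE eqxx /=; case: ltnP => [|/H ->]; by rewrite ?mulr1 ?mul0r.
Qed.

Lemma pid_E0 (u : 'rV[R]_k) (j : 'I_n) : (k <= j)%N -> (u *m E) 0 j = 0.
Proof.
move=> kj; rewrite mxE big1 // => i _; rewrite mxE.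
by rewrite (_ : (_ == _ :> nat) = false) ?mulr0 //; apply/negbTE; rewrite neq_ltn (leq_trans (ltn_ord i) kj).
Qed.

Definition subchart phi : chart R k Sub :=
  Chart [set p : Sub | dom phi (sval p)] (fun p : Sub => phi (sval p) *m P).

Definition sub_val (p : Sub) : X := sval p.

Section Slice.
Variable phi : chart R n X.
Hypotheses (mphi : max_atlas X phi) (sphi : slice_chart S k phi).

Lemma subchartK p : dom (subchart phi) p -> subchart phi p *m E = phi (sval p).
Proof.
move=> dp; apply: pid_PE_id => j kj.
by have := (sphi dp).1 (svalP p); exact.
Qed.

(** A point of the coordinate subspace close to a point of the submanifold comes
    from the ambient chart, and the slice property puts it on the submanifold. *)
Lemma subchart_nbhs p (Q : set X) : dom (subchart phi) p -> nbhs (sval p) Q ->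
  chart_filter (subchart phi) p [set q | Q (sval q)].
Proof.
move=> dp nQ; rewrite /chart_filter /=.
have N : nbhs (subchart phi p *m E) (phi @` (dom phi `&` Q)).
  rewrite subchartK //; have H := near_chart leX mphi dp nQ; exact H.
have c := @rV_linear_continuous R k _ (mulmxr E) (subchart phi p).
have cN : nbhs (subchart phi p) (mulmxr E @^-1` (phi @` (dom phi `&` Q))).
  exact: c _ N.
apply: filterS cN => u [x [dx Qx] e]; rewrite /= in e.
have Sx : S x by apply/(sphi dx) => j kj; rewrite e pid_E0.
by exists (exist _ x Sx) => //=; rewrite e -mulmxA pid_EP mulmx1.
Qed.

Lemma subchart_is_chart : is_chart (subchart phi).
Proof.
split.
  move=> p q /set_mem dp /set_mem dq e.
  have /(congr1 (mulmxr E)) /= := e; rewrite !subchartK // => e'.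
  have [inj _] := max_chart mphi; apply: eq_sig_hprop => [x|]; first exact: Prop_irrelevance.
  by apply: inj => //; apply/mem_set.
rewrite openE => _ [p dp <-]; have H := subchart_nbhs dp (nbhsT _).
rewrite /chart_filter /= in H; rewrite /interior /=.
by apply: filterS H => _ [q [dq _] <-]; exists q.
Qed.

End Slice.

Lemma smooth_subchart_transition phi phi' p :
  max_atlas X phi -> slice_chart S k phi -> max_atlas X phi' ->
  dom phi (sval p) -> dom phi' (sval p) ->
  smooth_near (loc (subchart phi) (subchart phi')) (subchart phi p).
Proof.
move=> m1 s1 m2 d1 d2.
have st : smooth_near (loc phi phi') (subchart phi p *m E).
  by rewrite subchartK //; exact: (smooth_transition leX).
have sm : smooth_near (fun u : 'rV[R]_k => loc phi phi' (u *m E) *m P) (subchart phi p).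
  apply: (@smooth_near_comp _ _ _ _ _ (mulmxr P)); last exact: smooth_near_linear.
  apply: (@smooth_near_comp _ _ _ _ (mulmxr E)) => //; exact: smooth_near_linear.
apply: smooth_near_eq sm.
have H := subchart_nbhs m1 s1 d1 (nbhsT _); rewrite /chart_filter /= in H.
apply: filterS H => _ [q [dq _] <-].
rewrite (locE _ (subchart_is_chart m1 s1)) // subchartK //.
by rewrite (locE _ (max_chart m1)).
Qed.

Lemma subchart_max phi : max_atlas X phi -> slice_chart S k phi ->
  max_atlas Sub (subchart phi).
Proof.
move=> m1 s1; split; first exact: subchart_is_chart.
move=> _ [phi' [m2 s2 ->]].
split; apply: compatibleI => [|q dq dq']; try exact: subchart_is_chart.
  split; last exact: smooth_subchart_transition.
  have H := subchart_nbhs m1 s1 dq (near_dom leX m2 dq'); exact H.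
split; last exact: smooth_subchart_transition.
have H := subchart_nbhs m2 s2 dq (near_dom leX m1 dq'); exact H.
Qed.

Lemma submanifold_locally_euclidean : locally_euclidean Sub.
Proof.
split.
  move=> p; have [phi [m1 s1 d1]] := sliced (svalP p).
  by exists (subchart phi) => //; exists phi.
by move=> _ [phi [m1 s1 ->]]; exact: subchart_max.
Qed.

Lemma nbhs_sub_val p (Q : set X) : nbhs (sval p) Q -> nbhs p (sub_val @^-1` Q).
Proof.
move=> nQ; have [phi [m1 s1 d1]] := sliced (svalP p).
apply/(nbhs_chart submanifold_locally_euclidean _ (subchart_max m1 s1)) => //.
exact: subchart_nbhs.
Qed.

Lemma loc_sub_val phi p : max_atlas X phi -> slice_chart S k phi ->
  dom phi (sval p) -> nbhs (subchart phi p)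
    [set u | mulmxr E u = loc (subchart phi) (phi \o sub_val) u].
Proof.
move=> m1 s1 d1.
have H := subchart_nbhs m1 s1 d1 (nbhsT _); rewrite /chart_filter /= in H.
apply: filterS H => _ [q [dq _] <-].
by rewrite /= (locE _ (subchart_is_chart m1 s1)) // subchartK.
Qed.

Lemma smooth_sub_val p : smooth_at sub_val p.
Proof.
have [phi [m1 s1 d1]] := sliced (svalP p).
apply: (smooth_atI submanifold_locally_euclidean leX (subchart_max m1 s1) m1) => //.
  exact: nbhs_sub_val (near_dom leX m1 d1).
apply: smooth_near_eq (loc_sub_val m1 s1 d1) _.
exact: smooth_near_linear.
Qed.

(** In a slice chart the inclusion is [mulmxr E], which has the left inverse
    [mulmxr P]. *)
Lemma push_sub_val_inj p v : push sub_val p v = 0 -> v = 0.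
Proof.
move=> H; have [phi [m1 s1 d1]] := sliced (svalP p).
have leS := submanifold_locally_euclidean; have ms := subchart_max m1 s1.
have := tcoord_push leS leX v (smooth_sub_val p) ms m1 d1 d1.
rewrite H {1}/tcoord linear0.
have [dl vl] := rV_linear_diff (mulmxr E) (subchart phi p).
have [_ E1] := near_eq_is_diff (loc_sub_val m1 s1 d1) dl.
rewrite (congr1 (@^~ (tcoord (subchart phi) p v)) E1).
rewrite (congr1 (@^~ (tcoord (subchart phi) p v)) vl) => /esym/(congr1 (mulmxr P)) /=.
rewrite mul0mx -mulmxA pid_EP mulmx1 => e.
by rewrite -(tvec_tcoord leS v ms (d1 : dom (subchart phi) p)) e /tvec linear0.
Qed.

(** The coordinates of the submanifold are among those of the ambient manifold. *)
Lemma smooth_to_sub l (Z : charted R l) (f : Z -> Sub) z : locally_euclidean Z ->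
  smooth_at (sub_val \o f) z -> smooth_at f z.
Proof.
move=> leZ sf; have [phi [m1 s1 d1]] := sliced (svalP (f z)).
have [mz dz] := (chart_at_max leZ z, chart_at_dom leZ z).
have ms := subchart_max m1 s1.
apply: (smooth_atI leZ submanifold_locally_euclidean mz ms) => //.
  have H := smooth_at_near_dom leX sf m1 d1; exact H.
have sm := sf.2 _ _ mz m1 dz d1.
apply: smooth_near_eq (smooth_near_comp sm (smooth_near_linear (mulmxr P) _)).
apply: filterS (near_chart leZ mz dz (nbhsT _)) => _ [x1 [dx1 _] <-].
by rewrite !(locE _ (max_chart mz)).
Qed.

End Submanifold.

(** * Equalizers of transversal maps *)

Lemma diff_row_mx (R : realType) (V : normedModType R) k l (f : V -> 'rV[R]_k)
    (g : V -> 'rV[R]_l) x v : differentiable f x -> differentiable g x ->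
  'd (fun y => row_mx (f y) (g y)) x v = row_mx ('d f x v) ('d g x v).
Proof.
move=> df dg.
have El i : (fun y => row_mx (f y) (g y) 0 (lshift l i)) = (fun y => f y 0 i).
  by apply/funext => y; rewrite row_mxEl.
have Er i : (fun y => row_mx (f y) (g y) 0 (rshift k i)) = (fun y => g y 0 i).
  by apply/funext => y; rewrite row_mxEr.
have dfg : differentiable (fun y => row_mx (f y) (g y)) x.
  apply/differentiable_rV => j; case: (split_ordP j) => i ->.
    by rewrite El; exact: (differentiable_rV _ _).1.
  by rewrite Er; exact: (differentiable_rV _ _).1.
apply/rowP => j; rewrite (diff_rVE _ _ dfg); case: (split_ordP j) => i ->.
  by rewrite El row_mxEl (diff_rVE _ _ df).
by rewrite Er row_mxEr (diff_rVE _ _ dg).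
Qed.

Section ChangeOfCoordinates.
Context {R : realType} {n : nat} {X : charted R n}.
Hypothesis leX : locally_euclidean X.

(** Charts of the maximal atlas may be composed with local diffeomorphisms. *)
Lemma recoordinatize_max (phi : chart R n X) (F G : 'rV[R]_n -> 'rV[R]_n)
    (U : set 'rV[R]_n) :
  max_atlas X phi -> open U -> U `<=` phi @` dom phi ->
  (forall y, U y -> smooth_near F y) -> (forall y, U y -> G (F y) = y) ->
  open (F @` U) -> (forall y, (F @` U) y -> smooth_near G y) ->
  max_atlas X (Chart (dom phi `&` phi @^-1` U) (F \o phi)).
Proof.
move=> mphi oU UD sF GF oV sG; set psi := Chart _ _.
have cphi := max_chart mphi; have [inj _] := cphi.
have imV : psi @` dom psi = F @` U.
  apply/seteqP; split=> [_ [x [dx Ux] <-]|_ [y Uy <-]]; first by exists (phi x).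
  by have [x dx e] := UD y Uy; exists x; rewrite /psi /= ?e //; split=> //=; rewrite e.
have cpsi : is_chart psi.
  split; last by rewrite imV.
  move=> x x' /set_mem[dx Ux] /set_mem[dx' Ux'] /= e.
  by apply: inj; [exact/mem_set|exact/mem_set|rewrite -(GF _ Ux) e GF].
have nb x Q : dom psi x -> nbhs x Q -> chart_filter psi x Q.
  move=> [dx Ux] nQ; rewrite /chart_filter /=.
  have N := near_chart leX mphi dx nQ.
  have sGx : smooth_near G (psi x) by apply: sG; exists (phi x).
  have N' : nbhs (G (psi x)) (phi @` (dom phi `&` Q)).
    by rewrite /= GF //; exact N.
  have N1 : nbhs (psi x) (G @^-1` (phi @` (dom phi `&` Q))).
    exact: smooth_near_continuous sGx _ N'.
  have N2 : nbhs (psi x) (F @` U).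
    by apply: open_nbhs_nbhs; split=> //; exists (phi x).
  have N3 : nbhs (psi x) ((G @^-1` (phi @` (dom phi `&` Q))) `&` (F @` U)).
    exact: filterI N1 N2.
  apply: filterS N3 => z [+ [y Uy Fy]]; rewrite -{z}Fy => -[x1 [dx1 Qx1]].
  rewrite GF // => e; exists x1; last by rewrite /= e.
  by split=> //; split=> //=; rewrite e.
split=> // chi achi; have mchi := leX.2 _ achi; have cchi := max_chart mchi.
split; apply: compatibleI => // x.
- move=> dpx dcx; split; first exact: nb dpx (near_dom leX mchi dcx).
  have [dx Ux] := dpx.
  have sGx : smooth_near G (psi x) by apply: sG; exists (phi x).
  have st : smooth_near (loc phi chi) (G (psi x)).
    by rewrite /= GF //; exact: (smooth_transition leX).
  apply: smooth_near_eq (smooth_near_comp sGx st).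
  have H := nb x setT dpx (nbhsT _); rewrite /chart_filter /= in H.
  apply: filterS H => _ [x1 [dx1 _] <-]; have [dx1' Ux1] := dx1.
  by rewrite (locE _ cpsi dx1) /= GF // (locE _ cphi dx1').
- move=> dcx [dx Ux].
  have nU : nbhs x (dom phi `&` phi @^-1` U).
    have nU : nbhs (phi x) U by exact: open_nbhs_nbhs.
    exact: filterI (near_dom leX mphi dx) (near_coord leX mphi dx nU).
  split; first by have H := near_chart leX mchi dcx nU; exact H.
  have st : smooth_near (loc chi phi) (chi x) by exact: (smooth_transition leX).
  have sFx : smooth_near F (loc chi phi (chi x)) by rewrite (locE _ cchi dcx); exact: sF.
  apply: smooth_near_eq (smooth_near_comp st sFx).
  apply: filterS (near_chart leX mchi dcx (nbhsT _)) => _ [x1 [dx1 _] <-].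
  by rewrite !(locE _ cchi dx1).
Qed.

End ChangeOfCoordinates.

Section LinearAlgebra.
Context {F : fieldType}.

Lemma surjective_row_full n m (f : {linear 'rV[F]_n -> 'rV[F]_m}) :
  (forall c, exists v, f v = c) -> row_full (lin1_mx f).
Proof.
move=> sf; rewrite -sub1mx; apply/row_subP => i.
have [v e] := sf (row i 1%:M); apply/submxP; exists v.
by rewrite mul_rV_lin1.
Qed.

(** The columns of full rank are completed by a basis of a complement of the space
    that they span. *)
Lemma complete_to_unit k m (C : 'M[F]_(k + m, m)) : row_full C ->
  exists D : 'M[F]_(k + m, k), row_mx D C \in unitmx.
Proof.
move=> fC; have rC : \rank C^T = m by rewrite mxrank_tr; apply/eqP.
have rk : \rank (C^T^C)%MS = k by rewrite mxrank_compl rC addnK.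
have [D eD] : exists D : 'M[F]_(k, k + m), (D :=: C^T^C)%MS.
  by move: (row_base _) (eq_row_base (C^T^C)%MS); rewrite rk => D eD; exists D.
exists D^T; rewrite -unitmx_tr tr_row_mx trmxK -row_full_unit.
rewrite -sub1mx -addsmxE (adds_eqmx eD (eqmx_refl _)) addsmxC.
by rewrite sub1mx; exact: addsmx_compl_full.
Qed.

End LinearAlgebra.

Section LevelSet.
Context {R : realType}.

(** In a chart of [M] the equation [F1 x = F2 x] becomes the vanishing of a
    function [f1 - f2] with surjective differential.  Completing it by linear
    functions of the coordinates gives a map whose Jacobian is invertible, and
    which is a slice chart by the inverse function theorem. *)
Lemma equalizer_slice n k m (X : charted R n) (M : charted R m) (F1 F2 : X -> M)
    (x : X) : n = (k + m)%N -> locally_euclidean X -> locally_euclidean M ->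
  smooth_at F1 x -> smooth_at F2 x -> F1 x = F2 x ->
  (forall c, exists v, push F1 x v - push F2 x v = c) ->
  exists phi, [/\ max_atlas X phi, slice_chart [set x | F1 x = F2 x] k phi &
    dom phi x].
Proof.
move=> e; move: X F1 F2 x; rewrite e {n e} => X F1 F2 x leX leM sF1 sF2 eF surj.
have [mphi dx] := (chart_at_max leX x, chart_at_dom leX x).
set phi := chart_at x in mphi dx.
have [mmu d1] := (chart_at_max leM (F1 x), chart_at_dom leM (F1 x)).
set mu := chart_at (F1 x) in mmu d1.
have d2 : dom mu (F2 x) by rewrite -eF.
pose f1 : 'rV[R]_(k + m) -> 'rV[R]_m := loc phi (mu \o F1).
pose f2 : 'rV[R]_(k + m) -> 'rV[R]_m := loc phi (mu \o F2).
have sf1 : smooth_near f1 (phi x) by exact: sF1.2.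
have sf2 : smooth_near f2 (phi x) by exact: sF2.2.
have df1 := smooth_near_differentiable sf1.
have df2 := smooth_near_differentiable sf2.
have dc : is_diff (phi x) (f1 - f2)
    (('d f1 (phi x) : _ -> 'rV[R]_m) - ('d f2 (phi x) : _ -> 'rV[R]_m)).
  by apply: is_diffB; exact: differentiableP.
have [dcx dcE] := dc.
pose C := lin1_mx ('d (f1 - f2) (phi x)).
have fC : row_full C.
  apply: surjective_row_full => c; have [v <-] := surj c; exists v.
  apply: (etrans (congr1 (@^~ v) dcE)).
  by rewrite /push /f1 /f2 /mu -eF.
have [D uD] := complete_to_unit fC.
pose Psi y := row_mx (y *m D) ((f1 - f2) y).
have sc y : smooth_near f1 y -> smooth_near f2 y -> smooth_near Psi y.
  move=> s1 s2; apply: smooth_near_row_mx; first exact: (smooth_near_linear (mulmxr D)).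
  apply/smooth_near_rV => j.
  have /smooth_near_rV/(_ j) s1j := s1; have /smooth_near_rV/(_ j) s2j := s2.
  apply: smooth_near_ext (smooth_near_add s1j (smooth_near_opp s2j)) => z.
  by rewrite /= !mxE.
have sPsi : smooth_near Psi (phi x) by exact: sc.
have JPsi : jacobian Psi (phi x) = row_mx D C.
  apply/row_matrixP => i; rewrite !rowE.
  apply: (etrans (mulmx_jacobian _ _ _)); rewrite mul_mx_row mul_rV_lin1.
  have [dl vl] := rV_linear_diff (mulmxr D) (phi x).
  rewrite (diff_row_mx _ dl dcx); congr row_mx.
  exact: (congr1 (@^~ (delta_mx 0 i)) vl).
have N1 : nbhs x (F1 @^-1` dom mu `&` F2 @^-1` dom mu).
  exact: filterI (smooth_at_near_dom leM sF1 mmu d1) (smooth_at_near_dom leM sF2 mmu d2).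
pose N := (phi @` (dom phi `&` (F1 @^-1` dom mu `&` F2 @^-1` dom mu))) `&`
   [set y | smooth_near f1 y /\ smooth_near f2 y].
have nN : nbhs (phi x) N.
  have N2 := near_chart leX mphi dx N1.
  have S1 : nbhs (phi x) [set y | smooth_near f1 y] := smooth_near_near sf1.
  have S2 : nbhs (phi x) [set y | smooth_near f2 y] := smooth_near_near sf2.
  exact: filterI N2 (filterI S1 S2).
have uJ : jacobian Psi (phi x) \in unitmx by rewrite JPsi.
have [U [G [[oU Ux] UN GF oV sG]]] := inverse_function sPsi uJ nN.
exists (Chart (dom phi `&` phi @^-1` U) (Psi \o phi)); split=> //.
  apply: (recoordinatize_max leX mphi oU _ _ GF oV sG).
    by move=> y /UN[[x1 [dx1 _] <-] _]; exists x1.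
  by move=> y /UN[_ [s1 s2]]; exact: sc.
move=> x1 [dx1 Ux1] /=.
have [[x1' [dx1' [m1 m2]] ex1] _] := UN _ Ux1.
have {}ex1 : x1' = x1 by have [inj _] := max_chart mphi; apply: inj => //; exact/mem_set.
rewrite {x1'}ex1 /= in dx1' m1 m2.
have fE : (f1 - f2) (phi x1) = mu (F1 x1) - mu (F2 x1).
  rewrite -[LHS]/(f1 (phi x1) - f2 (phi x1)) /f1 /f2.
  by rewrite !(locE _ (max_chart mphi)).
split=> [e|H].
  move=> j; case: (split_ordP j) => i -> kj.
    by exfalso; move: kj; rewrite leqNgt /= ltn_ord.
  by rewrite /Psi row_mxEr fE e subrr mxE.
have [inj _] := max_chart mmu; apply: inj; [exact/mem_set|exact/mem_set|].
apply/eqP; rewrite -subr_eq0 -fE; apply/eqP/rowP => i; rewrite [RHS]mxE.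
have Ei : Psi (phi x1) 0 (rshift k i) = 0 by exact: H (rshift k i) (leq_addr _ _).
by rewrite /Psi row_mxEr in Ei.
Qed.

(** The tangent space of the equalizer is contained in the kernel of
    [push F1 x - push F2 x], and both have dimension [k]. *)
Lemma equalizer_tangent n k m (X : charted R n) (M : charted R m) (F1 F2 : X -> M)
    (p : submanifold [set x | F1 x = F2 x] k) w :
  n = (k + m)%N -> locally_euclidean X -> locally_euclidean M ->
  (forall x, smooth_at F1 x) -> (forall x, smooth_at F2 x) ->
  (forall x, F1 x = F2 x -> forall c, exists v, push F1 x v - push F2 x v = c) ->
  push F1 (sub_val p) w = push F2 (sub_val p) w ->
  exists v, push (@sub_val _ _ _ _ _) p v = w.
Proof.
move=> e leX leM s1 s2 surj ew.
have kn : (k <= n)%N by rewrite e leq_addr.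
have sliced x : F1 x = F2 x -> exists phi, [/\ max_atlas X phi,
    slice_chart [set x | F1 x = F2 x] k phi & dom phi x].
  by move=> eF; exact: equalizer_slice e leX leM (s1 x) (s2 x) eF (surj x eF).
have leS := submanifold_locally_euclidean leX kn sliced.
have sv := smooth_sub_val leX kn sliced.
set x := sub_val p; have ex : F1 x = F2 x by exact: (svalP p).
pose d : 'rV[R]_n -> 'rV[R]_m := fun v => push F1 x v - push F2 x v.
have d_lin : linear d.
  by move=> a u v; rewrite /d !push_is_linear scalerBr opprD addrACA.
pose dM := GRing.isLinear.Build _ _ _ _ _ d_lin.
pose dL : {linear 'rV[R]_n -> 'rV[R]_m} := HB.pack d dM.
pose i : 'rV[R]_k -> 'rV[R]_n := push (@sub_val _ _ _ [set x | F1 x = F2 x] k) p.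
have i_lin : linear i by move=> a u v; rewrite /i push_is_linear.
pose iM := GRing.isLinear.Build _ _ _ _ _ i_lin.
pose iL : {linear 'rV[R]_k -> 'rV[R]_n} := HB.pack i iM.
have fD : row_full (lin1_mx dL) by apply: surjective_row_full; exact: surj.
have fI : row_free (lin1_mx iL).
  rewrite -kermx_eq0; apply/eqP/eqP/rowV0P => v /sub_kermxP; rewrite mul_rV_lin1.
  exact: (push_sub_val_inj leX kn sliced).
have EF : F1 \o @sub_val _ _ _ [set x | F1 x = F2 x] k = F2 \o @sub_val _ _ _ _ _.
  by apply/funext => q; exact: (svalP q).
have dI u : d (i u) = 0.
  apply/eqP; rewrite subr_eq0; apply/eqP.
  apply: etrans (esym (push_comp leS leX leM u (sv p) (s1 _))) _.
  rewrite EF; exact: (push_comp leS leX leM u (sv p) (s2 _)).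
have ID : lin1_mx iL *m lin1_mx dL = 0.
  apply/row_matrixP => j; rewrite row0 rowE mulmxA !mul_rV_lin1.
  exact: dI.
have : (kermx (lin1_mx dL) <= lin1_mx iL)%MS.
  rewrite -(geq_leqif (mxrank_leqif_sup _)); last exact/sub_kermxP.
  by rewrite mxrank_ker (eqP fD) (eqP fI) e addnK.
have wk : (w <= kermx (lin1_mx dL))%MS.
  by apply/sub_kermxP; rewrite mul_rV_lin1 /= /d ew subrr.
move/(submx_trans wk)/submxP => [v ->]; exists v.
by rewrite mul_rV_lin1.
Qed.

End LevelSet.

(** * Naturality of the exterior derivative *)

Section ExteriorDerivative.
Context {R : realType}.

(** The exterior derivative at [x] only involves the components of the form in the
    preferred chart at [x]. *)
Definition differentiable_form n (X : charted R n) (w : X -> 'rV[R]_n -> R)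
    (x : X) : Prop :=
  forall v, differentiable (loc (chart_at x) (fun y => w y (tvec (chart_at x) y v)))
    (chart_at x x).

Definition fibrewise_linear n (X : charted R n) (w : X -> 'rV[R]_n -> R) : Prop :=
  forall x a v v', w x (a *: v + v') = a * w x v + w x v'.

Lemma fibrewise_linear_sum n (X : charted R n) (w : X -> 'rV[R]_n -> R) x
    (I : finType) (a : I -> R) (v : I -> 'rV[R]_n) : fibrewise_linear w ->
  w x (\sum_i a i *: v i) = \sum_i a i * w x (v i).
Proof.
move=> lw; have w0 : w x 0 = 0.
  by have := lw x (-1) 0 0; rewrite scaler0 addr0 mulN1r addNr.
by elim/big_rec2: _ => // i y1 y2 _ <-; rewrite lw.
Qed.

Lemma deriveM_point (V : normedModType R) (f g : V -> R) x v :
  differentiable f x -> differentiable g x ->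
  'D_v (fun y => f y * g y) x = f x * 'D_v g x + 'D_v f x * g x.
Proof.
move=> df dg; rewrite (@deriveM R V f g); try exact: diff_derivable.
by rewrite -![_ *: _]/(_ * _) [g x * _]mulrC.
Qed.

Lemma derive_sum_point (V : normedModType R) k (f : 'I_k -> V -> R) x v :
  (forall i, differentiable (f i) x) ->
  'D_v (fun y => \sum_i f i y) x = \sum_i 'D_v (f i) x.
Proof.
move=> df; have -> : (fun y => \sum_i f i y) = \sum_i f i.
  by apply/funext => y; rewrite fct_sumE.
by apply: derive_sum => i; exact: diff_derivable.
Qed.

Context {n m : nat} {X : charted R n} {Y : charted R m}.
Hypotheses (leX : locally_euclidean X) (leY : locally_euclidean Y).

(** In coordinates the components of the pull-back are sums of products
    ['D_z F_j * (W_j \o F)], where [W_j] are the components of [w] and [F] is the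
    local expression of [f].  Antisymmetrization cancels the second derivatives
    of [F]. *)
Lemma ext_d_pullback (f : X -> Y) (w : Y -> 'rV[R]_m -> R) x :
  (forall x, smooth_at f x) -> fibrewise_linear w ->
  differentiable_form w (f x) ->
  differentiable_form (fun x v => w (f x) (push f x v)) x /\
  forall v z, ext_d (fun x v => w (f x) (push f x v)) x v z =
    pullback2 f (ext_d w) x v z.
Proof.
move=> sf lw dw.
have [mphi dx] := (chart_at_max leX x, chart_at_dom leX x).
have [mpsi dfx] := (chart_at_max leY (f x), chart_at_dom leY (f x)).
rewrite /differentiable_form /ext_d /pullback2 in dw *.
have pushE v : push f x v = 'd (loc (chart_at x) (chart_at (f x) \o f)) (chart_at x x) v by [].
set phi := chart_at x in mphi dx pushE *.
set psi := chart_at (f x) in mpsi dfx pushE dw *.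
pose F : 'rV[R]_n -> 'rV[R]_m := loc phi (psi \o f).
have sF : smooth_near F (phi x) by exact: (sf x).2.
have dF := smooth_near_differentiable sF.
have Fx : F (phi x) = psi (f x) by exact: (locE _ (max_chart mphi) dx).
pose W j := loc psi (fun y => w y (tvec psi y (delta_mx 0 j))).
pose DF z j (y : 'rV[R]_n) : R := 'D_z F y 0 j.
have sDF z j : smooth_near (DF z j) (phi x).
  by have /smooth_near_rV/(_ j) := smooth_near_derive z sF.
have dDF z j := smooth_near_differentiable (sDF z j).
have dW j : differentiable (W j) (F (phi x)) by rewrite Fx; exact: dw.
have dWF j : differentiable (fun y => W j (F y)) (phi x).
  exact: (@differentiable_comp _ _ _ _ F (W j)).
have dterm z j : differentiable (fun y => DF z j y * W j (F y)) (phi x).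
  exact: (@differentiableM _ _ (DF z j) (fun y => W j (F y))).
pose comp z := loc phi (fun x' => w (f x') (push f x' (tvec phi x' z))).
have compE z : \forall y \near phi x, \sum_j DF z j y * W j (F y) = comp z y.
  have N1 := near_chart leX mphi dx (smooth_at_near_dom leY (sf x) mpsi dfx).
  apply: filterS N1 => _ [x1 [dx1 dfx1] <-].
  rewrite /comp (locE _ (max_chart mphi) dx1).
  rewrite (push_tvec leX leY _ (sf x1) mphi mpsi dx1 dfx1).
  have dF1 := smooth_at_loc (sf x1) mphi mpsi dx1 dfx1.
  rewrite -[loc phi (psi \o f)]/F in dF1 *.
  have F1 : F (phi x1) = psi (f x1) by exact: (locE _ (max_chart mphi) dx1).
  rewrite [in RHS](row_sum_delta ('d F (phi x1) z)) {1}/tvec linear_sum.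
  under [in RHS]eq_bigr do rewrite linearZ -/(tvec _ _ _).
  rewrite (fibrewise_linear_sum _ _ _ lw); apply: eq_bigr => j _.
  by rewrite /DF deriveE // F1 /W (locE _ (max_chart mpsi) dfx1).
have dcomp z : differentiable (comp z) (phi x).
  apply: near_eq_differentiable (compE z) _.
  have -> : (fun y => \sum_j DF z j y * W j (F y)) =
      \sum_j (fun y => DF z j y * W j (F y)).
    by apply/funext => y; rewrite fct_sumE.
  by apply: differentiable_sum => j; exact: dterm.
split=> [v|v z]; first exact: dcomp.
have [DD HDD] : exists DD : 'rV[R]_n -> 'rV[R]_n -> 'I_m -> R,
    forall v1 z1 j, DD v1 z1 j = 'D_v1 (DF z1 j) (phi x).
  by exists (fun v1 z1 j => 'D_v1 (DF z1 j) (phi x)).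
have [g Hg] : exists g : 'I_m -> 'rV[R]_m -> R,
    forall j u, g j u = 'd (W j) (psi (f x)) u.
  by exists (fun j u => 'd (W j) (psi (f x)) u).
have pE u : 'D_u F (phi x) = push f x u by rewrite (deriveE _ dF) pushE.
have Dcomp v1 z1 : 'D_v1 (comp z1) (phi x) = \sum_j (push f x z1 0 j *
    g j (push f x v1) + DD v1 z1 j * W j (psi (f x))).
  apply: etrans (esym (near_eq_derive v1 (compE z1))) _.
  rewrite derive_sum_point; last by move=> j; exact: dterm.
  apply: eq_bigr => j _.
  rewrite (deriveM_point _ (dDF z1 j) (dWF j)) (derive_comp v1 dF (dW j)).
  by rewrite Hg HDD -Fx /DF !pE.
pose comp' z := loc psi (fun y => w y (tvec psi y z)).
have Dcomp' v1 z1 : 'D_v1 (comp' z1) (psi (f x)) =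
    \sum_j z1 0 j * g j v1.
  have E : \forall y \near psi (f x), \sum_j z1 0 j * W j y = comp' z1 y.
    apply: filterS (near_chart leY mpsi dfx (nbhsT _)) => _ [y1 [dy1 _] <-].
    rewrite /comp' (locE _ (max_chart mpsi) dy1).
    rewrite [in RHS](row_sum_delta z1) {1}/tvec linear_sum.
    under [in RHS]eq_bigr do rewrite linearZ -/(tvec _ _ _).
    rewrite (fibrewise_linear_sum _ _ _ lw); apply: eq_bigr => j _.
    by rewrite /W (locE _ (max_chart mpsi) dy1).
  rewrite -(near_eq_derive _ E) derive_sum_point.
    apply: eq_bigr => j _; rewrite deriveM_point //; last by rewrite -Fx; exact: dW.
    by rewrite derive_cst mul0r addr0 Hg deriveE // -Fx; exact: dW.
  move=> j; apply: (@differentiableM _ _ (fun=> z1 0 j) (W j)) => //.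
  by rewrite -Fx; exact: dW.
rewrite -/(comp z) -/(comp v) -/(comp' (push f x z)) -/(comp' (push f x v)).
rewrite !Dcomp !Dcomp' -!sumrB; apply: eq_bigr => j _.
have swap : DD v z j = DD z v j.
  rewrite !HDD.
  pose Fj (y : 'rV[R]_n) : R := F y 0 j.
  have sFj : smooth_near Fj (phi x) by have /smooth_near_rV/(_ j) := sF.
  have DFE u : \forall y \near phi x, 'D_u Fj y = DF u j y.
    apply: filterS (smooth_near_near sF) => y /smooth_near_differentiable dFy.
    have dFjy : differentiable Fj y by exact: (differentiable_rV _ _).1.
    by rewrite /DF !deriveE // diff_rVE.
  apply: etrans (esym (near_eq_derive v (DFE z))) _.
  apply: etrans (smooth_near_schwarz z v sFj) _.
  exact: near_eq_derive z (DFE v).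
by rewrite swap opprD addrACA subrr addr0.
Qed.

End ExteriorDerivative.

Section ExtDAdditive.
Context {R : realType} {n : nat} {X : charted R n}.
Hypothesis leX : locally_euclidean X.

Lemma ext_dD (w1 w2 : X -> 'rV[R]_n -> R) x :
  differentiable_form w1 x -> differentiable_form w2 x ->
  differentiable_form (fun x v => w1 x v + w2 x v) x /\
  forall v z, ext_d (fun x v => w1 x v + w2 x v) x v z =
    ext_d w1 x v z + ext_d w2 x v z.
Proof.
rewrite /differentiable_form /ext_d.
have [mphi dx] := (chart_at_max leX x, chart_at_dom leX x).
set phi := chart_at x in mphi dx * => d1 d2.
pose c (w : X -> 'rV[R]_n -> R) z := loc phi (fun x' => w x' (tvec phi x' z)).
have E z : \forall y \near phi x, c w1 z y + c w2 z y =
    c (fun x v => w1 x v + w2 x v) z y.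
  apply: filterS (near_chart leX mphi dx (nbhsT _)) => _ [x1 [dx1 _] <-].
  by rewrite /c !(locE _ (max_chart mphi) dx1).
have dc1 z : differentiable (c w1 z) (phi x) by exact: d1.
have dc2 z : differentiable (c w2 z) (phi x) by exact: d2.
have dc z : differentiable (fun y => c w1 z y + c w2 z y) (phi x).
  exact: (@differentiableD _ _ _ (c w1 z) (c w2 z)).
have Dc v1 z1 : 'D_v1 (c (fun x v => w1 x v + w2 x v) z1) (phi x) =
    'D_v1 (c w1 z1) (phi x) + 'D_v1 (c w2 z1) (phi x).
  apply: etrans (esym (near_eq_derive v1 (E z1))) _.
  by apply: deriveD; exact: diff_derivable.
split=> [v|v z]; first exact: near_eq_differentiable (E v) (dc v).
rewrite -/(c w1 z) -/(c w2 z) -/(c w1 v) -/(c w2 v).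
rewrite -[X in 'D_v X _ - _]/(c (fun x v => w1 x v + w2 x v) z).
rewrite -[X in _ - 'D_z X _]/(c (fun x v => w1 x v + w2 x v) v).
by rewrite (Dc v z) (Dc z v) opprD addrACA.
Qed.

End ExtDAdditive.

(** * Frame charts of dual bundles *)

Section DualBundleCharts.
Context {R : realType} {m n : nat} {B : charted R m} {X : charted R n}.
Context {u : B -> X} {E : B -> set 'rV[R]_n} {k : nat}.
Let DB := dual_bundle u E k.
Hypotheses (leB : locally_euclidean B) (leD : locally_euclidean DB).
Implicit Types (p : DB) (phi : chart R m B) (e : B -> 'M[R]_(k, n)).

(** A name for the charts in the atlas of [dual_bundle]. *)
Definition frame_chart phi e : chart R (m + k) DB :=
  Chart [set p : DB | dom phi (sval p).1]
    (fun p : DB => row_mx (phi (sval p).1)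
       (\row_i (sval p).2 (row i (e (sval p).1)))).

Lemma frame_chart_max phi e : max_atlas B phi -> smooth_frame u E phi e ->
  max_atlas DB (frame_chart phi e).
Proof. by move=> mphi fe; apply: leD.2; exists phi, e. Qed.

Lemma chart_at_frame p : exists phi e, [/\ max_atlas B phi, smooth_frame u E phi e,
  dom phi (base p) & chart_at p = frame_chart phi e].
Proof.
have [[phi [e [mphi fe cE]]] dp] := chart_atP leD p.
by exists phi, e; split=> //; rewrite cE in dp.
Qed.

Lemma loc_base phi e p : max_atlas B phi -> smooth_frame u E phi e ->
  dom phi (base p) ->
  nbhs (frame_chart phi e p) [set y | lsubmx y =
    loc (frame_chart phi e) (phi \o (base : DB -> B)) y].
Proof.
move=> mphi fe dp; have mc := frame_chart_max mphi fe.
apply: filterS (near_chart leD mc (dp : dom (frame_chart phi e) p) (nbhsT _)).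
move=> _ [q [dq _] <-]; apply: etrans (esym (locE _ (max_chart mc) dq)).
by rewrite /= row_mxKl.
Qed.

Lemma smooth_base p : smooth_at (base : DB -> B) p.
Proof.
have [phi [e [mphi fe dp _]]] := chart_at_frame p.
have mc := frame_chart_max mphi fe.
apply: (smooth_atI leD leB mc mphi) => //.
  by have H := near_dom leD mc (dp : dom (frame_chart phi e) p); exact H.
apply: smooth_near_eq (loc_base mphi fe dp) _.
exact: (smooth_near_linear (@lsubmx R 1 m k)).
Qed.

Lemma diff_loc_base phi e p v : max_atlas B phi -> smooth_frame u E phi e ->
  dom phi (base p) ->
  'd (loc (frame_chart phi e) (phi \o (base : DB -> B))) (frame_chart phi e p) v =
  lsubmx v.
Proof.
move=> mphi fe dp.
have [dl vl] := rV_linear_diff (@lsubmx R 1 m k) (frame_chart phi e p).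
have [_ E1] := near_eq_is_diff (loc_base mphi fe dp) dl.
by apply: etrans (congr1 (@^~ v) E1) _; exact: (congr1 (@^~ v) vl).
Qed.

Lemma push_base_tvec phi e p v : max_atlas B phi -> smooth_frame u E phi e ->
  dom phi (base p) ->
  push (base : DB -> B) p (tvec (frame_chart phi e) p v) =
  tvec phi (base p) (lsubmx v).
Proof.
move=> mphi fe dp; have mc := frame_chart_max mphi fe.
rewrite (push_tvec leD leB v (smooth_base p) mc mphi (dp : dom (frame_chart phi e) p) dp).
by rewrite diff_loc_base.
Qed.

Lemma push_base_surj p w : exists v, push (base : DB -> B) p v = w.
Proof.
have [phi [e [mphi fe dp _]]] := chart_at_frame p.
exists (tvec (frame_chart phi e) p (row_mx (tcoord phi (base p) w) 0)).
by rewrite push_base_tvec // row_mxKl tvec_tcoord.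
Qed.

(** In a frame chart the projection to the base is [lsubmx], so that its kernel
    consists of the vectors along the fibre coordinates. *)
Lemma vertical_tcoord phi e p v : max_atlas B phi -> smooth_frame u E phi e ->
  dom phi (base p) -> push (base : DB -> B) p v = 0 ->
  v = tvec (frame_chart phi e) p (row_mx 0 (rsubmx (tcoord (frame_chart phi e) p v))).
Proof.
move=> mphi fe dp v0; have mc := frame_chart_max mphi fe.
have dp' : dom (frame_chart phi e) p by exact: dp.
rewrite -[LHS](tvec_tcoord leD v mc dp'); congr tvec.
set w := tcoord _ _ _; rewrite -[LHS]hsubmxK; congr row_mx.
rewrite -(@diff_loc_base phi e p) //.
rewrite -(tcoord_push leD leB v (smooth_base p) mc mphi dp' dp).
by rewrite v0 /tcoord linear0.
Qed.

End DualBundleCharts.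

Section Lines.
Context {R : realType} {n m : nat} {X : charted R n} {Y : charted R m}.
Hypotheses (leX : locally_euclidean X) (leY : locally_euclidean Y).

(** For straight lines in the fibres of a dual bundle, along which the derivative
    can be computed without a local expression of [f]. *)
Lemma push_line (f : X -> Y) (c : R -> X) phi psi v w : smooth_at f (c 0) ->
  max_atlas X phi -> max_atlas Y psi -> (forall t, dom phi (c t)) ->
  (forall t, dom psi (f (c t))) ->
  (forall t, phi (c t) = phi (c 0) + t *: v) ->
  (forall t, psi (f (c t)) = psi (f (c 0)) + t *: w) ->
  push f (c 0) (tvec phi (c 0) v) = tvec psi (f (c 0)) w.
Proof.
move=> sf mphi mpsi dc dfc ec efc.
rewrite (push_tvec leX leY v sf mphi mpsi (dc 0) (dfc 0)); congr tvec.
have dL := smooth_at_loc sf mphi mpsi (dc 0) (dfc 0).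
rewrite -deriveE //; set L := loc _ _.
have EL t : L (t *: v + phi (c 0)) = psi (f (c 0)) + t *: w.
  rewrite addrC -ec -efc; exact: (locE _ (max_chart mphi) (dc t)).
have EL0 : L (phi (c 0)) = psi (f (c 0)) by have := EL 0; rewrite !scale0r add0r addr0.
rewrite /derive; apply: cvg_lim => //; apply: cvg_near_cst.
near=> h; rewrite /= EL EL0 addrC addKr scalerA mulVf ?scale1r //.
near: h; exact: nbhs_dnbhs_neq.
Unshelve. all: by end_near. Qed.

End Lines.

(** * The Liouville form in frame charts *)

Section Liouville.
Context {R : realType} {n : nat} {X : charted R n}.
Let TX := cotangent X.
Hypotheses (leX : locally_euclidean X) (leT : locally_euclidean TX).

Lemma pairing_linear (xi : TX) a v w :
  pairing xi (a *: v + w) = a * pairing xi v + pairing xi w.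
Proof. by have [H _] := svalP xi; exact: H. Qed.

Lemma pairing_sum (xi : TX) (I : finType) (a : I -> R) (v : I -> 'rV[R]_n) :
  pairing xi (\sum_i a i *: v i) = \sum_i a i * pairing xi (v i).
Proof.
have w0 : pairing xi 0 = 0.
  by have := pairing_linear xi (-1) 0 0; rewrite scaler0 addr0 mulN1r addNr.
by elim/big_rec2: _ => // i y1 y2 _ <-; rewrite pairing_linear.
Qed.

Lemma liouville_linear : fibrewise_linear (liouville (X := X)).
Proof. by move=> xi a v w; rewrite /liouville push_is_linear pairing_linear. Qed.

Lemma tcoord_tvec_change (x : X) phi psi v : max_atlas X phi -> max_atlas X psi ->
  dom phi x -> dom psi x ->
  tcoord psi x (tvec phi x v) = 'd (loc phi psi) (phi x) v.
Proof.
move=> mphi mpsi dx dx'.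
have := tcoord_push leX leX (tvec phi x v) (smooth_at_id leX x) mphi mpsi dx dx'.
by rewrite push_id // tcoord_tvec.
Qed.

(** The smoothness of a frame is a condition on these coordinates, with [psi] in
    the atlas. *)
Definition frame_matrix (psi : chart R n X) (e : X -> 'M[R]_n) (x : X) : 'M[R]_n :=
  \matrix_i tcoord psi x (row i (e x)).

Lemma frame_matrix_unit psi (e : X -> 'M[R]_n) x : max_atlas X psi -> dom psi x ->
  row_free (e x) -> frame_matrix psi e x \in unitmx.
Proof.
move=> mpsi dx fe; apply: unitmx_inj => v.
have -> : v *m frame_matrix psi e x = tcoord psi x (v *m e x).
  rewrite !mulmx_sum_row {1}/tcoord linear_sum; apply: eq_bigr => i _.
  by rewrite linearZ rowK.
move=> /(congr1 (tvec psi x)); rewrite tvec_tcoord // {1}/tvec linear0 => /eqP.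
by rewrite -[0 in X in X -> _](mul0mx _ (e x)) => /eqP/(row_free_inj fe).
Qed.

(** Both sides have the same coordinates in the chart [psi]. *)
Lemma frame_coordinates psi (e : X -> 'M[R]_n) x v : max_atlas X psi -> dom psi x ->
  row_free (e x) ->
  v = \sum_i (tcoord psi x v *m invmx (frame_matrix psi e x)) 0 i *: row i (e x).
Proof.
move=> mpsi dx fe; have uM := frame_matrix_unit mpsi dx fe.
rewrite -[LHS](tvec_tcoord leX v mpsi dx) -[RHS](tvec_tcoord leX _ mpsi dx).
congr tvec; rewrite [in RHS]/tcoord linear_sum.
rewrite -[LHS](mulmxKV uM) mulmx_sum_row; apply: eq_bigr => i _.
by rewrite linearZ rowK.
Qed.

Lemma liouville_tvec phi e psi (xi : TX) v : max_atlas X phi ->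
  smooth_frame (@id X) (fun=> setT) phi e -> max_atlas X psi ->
  dom phi (base xi) -> dom psi (base xi) ->
  liouville xi (tvec (frame_chart phi e) xi v) =
  \sum_i ('d (loc phi psi) (phi (base xi)) (lsubmx v)
            *m invmx (frame_matrix psi e (base xi))) 0 i *
         pairing xi (row i (e (base xi))).
Proof.
move=> mphi fe mpsi d1 d2; have [rf _ _] := fe.
rewrite /liouville (push_base_tvec leX leT _ mphi fe d1).
rewrite {1}(frame_coordinates (tvec phi (base xi) (lsubmx v)) mpsi d2 (rf _ d1)).
rewrite pairing_sum; apply: eq_bigr => i _.
by rewrite (tcoord_tvec_change _ mphi mpsi d1 d2).
Qed.

(** By [liouville_tvec] the components of the Liouville form in a frame chart are
    sums of products of the fibre coordinates with smooth functions of the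
    base point.  The auxiliary chart [psi] is needed because the frame is known
    to be smooth in the charts of the atlas, to which [phi] need not belong. *)
Lemma liouville_differentiable (xi : TX) :
  differentiable_form (liouville (X := X)) xi.
Proof.
have [phi [e [mphi fe d1 cE]]] := chart_at_frame leT xi.
move=> v; rewrite cE {cE}.
have [apsi d2] := chart_atP leX (base xi); have mpsi := leX.2 _ apsi.
set psi := chart_at (base xi) in apsi d2 mpsi.
have mc := frame_chart_max leT mphi fe.
have dc : dom (frame_chart phi e) xi by exact: d1.
set c := frame_chart phi e in mc dc *.
have cphi := max_chart mphi.
pose T := loc phi psi; pose g (y : 'rV[R]_(n + n)) := lsubmx y.
have gc : g (c xi) = phi (base xi) by rewrite /g row_mxKl.
pose M (z : 'rV[R]_n) : 'M[R]_n :=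
  \matrix_(i, j) loc phi (fun b => tcoord psi b (row i (e b))) z 0 j.
have ME b : dom phi b -> M (phi b) = frame_matrix psi e b.
  move=> db; apply/matrixP => i j; rewrite !mxE.
  by rewrite (locE (fun b => tcoord psi b (row i (e b))) cphi db).
have sM i j : smooth_near (fun z => M z i j : R) (phi (base xi)).
  have [_ _ sfr] := fe.
  have N : forall z, (phi @` (dom phi `&` (@id X) @^-1` dom psi)) z ->
      nbhs z (phi @` (dom phi `&` (@id X) @^-1` dom psi)).
    move=> _ [b [db db'] <-].
    exact (near_chart leX mphi db (near_dom leX mpsi db')).
  have sn : smooth_near (loc phi (fun b => tcoord psi b (row i (e b)))) (phi (base xi)).
    exists (phi @` (dom phi `&` (@id X) @^-1` dom psi)); last exact: sfr.
    by split; [rewrite openE => z /N|exists (base xi)].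
  have /smooth_near_rV/(_ j) := sn; apply: smooth_near_ext => z.
  by rewrite /M mxE.
have sI i j : smooth_near (fun z => invmx (M z) i j : R) (phi (base xi)).
  apply: smooth_near_invmx => //; rewrite ME //.
  by have [rf _ _] := fe; exact: frame_matrix_unit mpsi d2 (rf _ d1).
have sT : smooth_near T (phi (base xi)) by exact: (smooth_transition leX).
pose h i (z : 'rV[R]_n) : R := \sum_j 'D_(lsubmx v) T z 0 j * invmx (M z) j i.
have sh i : smooth_near (h i) (phi (base xi)).
  apply: smooth_near_sum => j; apply: smooth_near_mul => //.
  by have /smooth_near_rV/(_ j) := smooth_near_derive (lsubmx v) sT.
pose W (y : 'rV[R]_(n + n)) : R := \sum_i h i (g y) * (rsubmx y) 0 i.
have sW : smooth_near W (c xi).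
  apply: smooth_near_sum => i; apply: smooth_near_mul.
    apply: (@smooth_near_comp_R _ _ _ g (h i)).
      exact: (smooth_near_linear (@lsubmx R 1 n n)).
    by rewrite gc.
  by have /smooth_near_rV/(_ i) := smooth_near_linear (@rsubmx R 1 n n) (c xi).
apply: near_eq_differentiable (smooth_near_differentiable sW).
have N1 : nbhs xi ((base : TX -> X) @^-1` (dom psi)).
  exact (smooth_at_near_dom leX (smooth_base leX leT xi) mpsi d2).
have N2 : nbhs (phi (base xi)) [set z | smooth_near T z] := smooth_near_near sT.
have N3 : nbhs xi [set q : TX | smooth_near T (phi (base q))].
  have N4 := near_coord leX mphi d1 N2.
  exact: (smooth_base leX leT xi).1 _ N4.
have N4 : nbhs xi ((base : TX -> X) @^-1` (dom psi) `&`
    [set q : TX | smooth_near T (phi (base q))]).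
  exact: filterI N1 N3.
apply: filterS (near_chart leT mc dc N4) => _ [q [dq [dq' sTq]] <-].
rewrite (locE _ (max_chart mc) dq).
rewrite (liouville_tvec v mphi fe mpsi (dq : dom phi (base q)) dq') /W.
have -> : g (c q) = phi (base q) by rewrite /g row_mxKl.
apply: eq_bigr => i _; rewrite row_mxKr [in LHS]mxE; congr (_ * _).
rewrite /h [in RHS]mxE; apply: eq_bigr => j _.
by rewrite (ME _ dq) deriveE //; exact: smooth_near_differentiable.
Qed.

End Liouville.

(** * Composable pairs of a Lie groupoid *)

Lemma smooth_manifold_le (R : realType) n (X : charted R n) :
  smooth_manifold X -> locally_euclidean X.
Proof. by case. Qed.

Section LieGroupoid.
Context {R : realType} {m r : nat} {M : charted R m} {G : charted R (m + r)}.
Context {Gm : groupoid G M}.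
Hypothesis lieG : lie_groupoid Gm.
Let Comp := composables Gm.

Lemma objects_le : locally_euclidean M.
Proof. by case: lieG => /smooth_manifold_le. Qed.

Lemma arrows_le : locally_euclidean G.
Proof. by case: lieG => _ /smooth_manifold_le. Qed.

Lemma smooth_src g : smooth_at (src Gm) g.
Proof. by case: lieG => _ _ _ [[H _] _] _; exact: smooth_smooth_at arrows_le objects_le _ _ H. Qed.

Lemma smooth_tgt g : smooth_at (tgt Gm) g.
Proof. by case: lieG => _ _ _ [_ [H _]] _; exact: smooth_smooth_at arrows_le objects_le _ _ H. Qed.

Lemma smooth_ginv g : smooth_at (ginv Gm) g.
Proof. by case: lieG => _ _ _ _ [_ H _]; exact: smooth_smooth_at arrows_le arrows_le _ _ H. Qed.

Lemma push_src_surj g w : exists v, push (src Gm) g v = w.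
Proof. by case: lieG => _ _ _ [[_ H] _] _; exact: H. Qed.

Let GG := prod_manifold G G.
Let leGG : locally_euclidean GG := prod_locally_euclidean arrows_le arrows_le.
Let src1 (p : GG) : M := src Gm (prod_fst p).
Let tgt2 (p : GG) : M := tgt Gm (prod_snd p).

Let smooth_src1 p : smooth_at src1 p.
Proof.
apply: (smooth_at_comp leGG arrows_le (smooth_prod_fst arrows_le arrows_le p)); exact: smooth_src.
Qed.

Let smooth_tgt2 p : smooth_at tgt2 p.
Proof.
apply: (smooth_at_comp leGG arrows_le (smooth_prod_snd arrows_le arrows_le p)); exact: smooth_tgt.
Qed.

Let push_src1 p v : push src1 p v = push (src Gm) p.1 (push (@prod_fst _ _ _ G G) p v).
Proof. exact: (push_comp leGG arrows_le objects_le v (smooth_prod_fst arrows_le arrows_le p) (smooth_src _)). Qed.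

Let push_tgt2 p v : push tgt2 p v = push (tgt Gm) p.2 (push (@prod_snd _ _ _ G G) p v).
Proof. exact: (push_comp leGG arrows_le objects_le v (smooth_prod_snd arrows_le arrows_le p) (smooth_tgt _)). Qed.

Let dimE : (m + r + (m + r) = m + r + r + m)%N.
Proof. by rewrite addnA addnAC. Qed.

Let dim_le : (m + r + r <= m + r + (m + r))%N.
Proof. by rewrite dimE leq_addr. Qed.

Let transversal (p : GG) : src1 p = tgt2 p ->
  forall c, exists v, push src1 p v - push tgt2 p v = c.
Proof.
move=> _ c; have [w1 <-] := push_src_surj p.1 c.
have [v [e1 e2]] := prod_push_surj arrows_le arrows_le p w1 0.
by exists v; rewrite push_src1 push_tgt2 e1 e2 push0 subr0.
Qed.

Let sliced (p : GG) : src1 p = tgt2 p -> exists phi, [/\ max_atlas GG phi,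
  slice_chart [set p : GG | src Gm p.1 = tgt Gm p.2] (m + r + r) phi & dom phi p].
Proof.
move=> e; exact: (equalizer_slice dimE leGG objects_le (smooth_src1 p) (smooth_tgt2 p) e
  (transversal e)).
Qed.

Lemma composables_le : locally_euclidean Comp.
Proof. exact: (submanifold_locally_euclidean leGG dim_le sliced). Qed.

Let incl (p : Comp) : GG := sub_val p.

Let smooth_incl p : smooth_at incl p.
Proof. exact: (smooth_sub_val leGG dim_le sliced). Qed.

Lemma smooth_pr1 (p : Comp) : smooth_at (pr1 (Gm := Gm)) p.
Proof.
exact: (smooth_at_comp composables_le leGG (smooth_incl p) (smooth_prod_fst arrows_le arrows_le _)).
Qed.

Lemma smooth_pr2 (p : Comp) : smooth_at (pr2 (Gm := Gm)) p.
Proof.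
exact: (smooth_at_comp composables_le leGG (smooth_incl p) (smooth_prod_snd arrows_le arrows_le _)).
Qed.

Lemma smooth_mulc (p : Comp) : smooth_at (mulc (Gm := Gm)) p.
Proof.
case: lieG => _ _ _ _ [_ _ H]; exact: smooth_smooth_at composables_le arrows_le _ _ H.
Qed.

Let push_pr1 p v : push (pr1 (Gm := Gm)) p v =
  push (@prod_fst _ _ _ G G) (incl p) (push incl p v).
Proof.
exact: (push_comp composables_le leGG arrows_le v (smooth_incl p) (smooth_prod_fst arrows_le arrows_le _)).
Qed.

Let push_pr2 p v : push (pr2 (Gm := Gm)) p v =
  push (@prod_snd _ _ _ G G) (incl p) (push incl p v).
Proof.
exact: (push_comp composables_le leGG arrows_le v (smooth_incl p) (smooth_prod_snd arrows_le arrows_le _)).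
Qed.

Lemma push_pr_inj (p : Comp) v v' :
  push (pr1 (Gm := Gm)) p v = push (pr1 (Gm := Gm)) p v' ->
  push (pr2 (Gm := Gm)) p v = push (pr2 (Gm := Gm)) p v' -> v = v'.
Proof.
rewrite !push_pr1 !push_pr2 => e1 e2.
have e := prod_push_inj arrows_le arrows_le e1 e2.
apply/eqP; rewrite -subr_eq0; apply/eqP.
apply: (push_sub_val_inj leGG dim_le sliced (p := p)).
by apply: etrans (pushB incl p v v') _; rewrite e subrr.
Qed.

(** The source being a submersion, the two maps of which the composable pairs are
    the equalizer are transversal. *)
Lemma push_pr_surj (p : Comp) w1 w2 :
  push (src Gm) (pr1 p) w1 = push (tgt Gm) (pr2 p) w2 ->
  exists v, push (pr1 (Gm := Gm)) p v = w1 /\ push (pr2 (Gm := Gm)) p v = w2.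
Proof.
move=> e; have [w [e1 e2]] := prod_push_surj arrows_le arrows_le (incl p) w1 w2.
have ew : push src1 (incl p) w = push tgt2 (incl p) w.
  by rewrite push_src1 push_tgt2 e1 e2.
have [v ev] := equalizer_tangent (p := p) dimE leGG objects_le smooth_src1 smooth_tgt2
  transversal ew.
exists v; split.
  apply: etrans (push_pr1 p v) _; apply: etrans _ e1.
  exact: (congr1 (push (@prod_fst _ _ _ G G) (incl p)) ev).
apply: etrans (push_pr2 p v) _; apply: etrans _ e2.
exact: (congr1 (push (@prod_snd _ _ _ G G) (incl p)) ev).
Qed.

Lemma push_src_pr1 (p : Comp) v : push (src Gm) (pr1 p) (push (pr1 (Gm := Gm)) p v) =
  push (tgt Gm) (pr2 p) (push (pr2 (Gm := Gm)) p v).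
Proof.
apply: etrans (esym (push_comp composables_le arrows_le objects_le v (smooth_pr1 p) (smooth_src _))) _.
apply: etrans (push_comp composables_le arrows_le objects_le v (smooth_pr2 p) (smooth_tgt _)).
by congr (push _ p v); apply/funext => q; exact: (svalP q).
Qed.

(** A tangent vector at a composable pair is determined by its two projections, so
    there is a single candidate for the value that [on_pair] selects. *)
Lemma on_pairE (Z : pointedType) (F : Comp -> 'rV[R]_(m + r + r) -> Z) (p : Comp) v :
  on_pair F (pr1 p) (pr2 p) (push (pr1 (Gm := Gm)) p v) (push (pr2 (Gm := Gm)) p v) =
  F p v.
Proof.
rewrite /on_pair; set S := [set z | _].
have : exists z, S z.
  by exists (F p v), p, v; split=> //; rewrite /pr1 /pr2 -surjective_pairing.
move/getPex => [p' [v' [ep e1 e2 ->]]].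
have epp : p' = p.
  apply: eq_sig_hprop => [x|]; first exact: Prop_irrelevance.
  by rewrite [LHS]ep /pr1 /pr2 -surjective_pairing.
subst p'; congr (F p); exact: push_pr_inj e1 e2.
Qed.

Lemma smooth_to_composables l (Z : charted R l) (f : Z -> Comp) z :
  locally_euclidean Z -> smooth_at (pr1 (Gm := Gm) \o f) z ->
  smooth_at (pr2 (Gm := Gm) \o f) z -> smooth_at f z.
Proof.
move=> leZ s1 s2; apply: (smooth_to_sub leGG dim_le sliced leZ).
have := smooth_pair arrows_le arrows_le leZ s1 s2; congr (smooth_at _ z).
by apply/funext => z'; rewrite /= /pr1 /pr2 -surjective_pairing.
Qed.

Lemma groupoidP : groupoid_axioms Gm. Proof. by case: lieG. Qed.

Lemma divide_composable (q : Comp) :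
  src Gm (mulc q) = tgt Gm (ginv Gm (pr2 q)).
Proof.
have [_ mulE _ _ invE] := groupoidP.
have [-> _] := mulE _ _ (svalP q : src Gm (pr1 q) = tgt Gm (pr2 q)).
by have [_ ->] := invE (pr2 q).
Qed.

(** The map [(g, h) |-> (g h, h^-1)], whose product is again [g]. *)
Definition divide (q : Comp) : Comp :=
  exist (fun p : GG => src Gm p.1 = tgt Gm p.2) (mulc q, ginv Gm (pr2 q))
    (divide_composable q).

Lemma smooth_divide q : smooth_at divide q.
Proof.
apply: smooth_to_composables; first exact: composables_le.
  exact: smooth_mulc.
exact: (smooth_at_comp composables_le arrows_le (smooth_pr2 q) (smooth_ginv _)).
Qed.

Lemma mulc_divide q : mulc (divide q) = pr1 q.
Proof.
have [_ _ mulA mul1 invE] := groupoidP.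
have e : src Gm (pr1 q) = tgt Gm (pr2 q) := svalP q.
have [e1 e2 e3 e4] := invE (pr2 q).
apply: etrans (mulA _ _ _ e (esym e2)) _.
by rewrite e4 -e; have [_ ->] := mul1 (pr1 q).
Qed.

(** Right multiplication by an arrow is injective on tangent vectors, because
    right multiplication by the inverse arrow undoes it: [divide] maps the vector
    [(b, 0)] to [(m_* (b, 0), 0)]. *)
Lemma push_mulc_inj (p : Comp) v : push (pr2 (Gm := Gm)) p v = 0 ->
  push (mulc (Gm := Gm)) p v = 0 -> v = 0.
Proof.
move=> e2 em; suff e1 : push (pr1 (Gm := Gm)) p v = 0.
  apply: (@push_pr_inj p); first exact: etrans e1 (esym (push0 _ _)).
  exact: etrans e2 (esym (push0 _ _)).
have E : mulc (Gm := Gm) \o divide = pr1 (Gm := Gm).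
  by apply/funext => q; exact: mulc_divide.
rewrite -E; apply: etrans (push_comp composables_le composables_le arrows_le v
  (smooth_divide p) (smooth_mulc _)) _.
suff -> : push divide p v = 0 by exact: push0.
apply: (@push_pr_inj (divide p)); apply: etrans _ (esym (push0 _ _)).
  apply: etrans (esym (push_comp composables_le composables_le arrows_le v
    (smooth_divide p) (smooth_pr1 _))) _.
  exact: em.
apply: etrans (esym (push_comp composables_le composables_le arrows_le v
  (smooth_divide p) (smooth_pr2 _))) _.
apply: etrans (push_comp composables_le arrows_le arrows_le v (smooth_pr2 p) (smooth_ginv _)) _.
by apply: etrans (congr1 _ e2) _; exact: push0.
Qed.

End LieGroupoid.

(** * The Liouville form on the deformed groupoid *)

(** Transposed, [c] is to lie in the row space of [B^T], which is the kernel of its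
    cokernel. *)
Lemma factor_linear (F : fieldType) a b (B : 'M[F]_(a, b)) (c : 'cV[F]_a) :
  (forall u : 'rV_a, u *m B = 0 -> u *m c = 0) -> exists eta, B *m eta = c.
Proof.
move=> H; have : (c^T <= B^T)%MS.
  rewrite submxE; apply/eqP; apply: trmx_inj; rewrite trmx_mul trmxK trmx0.
  apply/row_matrixP => i; rewrite row0 row_mul; apply: H.
  rewrite -row_mul (_ : _ *m B = 0) ?row0 //.
  by apply: trmx_inj; rewrite trmx_mul trmxK mulmx_coker trmx0.
by move/submxP => [e ce]; exists e^T; rewrite -[c]trmxK ce trmx_mul trmxK.
Qed.

Section DeformedCotangent.
Context {R : realType} {m r : nat} {M : charted R m} {G : charted R (m + r)}.
Context {Gm : groupoid G M}.
Variable gamma : composables Gm -> 'rV[R]_(m + r + r) -> R.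
Variable D : groupoid (cotangent G) (dual_algebroid Gm).
Hypotheses (lieG : lie_groupoid Gm) (gamma_smooth : smooth_form1 gamma).
Hypotheses (D_def : deformed_cotangent gamma D) (lieD : lie_groupoid D).
Let TG := cotangent G.
Let DA := dual_algebroid Gm.
Let leTG : locally_euclidean TG := arrows_le lieD.
Let leDA : locally_euclidean DA := objects_le lieD.
Let leCG : locally_euclidean (composables Gm) := composables_le lieG.
Let leCD : locally_euclidean (composables D) := composables_le lieD.

Lemma base_src (xi : TG) : base (src D xi) = src Gm (base xi).
Proof. by case: D_def => /(_ xi)[]. Qed.

Lemma base_tgt (xi : TG) : base (tgt D xi) = tgt Gm (base xi).
Proof. by case: D_def => _ /(_ xi)[]. Qed.

Lemma proj_composable (q : composables D) :
  src Gm (base (pr1 q)) = tgt Gm (base (pr2 q)).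
Proof. by rewrite -base_src -base_tgt; congr base; exact: (svalP q). Qed.

Definition proj_arrows (q : composables D) : composables Gm :=
  exist (fun p : prod_manifold G G => src Gm p.1 = tgt Gm p.2)
    (base (pr1 q), base (pr2 q)) (proj_composable q).

Let smooth_baseG (xi : TG) : smooth_at (base : TG -> G) xi :=
  smooth_base (arrows_le lieG) leTG xi.

Lemma smooth_proj q : smooth_at proj_arrows q.
Proof.
apply: (smooth_to_composables lieG leCD).
  exact: (smooth_at_comp leCD leTG (smooth_pr1 lieD q) (smooth_baseG _)).
exact: (smooth_at_comp leCD leTG (smooth_pr2 lieD q) (smooth_baseG _)).
Qed.

Lemma push_pr1_proj q v :
  push (pr1 (Gm := Gm)) (proj_arrows q) (push proj_arrows q v) =
  push (base : TG -> G) (pr1 q) (push (pr1 (Gm := D)) q v).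
Proof.
apply: etrans (esym (push_comp leCD leCG (arrows_le lieG) v (smooth_proj q) (smooth_pr1 lieG _))) _.
exact: (push_comp leCD leTG (arrows_le lieG) v (smooth_pr1 lieD q) (smooth_baseG _)).
Qed.

Lemma push_pr2_proj q v :
  push (pr2 (Gm := Gm)) (proj_arrows q) (push proj_arrows q v) =
  push (base : TG -> G) (pr2 q) (push (pr2 (Gm := D)) q v).
Proof.
apply: etrans (esym (push_comp leCD leCG (arrows_le lieG) v (smooth_proj q) (smooth_pr2 lieG _))) _.
exact: (push_comp leCD leTG (arrows_le lieG) v (smooth_pr2 lieD q) (smooth_baseG _)).
Qed.

Lemma base_mulc q : base (mulc q : TG) = mulc (proj_arrows q).
Proof. by case: D_def => _ _ /(_ _ _ (svalP q))[]. Qed.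

Lemma push_mulc_proj q v :
  push (mulc (Gm := Gm)) (proj_arrows q) (push proj_arrows q v) =
  push (base : TG -> G) (mulc q) (push (mulc (Gm := D)) q v).
Proof.
apply: etrans (esym (push_comp leCD leCG (arrows_le lieG) v (smooth_proj q) (smooth_mulc lieG _))) _.
apply: etrans _ (push_comp leCD leTG (arrows_le lieG) v (smooth_mulc lieD q) (smooth_baseG _)).
by congr (push _ q v); apply/funext => q'; exact: (esym (base_mulc q')).
Qed.

(** The definition of the multiplication of the deformed groupoid says that the
    Liouville form is multiplicative up to [gamma]. *)
Lemma liouville_mulc q v :
  liouville (pr1 q : TG) (push (pr1 (Gm := D)) q v) +
  liouville (pr2 q : TG) (push (pr2 (Gm := D)) q v) +
  gamma (proj_arrows q) (push proj_arrows q v) =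
  liouville (mulc q : TG) (push (mulc (Gm := D)) q v).
Proof.
rewrite /liouville -push_pr1_proj -push_pr2_proj -push_mulc_proj.
set p := proj_arrows q; set w := push proj_arrows q v.
case: D_def => _ _ /(_ _ _ (svalP q))[_ H] _ _.
have := H _ _ (push_src_pr1 lieG p w).
rewrite (on_pairE lieG (push (mulc (Gm := Gm))) p w) (on_pairE lieG gamma p w).
by move=> <-.
Qed.

Lemma gamma_differentiable p : differentiable_form gamma p.
Proof.
have [_ sg] := gamma_smooth; have [ap dp] := chart_atP leCG p.
by move=> v; have [+ _] := sg _ ap v 1%N; apply; exists p.
Qed.

Lemma omega_can_mulc q v z :
  pullback2 (pr1 (Gm := D)) (@omega_can R _ G) q v z +
  pullback2 (pr2 (Gm := D)) (@omega_can R _ G) q v z +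
  pullback2 proj_arrows (ext_d gamma) q v z =
  pullback2 (mulc (Gm := D)) (@omega_can R _ G) q v z.
Proof.
have lT := @liouville_differentiable R _ G (arrows_le lieG) leTG.
have [lg _] := gamma_smooth.
have ll := @liouville_linear R _ G.
have [d1 <-] := ext_d_pullback leCD leTG (smooth_pr1 lieD) ll (lT (pr1 q)).
have [d2 <-] := ext_d_pullback leCD leTG (smooth_pr2 lieD) ll (lT (pr2 q)).
have [d3 <-] := ext_d_pullback leCD leTG (smooth_mulc lieD) ll (lT (mulc q)).
have [d4 <-] := ext_d_pullback leCD leCG smooth_proj lg (gamma_differentiable (proj_arrows q)).
have [d12 <-] := ext_dD leCD d1 d2.
have [_ <-] := ext_dD leCD d12 d4.
congr (ext_d _ q v z); apply/funext => q'; apply/funext => v'.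
exact: liouville_mulc.
Qed.

Lemma simp_d2_omega omegaB q v z :
  simp_d2 D (fun xi v z => omega_can xi v z
       + pullback2 (base : cotangent G -> G) omegaB xi v z) q v z =
  simp_d2 Gm omegaB (proj_arrows q) (push proj_arrows q v) (push proj_arrows q z)
  - ext_d gamma (proj_arrows q) (push proj_arrows q v) (push proj_arrows q z).
Proof.
have := omega_can_mulc q v z; rewrite /simp_d2 /pullback2.
rewrite !push_pr1_proj !push_pr2_proj !push_mulc_proj -base_mulc => <-.
set a1 := omega_can (pr1 q) _ _; set a2 := omega_can (pr2 q) _ _.
set g := ext_d gamma _ _ _.
set b1 := omegaB (base (pr1 q)) _ _; set b2 := omegaB (base (pr2 q)) _ _.
set b3 := omegaB _ _ _.
by clearbody a1 a2 g b1 b2 b3; ring.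
Qed.

End DeformedCotangent.

(** * Lifting composable pairs and their tangent vectors *)

Section Surjectivity.
Context {R : realType} {m r : nat} {M : charted R m} {G : charted R (m + r)}.
Context {Gm : groupoid G M}.
Variable gamma : composables Gm -> 'rV[R]_(m + r + r) -> R.
Variable D : groupoid (cotangent G) (dual_algebroid Gm).
Hypotheses (lieG : lie_groupoid Gm) (gamma_smooth : smooth_form1 gamma).
Hypotheses (D_def : deformed_cotangent gamma D) (lieD : lie_groupoid D).
Let TG := cotangent G.
Let DA := dual_algebroid Gm.
Let leTG : locally_euclidean TG := arrows_le lieD.
Let leDA : locally_euclidean DA := objects_le lieD.

Lemma add_covector_linear (xi : TG) (t : R) (eta : 'cV[R]_(m + r)) :
  linear_form_on setT (fun w => pairing xi w + t * (w *m eta) 0 0).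
Proof.
split=> [a v w _ _|v []//].
rewrite pairing_linear mulmxDl -scalemxAl !mxE; ring.
Qed.

Definition add_covector (xi : TG) (t : R) (eta : 'cV[R]_(m + r)) : TG :=
  exist (fun p : G * ('rV[R]_(m + r) -> R) => linear_form_on setT p.2)
    (base xi, fun w => pairing xi w + t * (w *m eta) 0 0) (add_covector_linear xi t eta).

Lemma pairing_add_covector xi t eta w :
  pairing (add_covector xi t eta) w = pairing xi w + t * (w *m eta) 0 0.
Proof. by []. Qed.

Lemma add_covector0 xi eta : add_covector xi 0 eta = xi.
Proof.
apply: eq_sig_hprop => [x|]; first exact: Prop_irrelevance.
rewrite /= [RHS]surjective_pairing; congr pair.
by apply/funext => w; rewrite mul0r addr0.
Qed.

Lemma zero_covector_linear : linear_form_on setT (fun _ : 'rV[R]_(m + r) => 0 : R).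
Proof. by split=> [a v w _ _|//]; rewrite mulr0 addr0. Qed.

Definition zero_covector (g : G) : TG :=
  exist (fun p : G * ('rV[R]_(m + r) -> R) => linear_form_on setT p.2)
    (g, fun=> 0) zero_covector_linear.

Lemma dual_algebroid_eq (alpha beta : DA) : base alpha = base beta ->
  (forall b, algebroid Gm (base alpha) b -> pairing alpha b = pairing beta b) ->
  alpha = beta.
Proof.
move=> eb ep; apply: eq_sig_hprop => [x|]; first exact: Prop_irrelevance.
rewrite [LHS]surjective_pairing [RHS]surjective_pairing; congr pair; first exact: eb.
apply/funext => b; have [_ z1] := svalP alpha; have [_ z2] := svalP beta.
have [ab|nab] := pselect (algebroid Gm (base alpha) b); first exact: ep.
apply: (etrans (z1 b nab)); apply: esym; apply: z2.
by move: nab; rewrite eb.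
Qed.

(** The unit law [m (1_(t xi), xi) = xi] of the deformed groupoid, evaluated on
    the vector [(b, 0)] with [b] in the algebroid: the unit covector pairs with
    [b] as [tgt D xi] does, and the product is [xi] itself. *)
Lemma pairing_tgt (xi : TG) (p : composables Gm) v :
  pr1 p = ident Gm (tgt Gm (base xi)) -> pr2 p = base xi ->
  push (pr2 (Gm := Gm)) p v = 0 ->
  pairing (tgt D xi) (push (pr1 (Gm := Gm)) p v) =
  pairing xi (push (mulc (Gm := Gm)) p v) - gamma p v.
Proof.
move=> e1 e2 v2; have [D1 D2 D3 D4 _] := D_def.
have [idE _ _ mul1 _] := groupoidP lieD.
set alpha := tgt D xi; have [b1 _] := D2 xi.
have [bi ui] := D4 alpha.
have comp : src D (ident D alpha) = tgt D xi by have [] := idE alpha.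
have [_ H] := D3 _ _ comp.
have [E _] := mul1 xi; rewrite -/alpha in E; rewrite E in H.
have k1 : base (ident D alpha) = pr1 p by rewrite bi b1 e1.
rewrite k1 -e2 in H.
have := H _ _ (push_src_pr1 lieG p v).
rewrite (on_pairE lieG (push (mulc (Gm := Gm))) p v) (on_pairE lieG gamma p v).
rewrite v2 => ->.
have sb : push (src Gm) (ident Gm (base alpha)) (push (pr1 (Gm := Gm)) p v) = 0.
  rewrite b1 -e1; apply: etrans (push_src_pr1 lieG p v) _.
  by rewrite v2 push0.
rewrite ui /u0 sb push0 subr0.
have -> : pairing xi 0 = 0.
  by have := pairing_linear xi (-1) 0 0; rewrite scaler0 addr0 mulN1r addNr.
by rewrite addr0 addrK.
Qed.

Lemma unit_composable h : src Gm (ident Gm (tgt Gm h)) = tgt Gm h.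
Proof. by have [idE _ _ _ _] := groupoidP lieG; have [] := idE (tgt Gm h). Qed.

Definition unit_pair (h : G) : composables Gm :=
  exist (fun p : prod_manifold G G => src Gm p.1 = tgt Gm p.2)
    (ident Gm (tgt Gm h), h) (unit_composable h).

(** The vectors [b] and [0] both project to zero on the objects. *)
Lemma algebroid_lift h b : algebroid Gm (tgt Gm h) b ->
  exists v, push (pr1 (Gm := Gm)) (unit_pair h) v = b /\
            push (pr2 (Gm := Gm)) (unit_pair h) v = 0.
Proof.
move=> ab; apply: (push_pr_surj lieG); rewrite push0; exact: ab.
Qed.

(** A linear function of the vectors [(b, 0)] is the composition of right
    translation with a linear form, as right translation is injective. *)
Lemma translate_form (h : G) (c : 'rV[R]_(m + r + r) -> R) :
  let p := unit_pair h in
  (forall a v w, c (a *: v + w) = a * c v + c w) ->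
  exists eta : 'cV[R]_(m + r), forall v, push (pr2 (Gm := Gm)) p v = 0 ->
    (push (mulc (Gm := Gm)) p v *m eta) 0 0 = c v.
Proof.
move=> p lc.
pose K := kermx (lin1_mx ('d (loc (chart_at p) (chart_at (pr2 p) \o pr2 (Gm := Gm)))
  (chart_at p p))).
pose L := lin1_mx ('d (loc (chart_at p) (chart_at (mulc p) \o mulc (Gm := Gm)))
  (chart_at p p)).
have LE v : v *m L = push (mulc (Gm := Gm)) p v by rewrite mul_rV_lin1.
have KE v : push (pr2 (Gm := Gm)) p v = 0 <-> (v <= K)%MS.
  split=> [e|/sub_kermxP]; first by apply/sub_kermxP; rewrite mul_rV_lin1.
  by rewrite mul_rV_lin1.
have c0 : c 0 = 0.
  by have := lc (-1) 0 0; rewrite scaler0 addr0 mulN1r addNr.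
have cK u : c (u *m K) = (u *m \col_i c (row i K)) 0 0.
  rewrite mulmx_sum_row mxE; elim/big_rec2: _ => // i y1 y2 _ <-.
  by rewrite lc mxE.
have [u uKL|eta He] := @factor_linear _ _ _ (K *m L) (\col_i c (row i K)).
  have uK : u *m K = 0.
    apply: (push_mulc_inj lieG (p := p)).
      by apply/KE; exact: submxMl.
    by rewrite -LE -mulmxA.
  by apply/rowP => j; rewrite (ord1 j) -cK uK c0 mxE.
exists eta => v /KE/submxP[u ->]; rewrite -LE cK -He.
by rewrite !mulmxA.
Qed.

Lemma pairing_ident (alpha : DA) b : algebroid Gm (base alpha) b ->
  pairing (ident D alpha) b = pairing alpha b.
Proof.
by case: D_def => _ _ _ /(_ alpha)[_ H] _ ab; rewrite H /u0 ab push0 subr0.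
Qed.

Lemma gamma_linear p a v w : gamma p (a *: v + w) = a * gamma p v + gamma p w.
Proof. by case: gamma_smooth => H _; exact: H. Qed.

(** The covector over the first arrow is arbitrary; the one over the second arrow
    is chosen such that its target is the source of the first. *)
Lemma proj_arrows_surj (p : composables Gm) :
  exists q, proj_arrows D_def q = p.
Proof.
have xe : src Gm (pr1 p) = tgt Gm (pr2 p) := svalP p.
pose xi1 := zero_covector (pr1 p); pose alpha := src D xi1.
have ba : base alpha = src Gm (pr1 p) by exact: base_src D_def xi1.
set h := pr2 p in xe; pose p' := unit_pair h.
(* The unit covector [ident D alpha] extends [alpha] linearly beyond the
   algebroid. *)
have [v w z|eta He] := @translate_form h (fun v =>
    pairing (ident D alpha) (push (pr1 (Gm := Gm)) p' v) + gamma p' v).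
  by rewrite push_is_linear pairing_linear gamma_linear mulrDr addrACA.
pose xi2 := add_covector (zero_covector h) 1 eta.
have e : src D xi1 = tgt D xi2.
  apply: dual_algebroid_eq; first by rewrite (base_tgt D_def) -/alpha ba.
  rewrite -/alpha ba xe => b ab; have [v [v1 v2]] := algebroid_lift ab.
  have ab' : algebroid Gm (base alpha) b by rewrite ba xe.
  have T := @pairing_tgt xi2 p' v erefl erefl v2.
  rewrite pairing_add_covector He // v1 (pairing_ident ab') in T.
  by rewrite T [pairing (zero_covector h) _]/(0 : R) add0r mul1r addrK.
exists (exist (fun p : prod_manifold TG TG => src D p.1 = tgt D p.2) (xi1, xi2) e).
apply: eq_sig_hprop => [x|]; first exact: Prop_irrelevance.
by rewrite [RHS]surjective_pairing.
Qed.

(** Along the line [xi + t eta] in a cotangent fibre, the target moves along a line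
    in a fibre of the dual of the algebroid, with a velocity that [eta]
    prescribes. *)
Lemma vertical_surj (xi : TG) c : push (base : DA -> M) (tgt D xi) c = 0 ->
  exists v, push (base : TG -> G) xi v = 0 /\ push (tgt D) xi v = c.
Proof.
move=> c0; set alpha := tgt D xi in c0; set h := base xi.
have ba : base alpha = tgt Gm h by exact: base_tgt D_def xi.
have leMG := objects_le lieG; have leGG := arrows_le lieG.
have [phi [e [mphi fe d1 _]]] := chart_at_frame leTG xi.
have [psi [f [mpsi ff d2 _]]] := chart_at_frame leDA alpha.
have cE := vertical_tcoord leMG leDA mpsi ff d2 c0.
set w := rsubmx _ in cE.
have [rff Ef _] := ff; have rf := rff _ d2; have EE := Ef _ d2.
pose p := unit_pair h.
(* The linear form on the algebroid with the value [w 0 i] on the [i]-th vector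
   of the frame [f], whose coordinates are found by [pinvmx]. *)
have [v x z|eta He] := @translate_form h (fun v =>
    (push (pr1 (Gm := Gm)) p v *m pinvmx (f (base alpha)) *m w^T) 0 0).
  by rewrite push_is_linear !mulmxDl -!scalemxAl !mxE.
pose V : 'rV[R]_(m + r + (m + r)) := row_mx 0 (\row_i (row i (e h) *m eta) 0 0).
exists (tvec (frame_chart phi e) xi V); split.
  by rewrite (push_base_tvec leGG leTG V mphi fe d1) row_mxKl /tvec linear0.
have mc := frame_chart_max leTG mphi fe; have mA := frame_chart_max leDA mpsi ff.
have sh0 := add_covector0 xi eta.
have bt t : base (tgt D (add_covector xi t eta)) = base alpha.
  by rewrite (base_tgt D_def) (base_tgt D_def).
have := @push_line _ _ _ TG DA leTG leDA (tgt D) (fun t => add_covector xi t eta)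
  (frame_chart phi e) (frame_chart psi f) V (row_mx 0 w).
rewrite sh0 cE; apply => //.
- exact: (smooth_tgt lieD).
- move=> t; rewrite -[dom _ _]/(dom psi (base (tgt D (add_covector xi t eta)))) bt.
  exact: d2.
- move=> t; rewrite /= scale_row_mx add_row_mx scaler0 addr0; congr row_mx.
  by apply/rowP => i; rewrite !mxE.
- move=> t; rewrite /= scale_row_mx add_row_mx scaler0 addr0.
  rewrite -[(sval (tgt D (add_covector xi t eta))).1]/(base _) bt; congr row_mx.
  apply/rowP => i; rewrite !mxE.
  have fi : algebroid Gm (tgt Gm h) (row i (f (base alpha))).
    by rewrite -ba; apply/EE; exact: row_sub.
  have [v [v1 v2]] := algebroid_lift fi.
  have T1 := @pairing_tgt (add_covector xi t eta) p v erefl erefl v2.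
  have T2 := @pairing_tgt xi p v erefl erefl v2.
  rewrite v1 in T1 T2; rewrite pairing_add_covector He // v1 in T1.
  rewrite -[LHS]/(pairing (tgt D (add_covector xi t eta)) (row i (f (base alpha)))) T1.
  rewrite -[X in _ = X + _]/(pairing (tgt D xi) (row i (f (base alpha)))) T2.
  rewrite [in LHS]rowE mulmxKp // -rowE !mxE; ring.
Qed.

(** Lifts of the two components of [v] are chosen independently.  The source of the
    first and the target of the second then differ by a vertical vector, which a
    vertical correction of the second lift absorbs. *)
Lemma push_proj_surj q v : exists V, push (proj_arrows D_def) q V = v.
Proof.
set p := proj_arrows D_def q in v *.
have leMG := objects_le lieG; have leGG := arrows_le lieG.
have [W1 e1] := push_base_surj leGG leTG (pr1 q) (push (pr1 (Gm := Gm)) p v).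
have [W2 e2] := push_base_surj leGG leTG (pr2 q) (push (pr2 (Gm := Gm)) p v).
have sb (xi : TG) : smooth_at (base : TG -> G) xi := smooth_base leGG leTG xi.
have sbA (al : DA) : smooth_at (base : DA -> M) al := smooth_base leMG leDA al.
have qe : src D (pr1 q) = tgt D (pr2 q) := svalP q.
have P1 : push (base : DA -> M) (src D (pr1 q)) (push (src D) (pr1 q) W1) =
    push (src Gm) (pr1 p) (push (pr1 (Gm := Gm)) p v).
  rewrite -e1.
  apply: etrans (esym (push_comp leTG leDA leMG W1 (smooth_src lieD _) (sbA _))) _.
  apply: etrans _ (push_comp leTG leGG leMG W1 (sb _) (smooth_src lieG _)).
  by congr (push _ _ W1); apply/funext => xi; exact: base_src D_def xi.
have P2 : push (base : DA -> M) (tgt D (pr2 q)) (push (tgt D) (pr2 q) W2) =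
    push (tgt Gm) (pr2 p) (push (pr2 (Gm := Gm)) p v).
  rewrite -e2.
  apply: etrans (esym (push_comp leTG leDA leMG W2 (smooth_tgt lieD _) (sbA _))) _.
  apply: etrans _ (push_comp leTG leGG leMG W2 (sb _) (smooth_tgt lieG _)).
  by congr (push _ _ W2); apply/funext => xi; exact: base_tgt D_def xi.
pose c := push (src D) (pr1 q) W1 - push (tgt D) (pr2 q) W2.
have c0 : push (base : DA -> M) (tgt D (pr2 q)) c = 0.
  rewrite /c pushB P2 -qe P1; apply/eqP; rewrite subr_eq0; apply/eqP.
  exact: push_src_pr1.
have [W [eW1 eW2]] := vertical_surj c0.
have [|V [E1 E2]] := push_pr_surj (w1 := W1) (w2 := W2 + W) lieD (p := q).
  by rewrite pushD eW2 /c addrC subrK.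
exists V; apply: (push_pr_inj lieG (p := p)).
  apply: etrans (push_pr1_proj lieG D_def lieD q V) _.
  exact: etrans (congr1 (push (base : TG -> G) (pr1 q)) E1) e1.
apply: etrans (push_pr2_proj lieG D_def lieD q V) _.
apply: etrans (congr1 (push (base : TG -> G) (pr2 q)) E2) _.
apply: etrans (pushD _ _ _ _) _.
by apply: etrans (congr1 (fun w => _ + w) eW1) _; rewrite addr0; exact: e2.
Qed.

End Surjectivity.

Theorem proposition2p15 (R : realType) (m r : nat)
    (M : charted R m) (G : charted R (m + r)) (Gm : groupoid G M)
    (gamma : composables Gm -> 'rV[R]_(m + r + r) -> R)
    (D : groupoid (cotangent G) (dual_algebroid Gm))
    (omegaB : G -> 'rV[R]_(m + r) -> 'rV[R]_(m + r) -> R)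
    (Gm_lie : lie_groupoid Gm)
    (gamma_smooth : smooth_form1 gamma)
    (D_def : deformed_cotangent gamma D)
    (D_lie : lie_groupoid D)
    (omegaB_smooth : smooth_form2 omegaB) :
  multiplicative2 D
    (fun xi v z => omega_can xi v z
       + pullback2 (base : cotangent G -> G) omegaB xi v z)
  <->
  (forall p v z, simp_d2 Gm omegaB p v z = ext_d gamma p v z).
Proof.
have key q v z :=
  simp_d2_omega Gm_lie gamma_smooth D_def D_lie omegaB q v z.
split=> [mult p v z|H q v z]; last by apply: etrans (key q v z) _; rewrite H subrr.
have [q <-] := proj_arrows_surj Gm_lie gamma_smooth D_def D_lie p.
have [V <-] := push_proj_surj Gm_lie D_def D_lie q v.
have [Z <-] := push_proj_surj Gm_lie D_def D_lie q z.
by apply/eqP; rewrite -subr_eq0 -key; apply/eqP; exact: mult.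
Qed.
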